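(* Let $n,m$ be integers with $4 \le m \le n$ and let $G = P_n \Box P_m$. Write $[1,r]$ for the set of integers $s$ with $1\le s\le r$. Then: (i) if $m=4$, then $S_{SC}(G) = [1,nm-4]\setminus\{2,3,5\}$; (ii) if $m=5$, then $S_{SC}(G) = [1,nm-5]\setminus\{2,3,5\}$; (iii) if $m\ge 6$, then $S_{SC}(G) = [1,nm-6]\setminus\{2,3,5\}$.
   Context: $P_n$ denotes the path on $n$ vertices and $G\Box H$ the cartesian product of graphs. An orientation $D$ of a graph is strong if for every ordered pair of vertices $u,v$ there is a directed path from $u$ to $v$. A $uv$-geodesic in $D$ is a shortest directed path from $u$ to $v$. A nonempty set $S\subseteq V(D)$ is convex in $D$ if for every $u,v\in S$, every vertex lying on a $uv$-geodesic or on a $vu$-geodesic belongs to $S$. The convexity number $\mathrm{con}(D)$ is the maximum cardinality of a convex set of $D$ different from $V(D)$. The strong convexity spectrum of a graph $G$ is $S_{SC}(G)=\{\mathrm{con}(D) : D \text{ is a strong orientation of } G\}$. *)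

(* Defs.v *)
From mathcomp Require Import all_boot.
Set Implicit Arguments.
Unset Strict Implicit.
Unset Printing Implicit Defensive.

(* Graphs are symmetric irreflexive relations on a finite vertex type, and
   digraphs are arbitrary relations. *)

Definition path_graph (n : nat) : rel 'I_n :=
  fun i j => (i.+1 == j :> nat) || (j.+1 == i :> nat).

Definition cartesian_product (T U : finType) (e : rel T) (f : rel U) :
    rel (T * U) :=
  fun x y => ((x.1 == y.1) && f x.2 y.2) || ((x.2 == y.2) && e x.1 y.1).

Definition orientation (T : finType) (e D : rel T) : Prop :=
  subrel D e /\ forall x y : T, e x y -> D x y (+) D y x.

(* The vertex sequence of the path is u :: p. *)
Definition dipath (T : finType) (D : rel T) (u v : T) (p : seq T) : bool :=
  [&& path D u p, uniq (u :: p) & last u p == v].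

Definition strong (T : finType) (D : rel T) : Prop :=
  forall u v : T, exists p : seq T, dipath D u v p.

Definition geodesic (T : finType) (D : rel T) (u v : T) (p : seq T) : Prop :=
  dipath D u v p /\ forall q : seq T, dipath D u v q -> size p <= size q.

(* The ordered pairs (u, v) and (v, u) are both covered, as u and v range
   over all of S. *)
Definition convex (T : finType) (D : rel T) (S : {set T}) : Prop :=
  S != set0 /\
  forall (u v : T) (p : seq T),
    u \in S -> v \in S -> geodesic D u v p -> {subset u :: p <= S}.

(* k is the maximum cardinality of a convex set other than the whole vertex
   set; no value of k qualifies when there is no such set. *)
Definition convexity_number (T : finType) (D : rel T) (k : nat) : Prop :=
  (exists S : {set T}, [/\ convex D S, S != [set: T] & #|S| = k]) /\
  (forall S : {set T}, convex D S -> S != [set: T] -> #|S| <= k).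

Definition strong_convexity_spectrum (T : finType) (e : rel T) (k : nat) :
    Prop :=
  exists D : rel T, [/\ orientation e D, strong D & convexity_number D k].

(* Main.v *)
Require Import Defs.
From Stdlib Require Import ZArith Lia Classical FinFun.
From mathcomp Require Import all_boot zify.

(** A set is convex in an orientation of the grid when it contains every vertex
    of every shortest directed walk between two of its points; everything is
    transported to orientations of rectangles of [Z * Z].

    Upper bounds.  Let [S] be convex, proper and with two vertices, and start
    from the lowest, then leftmost, vertex outside [S].  A directed walk that
    leaves [S] and comes back has at least as many vertices outside [S] as the
    distance between its ends, strongness forbids sources and sinks, and every
    vertex of [S] has two neighbours in [S].  Branching on the unknown
    neighbours, arcs and borders of the grid around the starting vertex shows by
    computation that at least [q] vertices lie outside [S] when [q] is 4, 5 or 6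
    and bounds the sides of the grid.  Minimum degree two and bipartiteness
    exclude the sizes 2, 3 and 5.

    Lower bounds.  [S] is a staircase whose rows start at the left border and
    widen downwards.  A single arc enters [S], and the return from each exit to
    the head of that arc is at most as long inside [S] as outside.  The outside
    either reaches both corners through which monotone geodesics sweep the whole
    grid, or is tiled by directed 4-cycles, which spread through the outside any
    convex set containing one of its edges.  The few sizes left over come from
    orientations of small grids checked by computation and enlarged by columns
    of directed 4-cycles: folding the new column back onto the grid maps arcs to
    arcs, so the distances do not change. *)

Set Implicit Arguments.
Unset Strict Implicit.
Unset Printing Implicit Defensive.

(** * Convex sets of digraphs *)

(** The maximum in the theorem reflects the two economical complements that the constructions use: a
    whole border line along the short side, with [m] vertices, and a 2 by 3 block in a corner, with
    6. The first is the better one up to [m = 5], the second from [m = 6] on. In the lower bounds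
    the delicate point is maximality rather than convexity of [S]: a convex set with two vertices
    that is not contained in [S] must be shown to be the whole grid, or at least not larger than
    [S]. Such a set induces a strong subdigraph, so it follows every arc that is the only way out
    of, or into, one of its vertices; the orientations are designed to contain long forced paths of
    this kind. A staircase surrounded by directed 4-cycles needs two empty rows above it, two equal
    rows at the bottom and two free columns on the right. Grids with 4 or 5 rows leave little room
    for that, which is why their small sizes rely on computed orientations. Integer coordinates
    allow a neighbourhood to be described relative to a vertex, and a grid to grow on its left
    side. *)

Section Walks.
Variables (X : Type) (D : X -> X -> Prop).
Implicit Types (A T : X -> Prop) (u v x : X) (i j l : nat).

(** Walks may repeat vertices, so that they concatenate freely; a shortest walk repeats none, hence
    geodesics are the same as for simple paths. *)
Inductive walk A : nat -> X -> X -> Prop :=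
| walk_nil u : A u -> walk A 0 u u
| walk_cons l u v x : A u -> D u v -> walk A l v x -> walk A l.+1 u x.

Definition connected A := forall u v, A u -> A v -> exists l, walk A l u v.

Definition geoconvex A T :=
  (forall u, T u -> A u) /\
  forall u v x i j, T u -> T v -> walk A i u x -> walk A j x v ->
    (forall l, walk A l u v -> i + j <= l) -> T x.

Lemma walk_first A l u v : walk A l u v -> A u.
Proof. by case. Qed.

Lemma walk_last A l u v : walk A l u v -> A v.
Proof. by elim. Qed.

Lemma walk_cat A i j u x v : walk A i u x -> walk A j x v -> walk A (i + j) u v.
Proof.
elim=> [|l {}u y {}x Au Duy _ IH] // w.
by rewrite addSn; apply: walk_cons Duy (IH w).
Qed.

Lemma walk1 A u v : A u -> A v -> D u v -> walk A 1 u v.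
Proof. by move=> Au Av Duv; apply: walk_cons Duv (walk_nil Av). Qed.

Lemma walk_rcons A l u x v : walk A l u x -> A v -> D x v -> walk A l.+1 u v.
Proof.
by move=> w Av Dxv; rewrite -addn1; apply: walk_cat w (walk1 (walk_last w) Av Dxv).
Qed.

Lemma walk_sub A A' l u v :
  (forall x, A x -> A' x) -> walk A l u v -> walk A' l u v.
Proof.
move=> sAA'; elim=> [x|l' x y z Ax Dxy _ IH]; first by move/sAA'; apply: walk_nil.
exact: walk_cons (sAA' _ Ax) Dxy IH.
Qed.

Lemma walk0E A u v : walk A 0 u v -> u = v.
Proof. by move E: 0 => n w; case: w E. Qed.

Lemma walkSE A l u v : walk A l.+1 u v -> exists x, [/\ A u, D u x & walk A l x v].
Proof.
move E: l.+1 => n w; case: w E => // l' x y z Ax Dxy w [El].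
by exists y; split; rewrite ?El.
Qed.

Lemma walk_split A i j u v :
  walk A (i + j) u v -> exists x, walk A i u x /\ walk A j x v.
Proof.
elim: i u => [|i IH] u w; first by exists u; split=> //; apply: walk_nil (walk_first w).
have [x [Au Dux /IH[y [w1 w2]]]] := walkSE w.
by exists y; split=> //; apply: walk_cons Dux w1.
Qed.

Lemma walk_min A u v : (exists l, walk A l u v) ->
  exists l, walk A l u v /\ forall l', walk A l' u v -> l <= l'.
Proof.
case=> l; elim/ltn_ind: l => l IH w.
case: (classic (exists2 l', l' < l & walk A l' u v)) => [[l' lt w']|no].
  exact: IH lt w'.
by exists l; split=> // l' w'; rewrite leqNgt; apply/negP=> lt; apply: no; exists l'.
Qed.

(** All vertices of a geodesic of [A] between two points of [T] are in [T]. Thus [T] induces a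
    strong subdigraph with the distances of [A]. *)
Lemma geoconvex_walk A T u v : geoconvex A T -> connected A -> T u -> T v ->
  exists l, walk T l u v /\ forall l', walk A l' u v -> l <= l'.
Proof.
move=> [sTA cT] cA Tu Tv.
have [l [w minl]] := walk_min (cA _ _ (sTA _ Tu) (sTA _ Tv)).
exists l; split=> //.
have P i j x : walk A i u x -> walk A j x v -> i + j = l -> walk T j x v.
  elim: j i x => [|j IH] i x wi wj E.
    by rewrite -(walk0E wj) in Tv *; apply: walk_nil.
  have [y [Ax Dxy wy]] := walkSE wj.
  apply: (walk_cons (v := y)) => //; first by apply: (cT u v x i j.+1); rewrite ?E.
  apply: IH (walk_rcons wi (walk_first wy) Dxy) wy _; lia.
exact: (P 0 l u (walk_nil (sTA _ Tu)) w).
Qed.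

(** With [geoconvex_in], the basic forcing tool: if a vertex of a convex set with at least two
    points has a single out-neighbour, that neighbour is in the set as well. *)
Lemma geoconvex_out A T u v : geoconvex A T -> connected A ->
  T u -> T v -> u <> v -> exists2 x, T x & D u x.
Proof.
move=> gT cA Tu Tv nuv; have [[|l] [w _]] := geoconvex_walk gT cA Tu Tv.
  by case: nuv; apply: walk0E w.
by have [x [_ Dux /walk_first Tx]] := walkSE w; exists x.
Qed.

Lemma geoconvex_in A T u v : geoconvex A T -> connected A ->
  T u -> T v -> u <> v -> exists2 x, T x & D x v.
Proof.
move=> gT cA Tu Tv nuv; have [[|l] [w _]] := geoconvex_walk gT cA Tu Tv.
  by case: nuv; apply: walk0E w.
rewrite -addn1 in w; have [x [/walk_last Tx w1]] := walk_split w.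
have [y [_ Dxy /walk0E Ey]] := walkSE w1.
by exists x; rewrite -?Ey.
Qed.

(* [S] is only entered at [t], and [f] is at most the number of arcs needed to
   reach [t] from outside, so no excursion outside [S] beats the way back inside. *)
Lemma convex_single_entry A S (t : X) (f : X -> nat) :
  (forall u, S u -> A u) ->
  (forall u v, A u -> A v -> D u v -> ~ S u -> S v -> v = t /\ f u <= 1) ->
  (forall u v, A u -> A v -> D u v -> ~ S u -> ~ S v -> f u <= (f v).+1) ->
  (forall u v, A u -> A v -> D u v -> S u -> ~ S v ->
     exists2 l, walk S l u t & l <= f v) ->
  geoconvex A S.
Proof.
move=> sSA entry lip exit; split=> // u v x i j Su Sv wi wj minl.
have back k y : walk A k y v -> ~ S y -> exists2 k', walk A k' t v & f y + k' <= k.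
  elim: k y => [|k IH] y w nSy; first by case: nSy; rewrite (walk0E w).
  have [z [Ay Dyz wz]] := walkSE w; have Az := walk_first wz.
  case: (classic (S z)) => Sz; last first.
    have [k' w' le] := IH _ wz Sz; exists k' => //.
    by have := lip _ _ Ay Az Dyz nSy Sz; lia.
  have [Ez f_le1] := entry _ _ Ay Az Dyz nSy Sz.
  by exists k; rewrite -?Ez //; lia.
have P a y k : walk A a u y -> S y -> walk A k y x -> a + k = i -> S x.
  elim: k a y => [|k IH] a y wa Sy wk E; first by rewrite -(walk0E wk).
  have [z [Ay Dyz wz]] := walkSE wk; have Az := walk_first wz.
  case: (classic (S z)) => Sz.
    by apply: (IH a.+1 z) => //; [apply: walk_rcons wa Az Dyz | lia].
  have [l wl le] := exit _ _ Ay Az Dyz Sy Sz.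
  have [k' wk' le'] := back _ _ (walk_cat wz wj) Sz.
  (* The detour inside [S] saves at least the exit arc. The gain is strict, as it must be, because
     convexity does not even tolerate a tie. *)
  have := minl _ (walk_cat wa (walk_cat (walk_sub sSA wl) wk')); lia.
exact: (P 0 u i (walk_nil (sSA _ Su)) Su wi erefl).
Qed.
End Walks.

(** * Orientations of the integer grid *)

Definition cell := (Z * Z)%type.

Section Grid.
Local Open Scope Z_scope.

(* Rows are numbered downwards: [H x y] says that the edge between (x, y) and
   (x + 1, y) points right, [V x y] that the edge between (x, y) and (x, y + 1)
   points down. *)
Definition arc (H V : Z -> Z -> bool) (u v : cell) : Prop :=
  [\/ [/\ v.1 = u.1 + 1, v.2 = u.2 & H u.1 u.2],
      [/\ u.1 = v.1 + 1, v.2 = u.2 & ~~ H v.1 v.2],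
      [/\ v.1 = u.1, v.2 = u.2 + 1 & V u.1 u.2] |
      [/\ v.1 = u.1, u.2 = v.2 + 1 & ~~ V v.1 v.2]].

Definition box (lo hi m : Z) (c : cell) : Prop := lo <= c.1 < hi /\ 0 <= c.2 < m.

Definition dist (u v : cell) : Z := Z.abs (u.1 - v.1) + Z.abs (u.2 - v.2).

Variables (H V : Z -> Z -> bool).
Implicit Types (A T : cell -> Prop) (u v : cell) (i j l : nat).
Let D := arc H V.

Lemma arcE u v : D u v <->
  (v.1 = u.1 + 1 /\ v.2 = u.2 /\ H u.1 u.2 = true) \/
  (v.1 = u.1 - 1 /\ v.2 = u.2 /\ H v.1 u.2 = false) \/
  (v.1 = u.1 /\ v.2 = u.2 + 1 /\ V u.1 u.2 = true) \/
  (v.1 = u.1 /\ v.2 = u.2 - 1 /\ V u.1 v.2 = false).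
Proof.
case: u v => x y [x' y']; rewrite /D /arc /=; split.
  case=> -[].
  - by move=> -> -> ->; left.
  - by move=> -> -> /negbTE h; right; left; split; [lia | ].
  - by move=> -> -> ->; right; right; left.
  - by move=> -> -> /negbTE h; right; right; right; split=> //; split=> //; lia.
case=> [[-> [-> h]]|[[Ex [-> h]]|[[-> [-> h]]|[-> [Ey h]]]]].
- exact: Or41.
- by apply: Or42; rewrite h; split=> //; lia.
- exact: Or43.
- by apply: Or44; rewrite h; split=> //; lia.
Qed.

Lemma arc_asym u v : D u v -> ~ D v u.
Proof.
move=> /arcE h1 /arcE h2; case: u v h1 h2 => x y [x' y'] /= h1 h2.
case: h1 => [[E [E' h]]|[[E [E' h]]|[[E [E' h]]|[E [E' h]]]]];
case: h2 => [[F [F' f]]|[[F [F' f]]|[[F [F' f]]|[F [F' f]]]]]; try lia.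
- by move: f; rewrite E' h.
- by move: f; rewrite E' h.
- by move: f; rewrite E h.
- by move: f; rewrite E h.
Qed.

Lemma arc_dist u v : D u v -> dist u v = 1.
Proof. by rewrite /dist => /arcE; lia. Qed.

Lemma arc_total u v : dist u v = 1 -> D u v \/ D v u.
Proof.
case: u v => x y [x' y']; rewrite /dist /= => d1.
have [[E ->]|[[E ->]|[[-> E]|[-> E]]]] :
  (x' = x + 1 /\ y' = y) \/ (x = x' + 1 /\ y' = y) \/
  (x' = x /\ y' = y + 1) \/ (x' = x /\ y = y' + 1) by lia.
- by rewrite {}E; case h: (H x y); [left | right]; constructor; rewrite /= ?h.
- by rewrite {}E; case h: (H x' y); [right | left]; constructor; rewrite /= ?h.
- by rewrite {}E; case h: (V x y); [left | right]; constructor; rewrite /= ?h.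
- by rewrite {}E; case h: (V x y'); [right | left]; constructor; rewrite /= ?h.
Qed.

Lemma walk_dist A l u v : walk D A l u v -> dist u v <= Z.of_nat l.
Proof.
elim=> [x _|l' x y z _ /arc_dist]; rewrite /dist; first lia.
by move=> d1 _; lia.
Qed.

(** The grid is bipartite: every arc changes the parity of the sum of the coordinates. *)
Lemma walk_parity A l u v : walk D A l u v ->
  exists k, u.1 + u.2 + v.1 + v.2 + Z.of_nat l = 2 * k.
Proof.
elim=> [x _|l' x y z _ /arc_dist d1 _ [k E]]; first by exists (x.1 + x.2); lia.
move: d1; rewrite /dist => d1.
have [s ->] : exists s, x.1 + x.2 = y.1 + y.2 + 1 + 2 * s.
  by case: (Z.eq_dec (x.1 + x.2) (y.1 + y.2 + 1)) => ?; [exists 0|exists (-1)]; lia.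
by exists (k + 1 + s); lia.
Qed.

Lemma walkR A x x' y : x <= x' ->
  (forall t, x <= t <= x' -> A (t, y)) -> (forall t, x <= t < x' -> H t y) ->
  walk D A (Z.to_nat (x' - x)) (x, y) (x', y).
Proof.
move: {2}(Z.to_nat _) (erefl (Z.to_nat (x' - x))) => l; elim: l x => [|l IH] x E le hA hH.
  have -> : x = x' by lia.
  by rewrite Z.sub_diag; apply: walk_nil; apply: hA; lia.
rewrite E; apply: (walk_cons (v := (x + 1, y))); first by apply: hA; lia.
  by constructor; split=> //; apply: hH => /=; lia.
have <- : Z.to_nat (x' - (x + 1)) = l by lia.
by apply: IH => [|| t ht| t ht]; [lia | lia | apply: hA; lia | apply: hH; lia].
Qed.

Lemma walkL A x x' y : x' <= x ->
  (forall t, x' <= t <= x -> A (t, y)) -> (forall t, x' <= t < x -> ~~ H t y) ->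
  walk D A (Z.to_nat (x - x')) (x, y) (x', y).
Proof.
move: {2}(Z.to_nat _) (erefl (Z.to_nat (x - x'))) => l; elim: l x => [|l IH] x E le hA hH.
  have -> : x = x' by lia.
  by rewrite Z.sub_diag; apply: walk_nil; apply: hA; lia.
rewrite E; apply: (walk_cons (v := (x - 1, y))); first by apply: hA; lia.
  by apply: Or42; split=> //=; [lia | apply: hH; lia].
have <- : Z.to_nat (x - 1 - x') = l by lia.
by apply: IH => [|| t ht| t ht]; [lia | lia | apply: hA; lia | apply: hH; lia].
Qed.

Lemma walkD A x y y' : y <= y' ->
  (forall t, y <= t <= y' -> A (x, t)) -> (forall t, y <= t < y' -> V x t) ->
  walk D A (Z.to_nat (y' - y)) (x, y) (x, y').
Proof.
move: {2}(Z.to_nat _) (erefl (Z.to_nat (y' - y))) => l; elim: l y => [|l IH] y E le hA hV.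
  have -> : y = y' by lia.
  by rewrite Z.sub_diag; apply: walk_nil; apply: hA; lia.
rewrite E; apply: (walk_cons (v := (x, y + 1))); first by apply: hA; lia.
  by apply: Or43; split=> //; apply: hV => /=; lia.
have <- : Z.to_nat (y' - (y + 1)) = l by lia.
by apply: IH => [|| t ht| t ht]; [lia | lia | apply: hA; lia | apply: hV; lia].
Qed.

Lemma walkU A x y y' : y' <= y ->
  (forall t, y' <= t <= y -> A (x, t)) -> (forall t, y' <= t < y -> ~~ V x t) ->
  walk D A (Z.to_nat (y - y')) (x, y) (x, y').
Proof.
move: {2}(Z.to_nat _) (erefl (Z.to_nat (y - y'))) => l; elim: l y => [|l IH] y E le hA hV.
  have -> : y = y' by lia.
  by rewrite Z.sub_diag; apply: walk_nil; apply: hA; lia.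
rewrite E; apply: (walk_cons (v := (x, y - 1))); first by apply: hA; lia.
  by apply: Or44; split=> //=; [lia | apply: hV; lia].
have <- : Z.to_nat (y - 1 - y') = l by lia.
by apply: IH => [|| t ht| t ht]; [lia | lia | apply: hA; lia | apply: hV; lia].
Qed.

Section Closure.
Variables (A T : cell -> Prop).
Hypothesis gT : geoconvex D A T.

(** A walk whose length is the Manhattan distance of its ends is a geodesic, whatever the other arcs
    are. *)
Lemma monotone_closed u v x i j : T u -> T v -> walk D A i u x -> walk D A j x v ->
  Z.of_nat (i + j) <= dist u v -> T x.
Proof.
move=> Tu Tv wi wj le; apply: (gT.2 u v x i j) => // l /walk_dist; lia.
Qed.

(** Asymmetry excludes [u = v] and bipartiteness excludes an arc from [u] to [v], so a directed path
    with two arcs is always a geodesic. *)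
Lemma two_path_closed u x v : A x -> T u -> T v -> D u x -> D x v -> T x.
Proof.
move=> Ax Tu Tv Dux Dxv; have [Au Av] := (gT.1 _ Tu, gT.1 _ Tv).
apply: (gT.2 u v x 1%N 1%N) => //; try exact: walk1.
case=> [|[|//]] w; first by case: (arc_asym Dux); rewrite (walk0E w).
have [y [_ Duv wy]] := walkSE w; rewrite (walk0E wy) in Duv.
move: (arc_dist Dux) (arc_dist Dxv) (arc_dist Duv).
by rewrite /dist; lia.
Qed.

(** Going around the cycle from [b] to [a] takes three arcs, and nothing is shorter: one arc would
    reverse the arc from [a] to [b], and even lengths have the wrong parity. *)
Lemma face_closed a b c d : A c -> A d -> T a -> T b ->
  D a b -> D b c -> D c d -> D d a -> T c /\ T d.
Proof.
move=> Ac Ad Ta Tb Dab Dbc Dcd Dda; have [Aa Ab] := (gT.1 _ Ta, gT.1 _ Tb).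
have min3 l : walk D A l b a -> (3 <= l)%N.
  move=> w; have [k] := walk_parity w; have := arc_dist Dab; rewrite /dist.
  case: l w => [|[|[|//]]] w; last lia.
    by rewrite (walk0E w); lia.
  have [y [_ Dby wy]] := walkSE w.
  by case: (arc_asym Dab); rewrite -(walk0E wy).
have wcd := walk1 Ac Ad Dcd; have wbc := walk1 Ab Ac Dbc; have wda := walk1 Ad Aa Dda.
split; first exact: (gT.2 b a c 1 (1 + 1))%N _ _ wbc (walk_cat wcd wda) min3.
by apply: (gT.2 b a d (1 + 1) 1)%N _ _ (walk_cat wbc wcd) wda min3.
Qed.
End Closure.
End Grid.

Ltac arc_case a h x y :=
  move: a => /arcE /= [[? [? h]]|[[? [? h]]|[[? [? h]]|[? [? h]]]]]; subst x y.

(** * Finite grids *)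

Section Embedding.
Variables (n m : nat) (lo : Z).
Local Notation vertex := ('I_n * 'I_m)%type.
Local Notation grid := (cartesian_product (@path_graph n) (@path_graph m)).
Local Notation ibox := (box lo (lo + Z.of_nat n) (Z.of_nat m)).

Definition emb (u : vertex) : cell := (lo + Z.of_nat u.1, Z.of_nat u.2)%Z.

Lemma emb_inj : injective emb.
Proof.
move=> [x y] [x' y'] [] E1 E2; congr pair; apply: val_inj => /=; lia.
Qed.

Lemma emb_box u : ibox (emb u).
Proof. by case: u => x y; rewrite /box /=; have := (ltn_ord x); have := ltn_ord y; lia. Qed.

Lemma embP c : ibox c -> exists u, emb u = c.
Proof.
case: c => x y []/= hx hy.
have hx' : (Z.to_nat (x - lo) < n)%N by lia.
have hy' : (Z.to_nat y < m)%N by lia.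
exists (Ordinal hx', Ordinal hy'); rewrite /emb /=; congr pair; lia.
Qed.

Lemma grid_dist u v : grid u v = (dist (emb u) (emb v) =? 1)%Z.
Proof.
case: u v => x y [x' y']; rewrite /cartesian_product /path_graph /dist /=.
rewrite -!val_eqE /=; apply/idP/idP; lia.
Qed.

Variables (H V : Z -> Z -> bool) (D : rel vertex).
Hypothesis DE : forall u v, D u v <-> arc H V (emb u) (emb v).
Local Notation walkb := (walk (arc H V) ibox).

Definition img (S : {set vertex}) (c : cell) := exists2 u, u \in S & emb u = c.

Lemma path_walk u p : path D u p -> walkb (size p) (emb u) (emb (last u p)).
Proof.
elim: p u => [|v p IH] u /=; first by move=> _; apply/walk_nil/emb_box.
by case/andP=> /DE Duv /IH; apply: walk_cons => //; apply: emb_box.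
Qed.

Lemma walk_path l u v : walkb l (emb u) (emb v) ->
  exists p, [/\ path D u p, last u p = v & size p = l].
Proof.
elim: l u => [|l IH] u w; first by exists [::]; split=> //; apply/emb_inj/(walk0E w).
have [c [_ Duc wc]] := walkSE w; have [x Ex] := embP (walk_first wc).
rewrite -{}Ex in Duc wc; have [p [pp lp sp]] := IH _ wc.
by exists (x :: p); rewrite /= pp lp sp (introT idP ((DE _ _).2 Duc)).
Qed.

Lemma dipath_shorten u p : path D u p ->
  exists q, [/\ dipath D u (last u p) q, {subset q <= p} & size q <= size p].
Proof.
move=> pp; case: (shortenP pp) => q pq uq sq.
exists q; split=> //; first by rewrite /dipath pq uq eqxx.
by move/andP: (uq) => [_ uq']; apply: uniq_leq_size.
Qed.

Lemma strongE : strong D <-> connected (arc H V) ibox.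
Proof.
split=> [sD c d /embP[u <-] /embP[v <-]|cD u v].
  have [p /and3P[pp _ /eqP <-]] := sD u v.
  by exists (size p); apply: path_walk.
have [l /walk_path[p [pp <- _]]] := cD _ _ (emb_box u) (emb_box v).
by have [q [dq _ _]] := dipath_shorten pp; exists q.
Qed.

(** The two notions of geodesic agree because a walk of minimal length has no repeated vertex, as
    [dipath] demands. *)
Lemma convexE S :
  convex D S <-> S != set0 /\ geoconvex (arc H V) ibox (img S).
Proof.
split=> [[S0 cS]|[S0 [_ gS]]]; split=> //.
  split=> [c [u _ <-]|_ _ c i j [u Su <-] [v Sv <-] wi wj minl]; first exact: emb_box.
  have [x Ex] := embP (walk_last wi); rewrite -{c}Ex in wi wj *.
  have [p [pp lp sp]] := walk_path wi; have [q [pq lq sq]] := walk_path wj.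
  exists x => //; have pr : path D u (p ++ q) by rewrite cat_path pp lp.
  have lr : last u (p ++ q) = v by rewrite last_cat lp.
  (* A repetition could be cut out, leaving a walk shorter than the minimum [i + j]. *)
  have uq : uniq (u :: p ++ q).
    have [r [/and3P[pr' ur /eqP lr'] sr le]] := dipath_shorten pr.
    apply: (leq_size_uniq ur) => [y|].
      by rewrite !inE => /orP[-> //|/sr ->]; rewrite orbT.
    rewrite /= ltnS size_cat sp sq; apply: minl.
    by rewrite -lr -lr'; apply: path_walk.
  have xin : x \in u :: p ++ q by rewrite -cat_cons mem_cat -lp mem_last.
  apply: (cS u v _ Su Sv _ x xin).
  split=> [|q' /and3P[pq' _ /eqP lq']]; first by rewrite /dipath pr uq lr eqxx.
  by rewrite size_cat sp sq; apply: minl; rewrite -lq'; apply: path_walk.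
move=> u v p Su Sv [/and3P[pp _ /eqP lp] minp] x xp.
move: pp lp minp; case/splitPl: xp => p1 p2 lp1; rewrite cat_path last_cat lp1.
case/andP=> pp1 pp2 lp2 minp.
have [y Sy /emb_inj <-] // : img S (emb x).
apply: (gS (emb u) (emb v) _ (size p1) (size p2)).
- by exists u.
- by exists v.
- by rewrite -lp1; apply: path_walk.
- by rewrite -lp2; apply: path_walk.
move=> l /walk_path[q [pq lq <-]].
have [r [dr _ le]] := dipath_shorten pq; rewrite lq in dr.
by rewrite -size_cat; apply: leq_trans (minp _ dr) le.
Qed.
End Embedding.

(** Sets of cells are predicates and have no cardinality; a covering list, possibly with
    repetitions, stands in for an upper bound on it. *)
Definition covered (T : cell -> Prop) k :=
  exists2 s : seq cell, size s <= k & forall c, T c -> List.In c s.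

Definition arcb (H V : Z -> Z -> bool) (u v : cell) : bool :=
  let: ((x, y), (x', y')) := (u, v) in
  [|| [&& (x' =? x + 1)%Z, (y' =? y)%Z & H x y],
      [&& (x =? x' + 1)%Z, (y' =? y)%Z & ~~ H x' y'],
      [&& (x' =? x)%Z, (y' =? y + 1)%Z & V x y] |
      [&& (x' =? x)%Z, (y =? y' + 1)%Z & ~~ V x' y']].

Lemma arcbP H V u v : arcb H V u v <-> arc H V u v.
Proof.
case: u v => x y [x' y']; rewrite /arc /=; split.
  by case/or4P=> /and3P[/Z.eqb_eq E /Z.eqb_eq E' h];
     [apply: Or41|apply: Or42|apply: Or43|apply: Or44].
by case=> [] [/Z.eqb_eq E /Z.eqb_eq E' h]; apply/or4P;
   [apply: Or41|apply: Or42|apply: Or43|apply: Or44]; rewrite E E' h.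
Qed.

(** * Convexity numbers of orientations given by [H] and [V] *)

Section Spectrum.
Variables (n m : nat).
Local Notation vertex := ('I_n * 'I_m)%type.
Local Notation grid := (cartesian_product (@path_graph n) (@path_graph m)).
Local Notation ibox lo := (box lo (lo + Z.of_nat n) (Z.of_nat m)).

Lemma card_covered lo (S : {set vertex}) (T : cell -> Prop) k :
  covered T k -> (forall u, u \in S -> T (emb lo u)) -> #|S| <= k.
Proof.
case=> s; elim: s k S T => [|c s IH] k S T le sT hS.
  suff -> : S = set0 by rewrite cards0.
  by apply/setP=> u; rewrite inE; apply/negP=> /hS/sT.
case: k le => // k le.
case: (classic (exists2 u, u \in S & emb lo u = c)) => [[u Su Eu]|no].
  rewrite (cardsD1 u) Su add1n ltnS; apply: (IH k _ (fun d => T d /\ d <> c)) => //.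
    by move=> d [/sT[<-|]] // /(_ erefl).
  move=> v /setD1P[nvu Sv]; split; first exact: hS.
  by rewrite -Eu => /emb_inj E; rewrite E eqxx in nvu.
apply: leqW; apply: (IH k _ (fun d => T d /\ d <> c)) => //.
  by move=> d [/sT[<-|]] // /(_ erefl).
by move=> v Sv; split; [exact: hS | move=> E; apply: no; exists v].
Qed.

(** Common interface of the constructions. Subsets of [S] have at most [k] points and singletons at
    most one, so maximality only concerns convex sets with two points that stick out of [S]. *)
Lemma spectrum_intro lo H V (Sb : cell -> bool) k :
  let S := [set u : vertex | Sb (emb lo u)] in
  #|S| = k -> 0 < k < n * m ->
  connected (arc H V) (ibox lo) ->
  geoconvex (arc H V) (ibox lo) (fun c => ibox lo c /\ Sb c) ->
  (forall T, geoconvex (arc H V) (ibox lo) T ->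
     (exists2 u, T u & exists2 v, T v & u <> v) -> (exists2 u, T u & ~~ Sb u) ->
     (forall c, ibox lo c -> T c) \/ covered T k) ->
  strong_convexity_spectrum grid k.
Proof.
move=> S Sk /andP[k_gt0 ltk] cD gS maxS.
pose D : rel vertex := fun u v => arcb H V (emb lo u) (emb lo v).
have DE u v : D u v <-> arc H V (emb lo u) (emb lo v) by apply: arcbP.
exists D; split.
- split=> [u v /DE/arc_dist|u v]; first by rewrite (grid_dist lo) => ->.
  rewrite (grid_dist lo) => /Z.eqb_eq /(arc_total H V)[a|a].
    rewrite (introT idP ((DE _ _).2 a)); apply/negP=> /DE; exact: arc_asym a.
  rewrite (introT idP ((DE _ _).2 a)) addbT; apply/negP=> /DE; exact: arc_asym a.
- exact/(strongE DE).
split.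
  exists S; split=> //; last first.
    by apply/eqP=> E; move: ltk; rewrite -Sk E cardsT card_prod !card_ord ltnn.
  apply/(convexE DE); split; first by rewrite -card_gt0 Sk.
  have E c : img lo S c <-> ibox lo c /\ Sb c.
    split=> [[u]|[/embP[u <-] Su]]; last by exists u; rewrite ?inE.
    by rewrite inE => Su <-; split=> //; apply: emb_box.
  case: gS => sS cS; split=> [c /E[]//|u v x i j /E Su /E Sv wi wj minl].
  by apply/E; apply: (cS u v x i j).
move=> S' /(convexE DE)[S'0 gS'] S'T.
have [cov|] := classic (covered (img lo S') k).
  by apply: (card_covered (lo := lo) cov) => u Su; exists u.
move=> ncov; case: (boolP (S' \subset S)) => [/subset_leq_card|/subsetPn[u Su nSu]].
  by rewrite Sk.
case: (classic (exists2 v, v \in S' & v <> u)) => [[v Sv nvu]|no].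
  case: (maxS _ gS'); last by [].
  - exists (emb lo u); first by exists u.
    by exists (emb lo v); [exists v | move=> /emb_inj E; apply: nvu].
  - by exists (emb lo u); [exists u | move: nSu; rewrite inE].
  move=> full; case/eqP: S'T; apply/setP=> w; rewrite inE.
  by have [w' Sw /emb_inj <-] := full _ (emb_box lo w).
case: ncov; exists [:: emb lo u] => // c [v Sv <-]; left.
by case: (v =P u) => [->//|nvu]; case: no; exists v.
Qed.

(** At most [n * m - k] points are left outside [S], and this is at most [k] once [S] fills half of
    the grid. *)
Lemma covered_complement lo (Sb : cell -> bool) (T : cell -> Prop) k :
  #|[set u : vertex | Sb (emb lo u)]| = k -> n * m <= k.*2 ->
  (forall c, T c -> ibox lo c) -> (forall c, T c -> ~~ Sb c) -> covered T k.
Proof.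
move=> Sk le Tbox TS.
exists [seq emb lo u | u <- enum [set u : vertex | ~~ Sb (emb lo u)]].
  rewrite size_map -cardE; have := cardsC [set u : vertex | Sb (emb lo u)].
  rewrite Sk card_prod !card_ord (_ : ~: _ = [set u : vertex | ~~ Sb (emb lo u)]).
    by lia.
  by apply/setP=> u; rewrite !inE.
move=> c Tc; have [u Eu] := embP (Tbox _ Tc).
have : u \in enum [set u : vertex | ~~ Sb (emb lo u)].
  by rewrite mem_enum inE Eu TS.
elim: (enum _) => //= v s IH; rewrite inE => /orP[/eqP<-|/IH]; first by left.
by right.
Qed.

Lemma orientation_arc D : orientation grid D ->
  exists H V, forall u v, D u v <-> arc H V (emb 0 u) (emb 0 v).
Proof.
case=> sD xD.
pose E x y x' y' := [exists u : vertex, exists v : vertex,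
  [&& (Z.of_nat u.1 =? x)%Z, (Z.of_nat u.2 =? y)%Z,
      (Z.of_nat v.1 =? x')%Z, (Z.of_nat v.2 =? y')%Z & D u v]].
have EE u v : E (emb 0 u).1 (emb 0 u).2 (emb 0 v).1 (emb 0 v).2 = D u v.
  apply/existsP/idP => [[u' /existsP[v' /and5P[]]]|Duv].
    rewrite /emb /= => /Z.eqb_eq e1 /Z.eqb_eq e2 /Z.eqb_eq e3 /Z.eqb_eq e4.
    have -> : u' = u by apply: (@emb_inj _ _ 0); rewrite /emb; congr pair; lia.
    by have -> : v' = v by apply: (@emb_inj _ _ 0); rewrite /emb; congr pair; lia.
  by exists u; apply/existsP; exists v; rewrite Duv !Z.eqb_refl.
have DN u v : grid u v -> D u v = ~~ D v u.
  by move/xD; case: (D u v); case: (D v u).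
exists (fun x y => E x y (x + 1)%Z y), (fun x y => E x y x (y + 1)%Z) => u v.
split=> [Duv|].
  have guv := sD _ _ Duv; have := guv; rewrite (grid_dist 0) => /Z.eqb_eq.
  have Dvu : ~~ D v u by rewrite -(DN u v guv).
  rewrite /dist => d1.
  have [[E1 E2]|[[E1 E2]|[[E1 E2]|[E1 E2]]]] :
      ((emb 0 v).1 = (emb 0 u).1 + 1 /\ (emb 0 v).2 = (emb 0 u).2 \/
       (emb 0 u).1 = (emb 0 v).1 + 1 /\ (emb 0 v).2 = (emb 0 u).2 \/
       (emb 0 v).1 = (emb 0 u).1 /\ (emb 0 v).2 = (emb 0 u).2 + 1 \/
       (emb 0 v).1 = (emb 0 u).1 /\ (emb 0 u).2 = (emb 0 v).2 + 1)%Z by lia.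
  - by apply: Or41; split=> //; rewrite -E1 -{2}E2 EE.
  - by apply: Or42; split=> //; rewrite -E1 {2}E2 EE.
  - by apply: Or43; split=> //; rewrite -E2 -{2}E1 EE.
  - by apply: Or44; split=> //; rewrite -E2 {2}E1 EE.
move=> a; have := arc_dist a => /Z.eqb_eq; rewrite -grid_dist => guv.
case: a => -[E1 E2].
- by rewrite -E1 -{2}E2 EE.
- by rewrite -E1 {2}E2 EE (DN u v guv).
- by rewrite -E2 -{2}E1 EE.
- by rewrite -E2 {2}E1 EE (DN u v guv).
Qed.
End Spectrum.

(** * Upper bounds *)

Section Search.
Local Open Scope Z_scope.

Definition ceq (p q : cell) : bool := (p.1 =? q.1) && (p.2 =? q.2).

(* [if]s, unlike [&&] and [||], are evaluated lazily by [vm_compute].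
   A partial description of a neighbourhood of a vertex outside the convex set
   [S], in coordinates relative to that vertex: [(p, true)] in [known] means
   that [p] is outside [S], [(p, false)] that it is inside; a wall is the
   extreme coordinate of the grid in a direction. *)
Record state := State {
  known : seq (cell * bool); arcs : seq (cell * cell);
  wallL : option Z; wallR : option Z; wallU : option Z; wallD : option Z }.

(** Directions are numbered right, left, down, up; [add_wall] follows the same numbering. *)
Definition nbr (c : cell) (k : nat) : cell :=
  match k with
  | 0%N => (c.1 + 1, c.2) | 1%N => (c.1 - 1, c.2)
  | 2%N => (c.1, c.2 + 1) | _ => (c.1, c.2 - 1)
  end.

Definition nbrs c := [:: nbr c 0; nbr c 1; nbr c 2; nbr c 3].

Fixpoint look (s : seq (cell * bool)) (p : cell) : option bool :=
  if s is (q, b) :: s' then if ceq p q then Some b else look s' p else None.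

Definition is_out st p :=
  if look (known st) p is Some b then b else false.

Definition is_in st p :=
  if look (known st) p is Some b then ~~ b else false.

Definition has_arc st p q := has (fun a => ceq p a.1 && ceq q a.2) (arcs st).

Definition beyond st (p : cell) : bool :=
  [|| if wallL st is Some l then p.1 <? l else false,
      if wallR st is Some r then r <? p.1 else false,
      if wallU st is Some t then p.2 <? t else false |
      if wallD st is Some b then b <? p.2 else false].

Fixpoint nodup (s : seq cell) :=
  if s is p :: s' then ~~ has (ceq p) s' && nodup s' else true.

Definition outs st := [seq a.1 | a <- known st & a.2].

Variable q : nat.

Definition too_narrow st :=
  (if (wallL st, wallR st) is (Some l, Some r) then r - l + 1 <? Z.of_nat q else false)
  || (if (wallU st, wallD st) is (Some t, Some b) then b - t + 1 <? Z.of_nat q else false).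

Definition stuck st c :=
  all (fun p => beyond st p || has_arc st p c) (nbrs c)
  || all (fun p => beyond st p || has_arc st c p) (nbrs c).

(** Contradictory when [c] is in [S]: a vertex of [S] has an out-neighbour and an in-neighbour in
    [S], which differ by asymmetry. *)
Definition thin st c :=
  (count (fun p => ~~ beyond st p && ~~ is_out st p) (nbrs c) <= 1)%N.

(** No arc leaves the set of known vertices outside [S], so [S] could not be reached from them;
    [sealed] is the dual obstruction. *)
Definition trapped st :=
  all (fun c => all (fun p => [|| beyond st p, is_out st p | has_arc st p c])
                    (nbrs c)) (outs st).

Definition sealed st :=
  all (fun c => all (fun p => [|| beyond st p, is_out st p | has_arc st c p])
                    (nbrs c)) (outs st).

(** Follows a directed walk outside [S] that was entered from [s], with [r] counting the arcs
    between outside vertices. Returning to [S] at [p] while [r < dist s p] contradicts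
    [excursion_dist]. *)
Fixpoint shortcut st fuel (s x : cell) (r : Z) : bool :=
  if fuel is fuel'.+1 then
    has (fun p => if has_arc st x p then
                    if is_out st p then shortcut st fuel' s p (r + 1)
                    else is_in st p && (r <? dist s p)
                  else false)
        (nbrs x)
  else false.

Definition exists_shortcut st :=
  has (fun a => if is_in st a.1 && is_out st a.2 then shortcut st q a.1 a.2 0
                else false) (arcs st).

(** Selects the contradictions to look for after an extension of the description. The choice only
    affects the cost and the power of the search: every positive answer is sound by
    [contradictoryP]. *)
Inductive update := NewCell | NewArc | NewWall.

Definition contradictory (k : update) st :=
  match k with
  | NewCell =>
     if (if (q <= size (outs st))%N then nodup (outs st) else false) then true else
     has (fun a => if a.2 then false else thin st a.1) (known st)
  | NewArc =>
     if has (fun a => if a.2 then stuck st a.1 else false) (known st) then true else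
     if exists_shortcut st then true else
     if trapped st then true else sealed st
  | NewWall =>
     if too_narrow st then true else
     if has (fun a => beyond st a.1) (known st) then true else
     if has (fun a => if a.2 then stuck st a.1 else thin st a.1) (known st) then true else
     if trapped st then true else sealed st
  end.

Definition add_cell st p b :=
  State (rcons (known st) (p, b)) (arcs st) (wallL st) (wallR st) (wallU st) (wallD st).

Definition add_arc st p p' :=
  State (known st) ((p, p') :: arcs st) (wallL st) (wallR st) (wallU st) (wallD st).

Definition add_wall st (c : cell) (k : nat) :=
  let: State kn ar l r u d := st in
  match k with
  | 0%N => State kn ar l (Some c.1) u d | 1%N => State kn ar (Some c.1) r u d
  | 2%N => State kn ar l r u (Some c.2) | _ => State kn ar l r (Some c.2) d
  end.

Fixpoint query st (s : seq (cell * nat)) : option (cell * nat) :=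
  if s is (c, k) :: s' then
    let p := nbr c k in
    if beyond st p then query st s' else
    if has_arc st c p then query st s' else
    if has_arc st p c then query st s' else Some (c, k)
  else None.

(* A vertex outside [S] below the starting one, or to its left in the same row,
   is not considered: the starting vertex is chosen so that there is none. *)
Fixpoint refute fuel k st : bool :=
  if fuel is fuel'.+1 then
    if contradictory k st then true else
    if query st [seq (c, k) | c <- outs st, k <- iota 0 4] is Some (c, k) then
       let p := nbr c k in
       if look (known st) p is Some _ then
         if refute fuel' NewArc (add_arc st c p) then refute fuel' NewArc (add_arc st p c)
         else false
       else
         if refute fuel' NewCell (add_cell st p false) then
         if (if (0 <? p.2) || ((p.2 =? 0) && (p.1 <? 0)) then true
             else refute fuel' NewCell (add_cell st p true))
         then refute fuel' NewWall (add_wall st c k) else false else false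
    else false
  else false.

Definition start := State [:: ((0, 0), true)] [::] None None None None.

(** * Soundness of the search *)

Section Soundness.
Variables (H V : Z -> Z -> bool) (lo hi m : Z) (S : cell -> Prop) (z : cell).
Local Notation D := (arc H V).
Local Notation ibox := (box lo hi m).
Let C c := ibox c /\ ~ S c.
Hypotheses (wide : Z.of_nat q <= hi - lo) (high : Z.of_nat q <= m).
Hypotheses (cD : connected D ibox) (gS : geoconvex D ibox S).
Hypothesis S2 : forall u, exists2 v, S v & v <> u.
Hypothesis few : forall s : seq cell,
  List.NoDup s -> (forall c, List.In c s -> C c) -> (size s < q)%N.
Hypothesis Cz : C z.
Hypothesis z_low : forall c, C c -> c.2 < z.2 \/ c.2 = z.2 /\ z.1 <= c.1.

Definition at_ (p : cell) : cell := (z.1 + p.1, z.2 + p.2).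

Definition describes st :=
  [/\ forall p b, List.In (p, b) (known st) ->
        ibox (at_ p) /\ (if b then ~ S (at_ p) else S (at_ p)),
      forall p p', List.In (p, p') (arcs st) -> D (at_ p) (at_ p'),
      (if wallL st is Some l then z.1 + l = lo else True) /\
      (if wallR st is Some r then z.1 + r = hi - 1 else True) &
      (if wallU st is Some t then z.2 + t = 0 else True) /\
      (if wallD st is Some b then z.2 + b = m - 1 else True)].

Lemma ceqP p p' : reflect (p = p') (ceq p p').
Proof.
case: p p' => x y [x' y']; apply: (iffP andP) => /= [[/Z.eqb_eq -> /Z.eqb_eq ->]|[-> ->]] //.
by rewrite !Z.eqb_refl.
Qed.

Lemma hasP_In (T : Type) (a : T -> bool) s :
  has a s -> exists2 x, List.In x s & a x.
Proof.
elim: s => //= x s IH /orP[ax|/IH[y sy ay]]; first by exists x; [left|].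
by exists y; [right|].
Qed.

Lemma allP_In (T : Type) (a : T -> bool) s x : all a s -> List.In x s -> a x.
Proof. by elim: s => //= y s IH /andP[ay /IH sa] [<-|]. Qed.

Lemma count_two (T : Type) (a : T -> bool) s x y :
  List.In x s -> List.In y s -> x <> y -> a x -> a y -> (1 < count a s)%N.
Proof.
have count_pos t r : List.In t r -> a t -> (0 < count a r)%N.
  by elim: r => //= t' r IH [->|/IH h] at_; [rewrite at_ | have := h at_; lia].
elim: s => //= t s IH [->|sx] [->|sy] nxy ax ay //.
- by rewrite ax; have := count_pos _ _ sy ay; lia.
- by rewrite ay; have := count_pos _ _ sx ax; lia.
- by have := IH sx sy nxy ax ay; lia.
Qed.

Lemma lookP s p b : look s p = Some b -> List.In (p, b) s.
Proof.
elim: s => //= -[p' b'] s IH; case: ceqP => [<- [<-]|_ /IH]; first by left.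
by right.
Qed.

Lemma outsP st p : List.In p (outs st) -> List.In (p, true) (known st).
Proof.
rewrite /outs; elim: (known st) => //= -[p' []] s IH //=; last by move/IH; right.
by case=> [->|/IH]; [left|right].
Qed.

Lemma nodupP s : nodup s -> List.NoDup s.
Proof.
elim: s => [|p s IH] /=; first by constructor.
case/andP=> np /IH ns; constructor=> // sp; case/negP: np.
elim: s sp {IH ns} => //= p' s IH [->|/IH ->]; last by rewrite orbT.
by case: ceqP.
Qed.

Lemma nbrsP c p : List.In p (nbrs c) <-> dist c p = 1.
Proof.
case: c p => x y [x' y']; rewrite /dist /nbrs /nbr /=; split.
  by case=> [[<- <-]|[[<- <-]|[[<- <-]|[[<- <-]|[]]]]] /=; lia.
move=> d1.
have [[-> ->]|[[-> ->]|[[-> ->]|[-> ->]]]] :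
  (x' = x + 1 /\ y' = y) \/ (x' = x - 1 /\ y' = y) \/
  (x' = x /\ y' = y + 1) \/ (x' = x /\ y' = y - 1) by lia.
all: by [left|right; left|do 2 right; left|do 3 right; left].
Qed.

Lemma dist_at p p' : dist (at_ p) (at_ p') = dist p p'.
Proof. by rewrite /dist /at_ /=; lia. Qed.

Lemma atK v : at_ (v.1 - z.1, v.2 - z.2) = v.
Proof. by case: v => x y; rewrite /at_ /=; congr pair; lia. Qed.

(* The excursion is not a geodesic since [S] is convex, and by parity the
   distance is then smaller than its length [l + 2] by at least two. *)
Lemma excursion_dist s x y t l : S s -> D s x -> walk D C l x y -> D y t -> S t ->
  dist s t <= Z.of_nat l.
Proof.
move=> Ss Dsx wxy Dyt St; have CB c : C c -> ibox c by case.
have wxyB := walk_sub CB wxy.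
have Bs := gS.1 _ Ss; have Bt := gS.1 _ St.
have wst : walk D ibox (l.+1 + 1) s t.
  apply: walk_cat (walk_cons Bs Dsx wxyB) (walk1 (walk_last wxyB) Bt Dyt).
have [g [wg ming]] := walk_min (ex_intro _ _ wst).
have gl : g <> l.+2.
  move=> E; have [_ []] := walk_first wxy.
  apply: (gS.2 s t x 1%N l.+1) => //; first exact: walk1 Bs (walk_first wxyB) Dsx.
    by rewrite -addn1; apply: walk_cat wxyB (walk1 (walk_last wxyB) Bt Dyt).
  by move=> l' /ming; lia.
have [k E] := walk_parity wst; have [k' E'] := walk_parity wg.
have := ming _ wst; have := walk_dist wg; lia.
Qed.

Section Facts.
Variable st : state.
Hypothesis st_ok : describes st.

Lemma is_outP p : is_out st p -> C (at_ p).
Proof.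
by rewrite /is_out; case E: look => [[]|] //; have [/(_ _ _ (lookP E))[]] := st_ok.
Qed.

Lemma is_inP p : is_in st p -> S (at_ p).
Proof.
by rewrite /is_in; case E: look => [[]|] //; have [/(_ _ _ (lookP E))[]] := st_ok.
Qed.

Lemma outs_C p : List.In p (outs st) -> C (at_ p).
Proof. by move/outsP; have [kn _ _ _] := st_ok; move/kn. Qed.

Lemma has_arcP p p' : has_arc st p p' -> D (at_ p) (at_ p').
Proof.
move/hasP_In=> [[a b] ab /andP[/ceqP-> /ceqP->]].
by have [_ ar _ _] := st_ok; apply: ar.
Qed.

Lemma beyondP p : beyond st p -> ~ ibox (at_ p).
Proof.
have [_ _ [l r] [u d]] := st_ok; rewrite /beyond /box /at_ /=.
case: (wallL st) l => [a|] l; case: (wallR st) r => [b|] r;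
case: (wallU st) u => [c|] u; case: (wallD st) d => [e|] d /=; lia.
Qed.

Lemma step_out p : ibox (at_ p) -> exists p',
  [/\ List.In p' (nbrs p), D (at_ p) (at_ p') & ibox (at_ p')].
Proof.
move=> Bp; have [v Sv nv] := S2 (at_ p).
have [[|l] w] := cD Bp (gS.1 _ Sv); first by case: nv; rewrite (walk0E w).
have [x [_ Dx wx]] := walkSE w; have Bx := walk_first wx.
exists (x.1 - z.1, x.2 - z.2); rewrite atK; split=> //.
by apply/nbrsP; rewrite -dist_at atK; apply: arc_dist Dx.
Qed.

Lemma step_in p : ibox (at_ p) -> exists p',
  [/\ List.In p' (nbrs p), D (at_ p') (at_ p) & ibox (at_ p')].
Proof.
move=> Bp; have [v Sv nv] := S2 (at_ p).
have [[|l] w] := cD (gS.1 _ Sv) Bp; first by case: nv; rewrite (walk0E w).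
rewrite -addn1 in w; have [x [wx w1]] := walk_split w; have Bx := walk_last wx.
have [y [_ Dx wy]] := walkSE w1; rewrite (walk0E wy) in Dx.
exists (x.1 - z.1, x.2 - z.2); rewrite atK; split=> //.
apply/nbrsP; rewrite -dist_at atK; have := arc_dist Dx; rewrite /dist; lia.
Qed.

Lemma stuckP c : ibox (at_ c) -> ~~ stuck st c.
Proof.
move=> Bc; apply/negP=> /orP[] al.
  have [p [pn b Bp]] := step_out Bc.
  have /orP[/beyondP//|/has_arcP a] := allP_In al pn; exact: arc_asym a b.
have [p [pn b Bp]] := step_in Bc.
have /orP[/beyondP//|/has_arcP a] := allP_In al pn; exact: arc_asym a b.
Qed.

Hypothesis seen0 : List.In (0, 0) (outs st).

Lemma at0 : at_ (0, 0) = z.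
Proof. by rewrite /at_ /= !Z.add_0_r -surjective_pairing. Qed.

Lemma mem_outs p : is_out st p -> List.In p (outs st).
Proof.
rewrite /is_out /outs; elim: (known st) => //= -[p' b] s IH /=.
by case: ceqP => [->|_ /IH]; case: b => //; [left|right].
Qed.

Lemma trappedP : ~~ trapped st.
Proof.
apply/negP=> tr.
have P l u v : walk D ibox l u v -> (exists2 p, List.In p (outs st) & u = at_ p) -> ~ S v.
  elim=> [x _ [p /outs_C[_ nS] -> //]|l' x y w _ Dxy wy IH [p op Ex]].
  have By := walk_first wy.
  apply: IH; exists (y.1 - z.1, y.2 - z.2); last by rewrite atK.
  have pn : List.In (y.1 - z.1, y.2 - z.2) (nbrs p).
    by apply/nbrsP; rewrite -dist_at atK -Ex; apply: arc_dist Dxy.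
  have /or3P[/beyondP||/has_arcP] := allP_In (allP_In tr op) pn.
  - by rewrite atK.
  - exact: mem_outs.
  - by rewrite atK -Ex => /arc_asym.
have [v Sv _] := S2 z; have [l w] := cD Cz.1 (gS.1 _ Sv).
by apply: (P _ _ _ w); first by exists (0, 0); rewrite ?at0.
Qed.

Lemma sealedP : ~~ sealed st.
Proof.
apply/negP=> tr.
have P l u v : walk D ibox l u v -> (exists2 p, List.In p (outs st) & v = at_ p) ->
    exists2 p, List.In p (outs st) & u = at_ p.
  elim=> [x _ //|l' x y w Bx Dxy _ IH /IH[p op Ey]].
  exists (x.1 - z.1, x.2 - z.2); last by rewrite atK.
  have pn : List.In (x.1 - z.1, x.2 - z.2) (nbrs p).
    apply/nbrsP; rewrite -dist_at atK -Ey.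
    by have := arc_dist Dxy; rewrite /dist; lia.
  have /or3P[/beyondP||/has_arcP] := allP_In (allP_In tr op) pn.
  - by rewrite atK.
  - exact: mem_outs.
  - by rewrite atK -Ey => /arc_asym.
have [v Sv _] := S2 z; have [l w] := cD (gS.1 _ Sv) Cz.1.
have [|p /outs_C[_ nS] Ev] := P _ _ _ w; first by exists (0, 0); rewrite ?at0.
by case: nS; rewrite -Ev.
Qed.

Lemma thinP s : ibox (at_ s) -> S (at_ s) -> ~~ thin st s.
Proof.
move=> Bs Ss; rewrite /thin.
have [v Sv nv] := S2 (at_ s); have nv' := not_eq_sym nv.
have [a Sa Da] := geoconvex_out gS cD Ss Sv nv'.
have [b Sb Db] := geoconvex_in gS cD Sv Ss nv.
have nab : a <> b by move=> E; rewrite E in Da; apply: arc_asym Da Db.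
have good c : S c -> dist (at_ s) c = 1 -> let p := (c.1 - z.1, c.2 - z.2) in
    List.In p (nbrs s) /\ ~~ beyond st p && ~~ is_out st p.
  move=> Sc d1 p; have Ep : at_ p = c by rewrite /p atK.
  split; first by apply/nbrsP; rewrite -dist_at Ep.
  apply/andP; split; apply/negP; first by move/beyondP; rewrite Ep; apply; apply: gS.1.
  by move/is_outP=> []; rewrite Ep.
have [pa ga] := good _ Sa (arc_dist Da).
have db : dist (at_ s) b = 1 by have := arc_dist Db; rewrite /dist; lia.
have [pb gb] := good _ Sb db.
rewrite -ltnNge; apply: (count_two pa pb) ga gb => -[E1 E2].
by apply: nab; move: E1 E2; case: (a) (b) => [x y] [x' y'] /= ? ?; congr pair; lia.
Qed.

Lemma shortcutP fuel s x l x0 : shortcut st fuel s x (Z.of_nat l) ->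
  S (at_ s) -> D (at_ s) x0 -> walk D C l x0 (at_ x) -> False.
Proof.
elim: fuel x l => // fuel IH x l sc0; have [p _] := hasP_In sc0.
case: ifP => // /has_arcP Dxp; case: ifP => [/is_outP Cp sc|_ /andP[/is_inP Sp lt]] Ss Dsx w.
  apply: (IH p l.+1) Ss Dsx _; first by rewrite Nat2Z.inj_succ -Z.add_1_r.
  exact: walk_rcons w Cp Dxp.
by have := excursion_dist Ss Dsx w Dxp Sp; rewrite dist_at; lia.
Qed.

Lemma contradictoryP k : ~~ contradictory k st.
Proof.
have kn p b : List.In (p, b) (known st) -> ibox (at_ p) /\ (if b then ~ S (at_ p) else S (at_ p)).
  by have [kn _ _ _] := st_ok; apply: kn.
have nstuck : ~~ has (fun a => if a.2 then stuck st a.1 else false) (known st).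
  apply/negP=> /hasP_In[[p []] // /kn[Bp _]]; exact/negP/stuckP.
have nthin a : List.In a (known st) -> a.2 = false -> ~~ thin st a.1.
  by case: a => p b /kn[Bp Sp] /= E; rewrite E in Sp; apply: thinP.
rewrite /contradictory; case: k.
- case: ifP.
    case: ifP => // le /nodupP nd; move: le; rewrite leqNgt.
    have inj p p' : at_ p = at_ p' -> p = p'.
      by case: p p' => a b [a' b'] [] E1 E2; congr pair; lia.
    have nd' : List.NoDup [seq at_ p | p <- outs st].
      by apply: (FinFun.Injective_map_NoDup inj nd).
    have := few nd'; rewrite size_map => -> // c /List.in_map_iff[p [<-]].
    exact: outs_C.
  move=> _; apply/negP=> /hasP_In[[p []] // kp]; exact/negP/(nthin _ kp).
- rewrite (negbTE nstuck); case: ifP => [/hasP_In[[p p'] ar /=]|_].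
    case: ifP => // /andP[/is_inP Sp /is_outP Cp'] sc.
    have [_ /(_ _ _ ar) Dp _ _] := st_ok.
    by case: (shortcutP (l := 0) sc Sp Dp (walk_nil _ Cp')).
  by rewrite (negbTE trappedP) sealedP.
case: ifP => [|_].
  have [_ _ [l r] [u d]] := st_ok; rewrite /too_narrow.
  case: (wallL st) l => [a|] l; case: (wallR st) r => [b|] r;
  case: (wallU st) u => [c|] u; case: (wallD st) d => [e|] d /=; lia.
case: ifP => [/hasP_In[[p b] /kn[Bp _] /beyondP]|_] //.
case: ifP => [/hasP_In[[p []] kp /=]|_].
- by have [Bp _] := kn _ _ kp; rewrite (negbTE (stuckP Bp)).
- by rewrite (negbTE (nthin _ kp _)).
by rewrite (negbTE trappedP) sealedP.
Qed.

End Facts.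

Lemma query_mem st s a : query st s = Some a -> List.In a s.
Proof.
elim: s => //= -[c k] s IH.
by do 3 (case: ifP => [_ /IH|_]; first by right); case=> <-; left.
Qed.

(** At each branching one of the alternatives is again a true description of the grid around [z],
    and a true description never meets a contradiction. Running out of fuel or of queries returns
    [false], which is consistent with the claim. *)
Lemma refuteP fuel k st : describes st -> List.In (0, 0) (outs st) -> ~~ refute fuel k st.
Proof.
elim: fuel k st => // fuel IH k st st_ok st0 /=.
rewrite (negbTE (contradictoryP st_ok st0 k)).
case E: query => [[c d]|] //.
have oc : List.In c (outs st).
  move/query_mem: E; elim: (outs st) => //= p s IHs.
  by case=> [[->]|[[->]|[[->]|[[->]|/IHs]]]]; [left..|right].
have [[Bc nSc] dcp] : C (at_ c) /\ dist c (nbr c d) = 1.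
  split; first exact: outs_C oc.
  apply/nbrsP; case: d {E} => [|[|[|d]]] /=.
  - by left.
  - by right; left.
  - by do 2 right; left.
  by do 3 right; left.
have [kn ar [l r] [u w]] := st_ok.
set p := nbr c d in dcp *.
case Ep: look => [b|].
  have [Bp _] := kn _ _ (lookP Ep).
  have ok a a' : D (at_ a) (at_ a') -> describes (add_arc st a a').
    by move=> Da; split=> //= e e' [[<- <-]|/ar].
  have d1 : dist (at_ c) (at_ p) = 1 by rewrite dist_at.
  case: (arc_total H V d1) => Da; first by rewrite (negbTE (IH _ _ (ok _ _ Da) _)).
  by case: ifP => // _; apply: IH; [apply: ok | ].
have outs_add b a : List.In a (outs st) -> List.In a (outs (add_cell st p b)).
  rewrite /outs /=; elim: (known st) => //= -[e []] t IHt //=.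
  by case=> [->|/IHt]; [left|right].
have ok b : ibox (at_ p) -> (if b then ~ S (at_ p) else S (at_ p)) ->
    describes (add_cell st p b).
  move=> Bp Sp; split=> // a b' /=; rewrite -cats1 => /List.in_app_iff[/kn //|].
  by case=> [[<- <-]|[]].
case: (classic (ibox (at_ p))) => [Bp|nBp].
  case: (classic (S (at_ p))) => Sp.
    by rewrite (negbTE (IH _ _ (ok false Bp Sp) _)) //; apply: outs_add.
  case: ifP => // _; case below: ((0 <? p.2) || ((p.2 =? 0) && (p.1 <? 0))).
    by have := z_low (conj Bp Sp); move: below; rewrite /at_ /=; lia.
  by rewrite (negbTE (IH _ _ (ok true Bp Sp) _)) //; apply: outs_add.
case: ifP => // _; case: ifP => // _; apply: IH; last first.
  by move: st0; rewrite /outs; case: (st) (d) => ? ? ? ? ? ? [|[|[|?]]].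
move: kn ar l r u w nBp Bc; rewrite /p /box /at_ /add_wall.
case: (st) (d) => K R wl wr wu wd [|[|[|e]]] /= kn ar l r u w nBp Bc;
  split=> //=; split=> //; lia.
Qed.

Lemma start_contra : refute 100 NewCell start = true -> False.
Proof.
apply/negP; apply: refuteP; last by left.
split=> //= p b [[<- <-]|//]; rewrite at0; exact: Cz.
Qed.
End Soundness.
End Search.

(** The fuel bounds the length of a branch of the search; every branch closes before it is
    exhausted. *)
Lemma refute4 : refute 4 100 NewCell start.
Proof. by vm_cast_no_check (erefl true). Qed.

Lemma refute5 : refute 5 100 NewCell start.
Proof. by vm_cast_no_check (erefl true). Qed.

Lemma refute6 : refute 6 100 NewCell start.
Proof. by vm_cast_no_check (erefl true). Qed.

Lemma argmin_exists (T : Type) (P : T -> Prop) (f : T -> nat) :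
  (exists x, P x) -> exists x, P x /\ forall y, P y -> (f x <= f y)%N.
Proof.
case=> x; move: {2}(f x) (leqnn (f x)) => k; elim: k x => [|k IH] x le Px.
  by exists x; split=> // y _; lia.
case: (classic (exists2 y, P y & (f y < f x)%N)) => [[y Py lt]|no].
  by apply: (IH y) => //; lia.
by exists x; split=> // y Py; rewrite leqNgt; apply/negP=> lt; apply: no; exists y.
Qed.

Lemma complement_large (q : nat) H V lo hi m (S : cell -> Prop) :
  (4 <= q <= 6)%N -> (Z.of_nat q <= hi - lo)%Z -> (Z.of_nat q <= m)%Z ->
  connected (arc H V) (box lo hi m) -> geoconvex (arc H V) (box lo hi m) S ->
  (forall u, exists2 v, S v & v <> u) -> (exists c, box lo hi m c /\ ~ S c) ->
  exists s : seq cell, [/\ List.NoDup s, (q <= size s)%N &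
    forall c, List.In c s -> box lo hi m c /\ ~ S c].
Proof.
move=> hq wide high cD gS S2 exC; apply: NNPP => no.
have few s : List.NoDup s -> (forall c, List.In c s -> box lo hi m c /\ ~ S c) ->
    (size s < q)%N.
  by move=> nd sC; rewrite ltnNge; apply/negP=> le; apply: no; exists s.
(* As [c.1 - lo] stays below [hi - lo], this weight orders the cells from the bottom row upwards and
   from left to right within a row. *)
have [z [Cz minz]] := argmin_exists
  (fun c => Z.to_nat ((m - c.2) * (hi - lo) + (c.1 - lo)))%Z exC.
have z_low c : box lo hi m c /\ ~ S c -> (c.2 < z.2 \/ c.2 = z.2 /\ z.1 <= c.1)%Z.
  move=> Cc; have := minz _ Cc; case: Cc => -[]; case: Cz => -[]; nia.
apply: (start_contra wide high cD gS S2 few Cz z_low); clear -hq.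
have /or3P[/eqP->|/eqP->|/eqP->] : [|| q == 4, q == 5 | q == 6] by lia.
- exact: refute4.
- exact: refute5.
- exact: refute6.
Qed.

(** * Sizes excluded for proper convex sets *)

Section Necessity.
Variables (n m : nat).
Local Notation vertex := ('I_n * 'I_m)%type.
Local Notation grid := (cartesian_product (@path_graph n) (@path_graph m)).
Local Notation ibox := (box 0 (0 + Z.of_nat n) (Z.of_nat m)).

Lemma size_le_card lo (A : {set vertex}) s : List.NoDup s ->
  (forall c, List.In c s -> exists2 u, u \in A & emb lo u = c) -> size s <= #|A|.
Proof.
elim: s A => // c s IH A nd sA; have [u Au Eu] := sA c (or_introl erefl).
rewrite (cardsD1 u) Au add1n ltnS; have [nc nds] := (List.NoDup_cons_iff c s).1 nd.
apply: IH => // d sd; have [v Av Ev] := sA d (or_intror sd).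
exists v => //; rewrite in_setD1 Av andbT; apply/eqP=> E.
by apply: nc; rewrite -Eu -E Ev.
Qed.

(** Serves to exclude a complete bipartite graph with sides 2 and 3: two common neighbours of [a]
    and [b] are symmetric about the midpoint of [a] and [b], so one determines the other. *)
Lemma opposite_corners (a b c d : cell) : a <> b -> c <> d ->
  dist a c = 1%Z -> dist a d = 1%Z -> dist b c = 1%Z -> dist b d = 1%Z ->
  (d.1 = a.1 + b.1 - c.1 /\ d.2 = a.2 + b.2 - c.2)%Z.
Proof.
move: a b c d => [a a'] [b b'] [c c'] [d d'].
have ne x x' y y' : (x, x') <> (y, y') :> cell -> x <> y \/ x' <> y'.
  by case: (Z.eq_dec x y) => [->|]; [right=> E; rewrite E in H | left].
have opt x x' y y' : dist (x, x') (y, y') = 1%Z ->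
    [\/ y = x + 1 /\ y' = x', y = x - 1 /\ y' = x',
        y = x /\ y' = x' + 1 | y = x /\ y' = x' - 1]%Z.
  rewrite /dist /= => d1; have : (y = x + 1 /\ y' = x' \/ y = x - 1 /\ y' = x' \/
    y = x /\ y' = x' + 1 \/ y = x /\ y' = x' - 1)%Z by lia.
  by case=> [|[|[|]]]; constructor.
move=> /ne nab /ne ncd /opt ac /opt ad /opt bc /opt bd.
by case: ac => -[? ?]; case: ad => -[? ?]; case: bc => -[? ?]; case: bd => -[? ?] /=; lia.
Qed.

Section Fixed.
Variables (D : rel vertex) (S : {set vertex}).
Hypotheses (oD : orientation grid D) (sD : strong D) (cS : convex D S).

Lemma two_neighbours u : 1 < #|S| -> u \in S -> exists a b,
  [/\ a \in S, b \in S, a != b, dist (emb 0 u) (emb 0 a) = 1%Z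
    & dist (emb 0 u) (emb 0 b) = 1%Z].
Proof.
move=> S2 Su; have [H [V DE]] := orientation_arc oD.
have cD := (strongE DE).1 sD; have [_ gS] := (convexE DE S).1 cS.
have [v Sv nvu] : exists2 v, v \in S & v <> u.
  have [v [w [Sv Sw nvw]]] := card_gt1P S2.
  by case: (v =P u) => [E|]; [exists w => // E'; rewrite E E' eqxx in nvw | exists v].
have neq : emb 0 u <> emb 0 v by move/emb_inj=> E; apply: nvu.
have [iu iv] : img 0 S (emb 0 u) /\ img 0 S (emb 0 v) by split; [exists u|exists v].
have [_ [a Sa <-] Da] := geoconvex_out gS cD iu iv neq.
have [_ [b Sb <-] Db] := geoconvex_in gS cD iv iu (not_eq_sym neq).
exists a, b; split=> //; first by apply/eqP=> E; rewrite -E in Db; apply: arc_asym Da Db.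
  exact: arc_dist Da.
by have := arc_dist Db; rewrite /dist; lia.
Qed.

(** Colour [S] by parity. Each vertex has two neighbours in [S], both of the other colour, so each
    class has at least two elements and the sizes 2 and 3 are impossible. A set of 5 would split
    into 2 and 3, and each of the three would be adjacent to both of the two. *)
Lemma card_convex_not235 : #|S| \notin [:: 2; 3; 5].
Proof.
case: (leqP #|S| 1) => S2; first by case: #|S| S2 => [|[|]].
pose col (u : vertex) := odd (u.1 + u.2).
pose X b := [set u in S | col u == b].
have SX : #|S| = #|X true| + #|X false|.
  rewrite -(cardsID [set u | col u]); congr addn; apply: eq_card => u;
  by rewrite !inE; case: (col u); rewrite ?andbT ?andbF.
have opp u a : dist (emb 0 u) (emb 0 a) = 1%Z -> col a = ~~ col u.
  by rewrite /dist /col /=; lia.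
have nb u b : u \in X b -> exists a a',
    [/\ a \in X (~~ b), a' \in X (~~ b), a != a', dist (emb 0 u) (emb 0 a) = 1%Z
      & dist (emb 0 u) (emb 0 a') = 1%Z].
  rewrite inE => /andP[Su /eqP cu].
  have [a [a' [Sa Sa' na da da']]] := two_neighbours S2 Su.
  by exists a, a'; rewrite !inE Sa Sa' (opp _ _ da) (opp _ _ da') cu eqxx.
have X2' b : 0 < #|X b| -> 1 < #|X (~~ b)|.
  case/card_gt0P=> u /nb[a [a' [Xa Xa' na _ _]]].
  by apply/card_gt1P; exists a, a'.
have X2 b : 1 < #|X b|.
  have [X0|/X2'/ltnW/X2'] := posnP #|X b|; last by rewrite negbK.
  have /X2' : 0 < #|X (~~ b)|.
    by move: S2; rewrite SX; case: b X0 => /= ->; rewrite ?addn0 ?add0n => /ltnW.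
  by rewrite negbK X0.
have no23 b : #|X b| = 2 -> #|X (~~ b)| = 3 -> False.
  move=> Xb2 X3; have /cards2P[a [a' [naa' Xb]]] : #|X b| == 2 by rewrite Xb2.
  have /card_gt2P[c [d [e [[Xc Xd Xe] [ncd nde nec]]]]] : 2 < #|X (~~ b)| by rewrite X3.
  have adj y : y \in X (~~ b) ->
      dist (emb 0 a) (emb 0 y) = 1%Z /\ dist (emb 0 a') (emb 0 y) = 1%Z.
    move/nb=> [z [z' []]]; rewrite negbK Xb !inE.
    have ds x : dist (emb 0 x) (emb 0 y) = dist (emb 0 y) (emb 0 x) by rewrite /dist; lia.
    by move=> /orP[]/eqP-> /orP[]/eqP->; rewrite ?eqxx // !ds => _ -> ->.
  have inj (x y : vertex) : x != y -> emb 0 x <> emb 0 y by move=> /eqP n1 /emb_inj.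
  have [[ac a'c] [ad a'd] [ae a'e]] := And3 (adj _ Xc) (adj _ Xd) (adj _ Xe).
  have nce : c != e by rewrite eq_sym.
  have [d1 d2] := opposite_corners (inj _ _ naa') (inj _ _ ncd) ac ad a'c a'd.
  have [e1 e2] := opposite_corners (inj _ _ naa') (inj _ _ nce) ac ae a'c a'e.
  case/eqP: nde; apply: (@emb_inj _ _ 0).
  by rewrite [LHS]surjective_pairing [RHS]surjective_pairing d1 d2 e1 e2.
rewrite SX !inE; have := (X2 true); have := (X2 false).
have := no23 true; have := no23 false; rewrite /=.
case: #|X true| => [|[|[|[|t]]]] //; case: #|X false| => [|[|[|[|f]]]] //= h1 h2 _ _;
  try lia; by [case: h1 | case: h2].
Qed.

Lemma card_convex_le q : 3 < q < 7 -> q <= n -> q <= m -> S != [set: vertex] ->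
  #|S| <= n * m - q.
Proof.
move=> hq qn qm ST; have [H [V DE]] := orientation_arc oD.
have cD := (strongE DE).1 sD; have [_ gS] := (convexE DE S).1 cS.
case: (leqP #|S| 1) => S2; first by nia.
have S2' c : exists2 v, img 0 S v & v <> c.
  have [v [w [Sv Sw nvw]]] := card_gt1P S2.
  case: (classic (emb 0 v = c)) => [E|]; last by exists (emb 0 v) => //; exists v.
  exists (emb 0 w); first by exists w.
  by move=> E'; case/eqP: nvw; apply: (@emb_inj _ _ 0); rewrite E E'.
have exC : exists c, ibox c /\ ~ img 0 S c.
  have /subsetPn[u _ nSu] : ~~ ([set: vertex] \subset S) by rewrite subTset.
  exists (emb 0 u); split; first exact: emb_box.
  by case=> v Sv /emb_inj E; rewrite -E Sv in nSu.
have [||s [nds les sC]] := complement_large hq _ _ cD gS S2' exC; try lia.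
have := cardsC S; rewrite card_prod !card_ord.
suff : size s <= #|~: S| by lia.
apply: (size_le_card (lo := 0) nds) => c /sC[/embP[u Eu] nSc].
by exists u => //; rewrite inE; apply/negP=> Su; apply: nSc; exists u.
Qed.
End Fixed.

Lemma spectrum_bound q k : 3 < q < 7 -> q <= n -> q <= m ->
  strong_convexity_spectrum grid k -> (1 <= k <= n * m - q) && (k \notin [:: 2; 3; 5]).
Proof.
move=> hq qn qm [D [oD sD [[S [cS ST <-]] _]]].
rewrite (card_convex_le oD sD cS hq qn qm ST) (card_convex_not235 oD sD cS) !andbT.
by rewrite card_gt0; case: cS.
Qed.
End Necessity.

(** * Staircases *)

Local Arguments Z.eqb : simpl never.
Local Arguments Z.ltb : simpl never.
Local Arguments Z.add : simpl never.
Local Arguments Z.sub : simpl never.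

Local Open Scope Z_scope.

Lemma Z_up (P : Z -> Prop) a b : P a -> (forall x, a <= x < b -> P x -> P (x + 1)) ->
  forall x, a <= x <= b -> P x.
Proof.
move=> Pa step x hx.
have P' (l : nat) : a + Z.of_nat l <= b -> P (a + Z.of_nat l).
  elim: l => [|l IH] h; first by rewrite Z.add_0_r.
  have -> : a + Z.of_nat l.+1 = a + Z.of_nat l + 1 by lia.
  by apply: step; [lia | apply: IH; lia].
have E : x = a + Z.of_nat (Z.to_nat (x - a)) by lia.
by rewrite E; apply: P'; lia.
Qed.

Lemma Z_down (P : Z -> Prop) a b : P b -> (forall x, a < x <= b -> P x -> P (x - 1)) ->
  forall x, a <= x <= b -> P x.
Proof.
move=> Pb step x hx.
have P' (l : nat) : a <= b - Z.of_nat l -> P (b - Z.of_nat l).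
  elim: l => [|l IH] h; first by rewrite Z.sub_0_r.
  have -> : b - Z.of_nat l.+1 = b - Z.of_nat l - 1 by lia.
  by apply: step; [lia | apply: IH; lia].
have E : x = b - Z.of_nat (Z.to_nat (b - x)) by lia.
by rewrite E; apply: P'; lia.
Qed.

Section Reach.
Variables (X : Type) (D : X -> X -> Prop) (A : X -> Prop).

Definition reach u v := exists l, walk D A l u v.

Lemma reach_refl u : A u -> reach u u.
Proof. by move=> Au; exists 0%N; apply: walk_nil. Qed.

Lemma reach_trans u v x : reach u v -> reach v x -> reach u x.
Proof. by move=> [i wi] [j wj]; exists (i + j)%N; apply: walk_cat wi wj. Qed.

Lemma reach1 u v : A u -> A v -> D u v -> reach u v.
Proof. by move=> Au Av Duv; exists 1%N; apply: walk1. Qed.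

Lemma connected_hub c : (forall u, A u -> reach u c) -> (forall v, A v -> reach c v) ->
  connected D A.
Proof. by move=> to from u v /to uc /from; apply: reach_trans uc. Qed.
End Reach.

(** * Staircases below an empty first row *)

Section Corner.
Variables (n m : Z) (w : Z -> Z).
Hypotheses (m4 : 4 <= m) (w0 : w 0 = 0).
Hypothesis w_range : forall y, 1 <= y < m -> 2 <= w y <= n.
Hypothesis w_mono : forall y y', 0 <= y <= y' -> y' < m -> w y <= w y'.
Hypotheses (w_end : w (m - 2) = n) (w_end' : w (m - 1) = n).

(* Arcs go down the left border, right along the last row and across the right
   border of [S], down to the last row from the row above it except in the last
   column, and left or up everywhere else; [S] is entered from (0, 0) only. *)
Definition cornerH x y := (y =? m - 1) || (x + 1 =? w y).
Definition cornerV x y := (x =? 0) || (y + 1 =? m - 1) && (x + 1 <? n).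
Local Notation D := (arc cornerH cornerV).
Local Notation ibox := (box 0 n m).
Local Notation S := (fun c : cell => ibox c /\ c.1 <? w c.2).

Let n2 : 2 <= n. Proof. by have := w_range (y := m - 1); lia. Qed.

Lemma corner_down y : 0 <= y < m -> walk D ibox (Z.to_nat (y - 0)) (0, 0) (0, y).
Proof. by move=> hy; apply: walkD => [|t ht|t ht]; rewrite /box /cornerV /=; lia. Qed.

Lemma corner_bottom x x' : 0 <= x <= x' -> x' < n ->
  walk D ibox (Z.to_nat (x' - x)) (x, m - 1) (x', m - 1).
Proof. by move=> hx hx'; apply: walkR => [|t ht|t ht]; rewrite /box /cornerH /=; lia. Qed.

Lemma corner_end : walk D ibox (Z.to_nat (m - 1 - (m - 2))) (n - 1, m - 1) (n - 1, m - 2).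
Proof. by apply: walkU => [|t ht|t ht]; rewrite /box /cornerV /=; lia. Qed.

Lemma corner_left x : 0 <= x < n ->
  walk D ibox (Z.to_nat (n - 1 - x)) (n - 1, m - 2) (x, m - 2).
Proof. by move=> hx; apply: walkL => [|t ht|t ht]; rewrite /box /cornerH /=; lia. Qed.

Lemma corner_up x y y' : 1 <= x < n -> 0 <= y' <= y -> y <= m - 2 ->
  walk D ibox (Z.to_nat (y - y')) (x, y) (x, y').
Proof. by move=> hx hy hy'; apply: walkU => [|t ht|t ht]; rewrite /box /cornerV /=; lia. Qed.

Lemma corner_top x : 0 <= x < n -> walk D ibox (Z.to_nat (x - 0)) (x, 0) (0, 0).
Proof. by move=> hx; apply: walkL => [|t ht|t ht]; rewrite /box /cornerH /= ?w0; lia. Qed.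

Lemma corner_connected : connected D ibox.
Proof.
have from v : ibox v -> reach D ibox (0, 0) v.
  case: v => x y [/= hx hy].
  have to_end : reach D ibox (0, 0) (n - 1, m - 2).
    apply: reach_trans (ex_intro _ _ (corner_down (y := m - 1) _)) _; first lia.
    apply: reach_trans (ex_intro _ _ (corner_bottom (x := 0) (x' := n - 1) _ _)) _; try lia.
    by eexists; apply: corner_end.
  case: (Z.eq_dec x 0) => [->|x0]; first by eexists; apply: corner_down; lia.
  case: (Z.eq_dec y (m - 1)) => [->|ym].
    apply: reach_trans (ex_intro _ _ (corner_down (y := m - 1) _)) _; first lia.
    by eexists; apply: corner_bottom; lia.
  apply: reach_trans to_end _.
  apply: reach_trans (ex_intro _ _ (corner_left (x := x) _)) _; first lia.
  by eexists; apply: corner_up; lia.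
apply: connected_hub from => -[x y] [/= hx hy].
have up x' y' : 1 <= x' < n -> 0 <= y' <= m - 2 -> reach D ibox (x', y') (0, 0).
  move=> hx' hy'; apply: reach_trans (ex_intro _ _ (corner_up (y' := 0) _ _ _)) _; try lia.
  by eexists; apply: corner_top; lia.
have bottom x' : 0 <= x' < n -> reach D ibox (x', m - 1) (0, 0).
  move=> hx'; apply: reach_trans (ex_intro _ _ (corner_bottom (x' := n - 1) _ _)) _; try lia.
  by apply: reach_trans (ex_intro _ _ corner_end) (up _ _ _ _); lia.
case: (Z.eq_dec y (m - 1)) => [->|ym]; first exact: bottom.
case: (Z.eq_dec x 0) => [->|x0]; last by apply: up; lia.
apply: reach_trans (bottom 0 _); last lia.
exists (Z.to_nat (m - 1 - y)).
by apply: walkD => [|t ht|t ht]; rewrite /box /cornerV /=; lia.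
Qed.

Let w_bottom y : m - 2 <= y < m -> w y = n.
Proof.
by move=> hy; have [->|->] : y = m - 2 \/ y = m - 1 by lia.
Qed.

Lemma young_notin c : ibox c -> ~ S c -> w c.2 <= c.1.
Proof. by move=> Bc nS; case: (Z.ltb_spec c.1 (w c.2)) => // lt; case: nS; split=> //; lia. Qed.

(** From a vertex (x, y) outside, entering [S] through (0, 0) costs at least x + y + 1 arcs by the
    Manhattan distance. From an exit (x, y) the way back inside goes left to a column that row 1
    still contains, up to row 1 and left, in x + y - 1 arcs. *)
Lemma corner_convex : geoconvex D ibox S.
Proof.
apply: (@convex_single_entry _ _ _ _ (0, 1) (fun c => Z.to_nat (c.1 + c.2 + 1))).
- by move=> c [].
- move=> [x y] [x' y'] Bu Bv a /(young_notin Bu)/= nS [_ /Z.ltb_lt /= S'].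
  case: Bu Bv => /= hx hy [/= hx' hy'].
  arc_case a h x' y'; move: h; rewrite /cornerH /cornerV => h.
  + lia.
  + lia.
  + have y0 : y = 0.
      by case: (Z.eq_dec y 0) => // y0; have := w_range (y := y); have := w_bottom (y := y); lia.
    by subst y; split; [congr pair; lia | lia].
  by have := w_mono (y := y - 1) (y' := y); lia.
- move=> [x y] [x' y'] [/= hx hy] [/= hx' hy'] /arc_dist; rewrite /dist /=; lia.
move=> [x y] [x' y'] Bu Bv a [_ /Z.ltb_lt /= Su] /(young_notin Bv)/= nS.
case: Bu Bv => /= hx hy [/= hx' hy'].
have y1 : 1 <= y by case: (Z.eq_dec y 0) => [E|]; [move: Su; rewrite E w0; lia | lia].
have [x1 ym] : 1 <= x /\ y <= m - 2.
  arc_case a h x' y'; move: h; rewrite /cornerH /cornerV => h.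
  + by have := w_range (y := y); have := w_bottom (y := y); lia.
  + lia.
  + by have := w_mono (y := y) (y' := y + 1); lia.
  by split; first lia; have := w_bottom (y := y - 1); lia.
pose x1' := Z.min x (w 1 - 1).
have w1 := w_range (y := 1); have w1y := w_mono (y := 1) (y' := y).
have SI a' b' : 0 <= a' < w b' -> 1 <= b' < m -> S (a', b').
  move=> ha hb; have wb := w_range (y := b').
  by split; [rewrite /box /=; lia | apply/Z.ltb_lt => /=; lia].
exists (Z.to_nat (x - x1') + (Z.to_nat (y - 1) + Z.to_nat (x1' - 0)))%N.
  apply: (@walk_cat _ _ _ _ _ _ (x1', y)).
    by apply: walkL => [|t ht|t ht]; [lia|apply: SI; lia|rewrite /cornerH; lia].
  apply: (@walk_cat _ _ _ _ _ _ (x1', 1)).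
    apply: walkU => [|t ht|t ht]; [lia| |rewrite /cornerV; lia].
    by apply: SI; last lia; have := w_mono (y := 1) (y' := t); lia.
  by apply: walkL => [|t ht|t ht]; [lia|apply: SI; lia|rewrite /cornerH; lia].
have := arc_dist a; rewrite /dist /=; move: (arc_dist a); rewrite /dist /=; lia.
Qed.
(** Outside [S], except at (0, 0), every arc decreases the sum of the coordinates, so out-neighbours
    in [T] lead from [z] to (0, 0). From there each vertex has a single way out, down the left
    border and along the last row, until the opposite corner is reached. The geodesics from that
    corner to (0, 0) that follow row [m - 2], a column and row 0 cover the rest. *)
Lemma corner_hull T z : geoconvex D ibox T -> (exists2 u, T u & exists2 v, T v & u <> v) ->
  T z -> ~ S z -> forall c, ibox c -> T c.
Proof.
move=> gT [u0 Tu0 [v0 Tv0 nuv]] Tz nSz.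
have out u : T u -> exists2 v, T v & D u v.
  move=> Tu; have cD := corner_connected.
  case: (classic (u = u0)) => [E|]; last exact: geoconvex_out gT cD Tu Tu0.
  by apply: geoconvex_out gT cD Tu Tv0 _; rewrite E.
have T00 : T (0, 0).
  have [k le] : exists k : nat, z.1 + z.2 <= Z.of_nat k by exists (Z.to_nat (z.1 + z.2)); lia.
  elim: k z Tz nSz le => [|k IH] [x y] Tz nSz /= le.
    have [/= hx hy] := gT.1 _ Tz; have [Ex Ey] : x = 0 /\ y = 0 by lia.
    by rewrite Ex Ey in Tz.
  have Bz := gT.1 _ Tz; have := Bz => -[/= hx hy].
  have /= wx := young_notin Bz nSz.
  have [[x' y'] Tv a] := out _ Tz; have := gT.1 _ Tv => -[/= hx' hy'].
  have wb := w_bottom (y := y); have wr := w_range (y := y).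
  have [z0|z0] : (x = 0 /\ y = 0) \/ ~ (x = 0 /\ y = 0) by lia.
    by case: z0 Tz => -> ->.
  arc_case a h x' y'; move: h; rewrite /cornerH /cornerV => h; try lia.
    by apply: (IH _ Tv) => /=; [case=> _ /Z.ltb_lt /= ?; lia | lia].
  have wm := w_mono (y := y - 1) (y' := y).
  by apply: (IH _ Tv) => /=; [case=> _ /Z.ltb_lt /= ?; lia | lia].
have T0y : forall y, 0 <= y <= m - 1 -> T (0, y).
  apply: Z_up T00 _ => y hy Ty; have [[x' y'] Tv a] := out _ Ty.
  have := gT.1 _ Tv => -[/= hx' hy']; have wr := w_range (y := y).
  arc_case a h x' y'; move: h; rewrite /cornerH /cornerV => h; try lia; last by [].
  by move: h; case: (Z.eq_dec y 0) => [->|]; rewrite ?w0; lia.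
have Tbot : forall x, 0 <= x <= n - 1 -> T (x, m - 1).
  apply: Z_up => [|x hx Tx]; first by apply: T0y; lia.
  have [[x' y'] Tv a] := out _ Tx; have := gT.1 _ Tv => -[/= hx' hy'].
  by arc_case a h x' y'; move: h; rewrite /cornerH /cornerV => h; try lia.
case=> x y [/= hx hy].
case: (Z.eq_dec y (m - 1)) => [->|ym]; first by apply: Tbot; lia.
case: (Z.eq_dec x 0) => [->|x0]; first by apply: T0y; lia.
have TE : T (n - 1, m - 1) by apply: Tbot; lia.
apply: (monotone_closed gT TE T00 (walk_cat corner_end (walk_cat (corner_left (x := x) _)
   (corner_up (x := x) (y := m - 2) (y' := y) _ _ _)))
   (walk_cat (corner_up (y' := 0) _ _ _) (corner_top _))); try lia.
rewrite /dist /=; lia.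
Qed.
End Corner.

Lemma card_young n m (w : nat -> nat) : (forall i, (i < m)%N -> (w i <= n)%N) ->
  #|[set u : 'I_n * 'I_m | (emb 0 u).1 <? Z.of_nat (w (Z.to_nat (emb 0 u).2))]|
  = (\sum_(i < m) w i)%N.
Proof.
move=> wn; pose F (x : 'I_n) (i : 'I_m) : nat := (x < w i)%N.
transitivity (\sum_(u : 'I_n * 'I_m) F u.1 u.2)%N.
  rewrite cardsE -sum1_card big_mkcond; apply: eq_bigr => u _.
  by rewrite unfold_in /F /emb /= Nat2Z.id; case: ifP; lia.
rewrite -(pair_bigA _ F) exchange_big /=; apply: eq_bigr => i _.
transitivity (\sum_(x < w i) 1)%N; last by rewrite sum1_card card_ord.
rewrite (big_ord_widen n (fun=> 1%N) (wn i (ltn_ord i))) [RHS]big_mkcond /=.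
by apply: eq_bigr => x _; rewrite /F; case: ltnP.
Qed.

Lemma sum_strictly_between n m (w : nat -> nat) i j :
  (forall i, (i < m)%N -> (w i <= n)%N) -> (i < m)%N -> (w i < n)%N ->
  (j < m)%N -> (0 < w j)%N -> (0 < \sum_(i < m) w i < n * m)%N.
Proof.
move=> wn im wi jm wj; apply/andP; split.
  by rewrite (bigD1 (Ordinal jm)) //= addn_gt0 wj.
have -> : (n * m = \sum_(i < m) n)%N by rewrite sum_nat_const card_ord mulnC.
rewrite (bigD1 (Ordinal im)) //=.
rewrite [X in (_ < X)%N](bigD1 (Ordinal im)) //= -addSn leq_add //.
by apply: leq_sum => l _; apply: wn.
Qed.

Lemma corner_spectrum n m (w : nat -> nat) : (4 <= m)%N -> w 0%N = 0%N ->
  (forall i, (0 < i < m)%N -> (2 <= w i <= n)%N) ->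
  (forall i j, (i <= j < m)%N -> (w i <= w j)%N) -> w m.-2 = n -> w m.-1 = n ->
  strong_convexity_spectrum (cartesian_product (@path_graph n) (@path_graph m))
    (\sum_(i < m) w i)%N.
Proof.
move=> m4 w0 wr wm we we'; pose W y := Z.of_nat (w (Z.to_nat y)).
have W1 : W 0 = 0 by rewrite /W w0.
have W2 y : 1 <= y < Z.of_nat m -> 2 <= W y <= Z.of_nat n.
  by move=> hy; have := wr (Z.to_nat y); rewrite /W; lia.
have W3 y y' : 0 <= y <= y' -> y' < Z.of_nat m -> W y <= W y'.
  by move=> hy hy'; have := wm (Z.to_nat y) (Z.to_nat y'); rewrite /W; lia.
have W4 : W (Z.of_nat m - 2) = Z.of_nat n.
  by rewrite /W -we; congr (Z.of_nat (w _)); lia.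
have W5 : W (Z.of_nat m - 1) = Z.of_nat n.
  by rewrite /W -we'; congr (Z.of_nat (w _)); lia.
have m4' : 4 <= Z.of_nat m by lia.
have wn i : (i < m)%N -> (w i <= n)%N.
  by case: i => [|i] hi; [rewrite w0 | have := wr i.+1; lia].
have n2 : (2 <= n)%N by have := wr m.-1; lia.
apply: (@spectrum_intro n m 0 (cornerH (Z.of_nat m) W)
  (cornerV (Z.of_nat n) (Z.of_nat m)) (fun c => c.1 <? W c.2)).
- exact: card_young.
- by apply: (sum_strictly_between (i := 0) (j := m.-1)) => //; rewrite ?w0 ?we'; lia.
- by rewrite Z.add_0_l; apply: corner_connected.
- by rewrite Z.add_0_l; apply: corner_convex.
move=> T; rewrite Z.add_0_l => gT T2 [z Tz nz]; left.
by apply: (corner_hull m4' W1 W2 W3 W4 W5 gT T2 Tz) => -[_ Sz]; rewrite Sz in nz.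
Qed.

Lemma walk_crossing X (D : X -> X -> Prop) (A B : X -> Prop) l u v :
  walk D A l u v -> ~ B u -> B v -> exists a b, [/\ A a, A b, D a b, ~ B a & B b].
Proof.
elim=> [x _ nB /nB //|l' x y v' Ax Dxy w IH nBx Bv].
case: (classic (B y)) => By; last exact: IH.
by exists x, y; split=> //; apply: walk_first w.
Qed.

(** * Staircases whose complement lies in the last two columns *)

Section Notch.
Variables (n m : Z) (w : Z -> Z).
Hypotheses (n4 : 4 <= n) (m5 : 5 <= m).
Hypothesis w_top : forall y, 0 <= y <= 2 -> w y = n - 2.
Hypothesis w_range : forall y, 0 <= y < m -> n - 2 <= w y <= n.
Hypothesis w_mono : forall y y', 0 <= y <= y' -> y' < m -> w y <= w y'.
Hypothesis w_bottom : forall y, m - 2 <= y < m -> w y = n.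

(* As for a corner, except that the complement is left from (n - 2, 0) to its left
   neighbour only, along the path (n - 2, 1), (n - 1, 1), (n - 1, 0), (n - 2, 0). *)
Definition notchH x y :=
  [|| y =? m - 1, (x + 1 =? w y) && (0 <? y) | (y =? 1) && (x =? n - 2)].
Definition notchV x y :=
  [|| x =? 0, (y + 1 =? m - 1) && (x + 1 <? n), (y =? 0) && (x =? n - 2)
    | (y =? 1) && (x =? n - 1)].
Local Notation D := (arc notchH notchV).
Local Notation ibox := (box 0 n m).
Local Notation S := (fun c : cell => ibox c /\ c.1 <? w c.2).

Lemma notch_notin c : ibox c -> ~ S c -> w c.2 <= c.1.
Proof. by move=> Bc nS; case: (Z.ltb_spec c.1 (w c.2)) => // lt; case: nS; split=> //; lia. Qed.

Lemma notch_down y y' : 0 <= y <= y' -> y' < m ->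
  walk D ibox (Z.to_nat (y' - y)) (0, y) (0, y').
Proof. by move=> hy hy'; apply: walkD => [|t ht|t ht]; rewrite /box /notchV /=; lia. Qed.

Lemma notch_bottom x x' : 0 <= x <= x' -> x' < n ->
  walk D ibox (Z.to_nat (x' - x)) (x, m - 1) (x', m - 1).
Proof. by move=> hx hx'; apply: walkR => [|t ht|t ht]; rewrite /box /notchH /=; lia. Qed.

Lemma notch_end : walk D ibox (Z.to_nat (m - 1 - (m - 2))) (n - 1, m - 1) (n - 1, m - 2).
Proof. by apply: walkU => [|t ht|t ht]; rewrite /box /notchV /=; lia. Qed.

Lemma notch_left x : 0 <= x < n ->
  walk D ibox (Z.to_nat (n - 1 - x)) (n - 1, m - 2) (x, m - 2).
Proof.
move=> hx; have wm := w_bottom (y := m - 2).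
by apply: walkL => [|t ht|t ht]; rewrite /box /notchH /=; lia.
Qed.

Lemma notch_up x y y' : 1 <= x < n -> 0 <= y' <= y -> y <= m - 2 ->
  (x = n - 2 -> 1 <= y') -> (x = n - 1 -> 2 <= y') ->
  walk D ibox (Z.to_nat (y - y')) (x, y) (x, y').
Proof. by move=> hx hy hy' h h'; apply: walkU => [|t ht|t ht]; rewrite /box /notchV /=; lia. Qed.

Lemma notch_top x x' : 0 <= x' <= x -> x < n ->
  walk D ibox (Z.to_nat (x - x')) (x, 0) (x', 0).
Proof. by move=> hx hx'; apply: walkL => [|t ht|t ht]; rewrite /box /notchH /=; lia. Qed.

Let D1 : cell := (n - 2, 0).
Let D2 : cell := (n - 1, 0).
Let B1 : cell := (n - 2, 1).
Let B2 : cell := (n - 1, 1).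

Lemma notch_B1B2 : D B1 B2.
Proof. by apply: Or41; rewrite /notchH /=; split; lia. Qed.

Lemma notch_B2D2 : D B2 D2.
Proof. by apply: Or44; rewrite /notchV /=; split; lia. Qed.

Lemma notch_A2A1 : D (n - 1, 2) (n - 2, 2).
Proof. by apply: Or42; rewrite /notchH /= w_top; split; lia. Qed.

Lemma notch_connected : connected D ibox.
Proof.
have hub : reach D ibox B1 D2.
  by apply: (@reach_trans _ _ _ _ B2); apply: reach1;
     rewrite ?/box /=; try lia; [exact: notch_B1B2 | exact: notch_B2D2].
have top x : 0 <= x < n -> reach D ibox (x, 0) (0, 0).
  by move=> hx; eexists; apply: notch_top; lia.
have from v : ibox v -> reach D ibox (0, 0) v.
  case: v => x y [/= hx hy].
  have to_end : reach D ibox (0, 0) (n - 1, m - 2).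
    apply: reach_trans (ex_intro _ _ (notch_down (y := 0) (y' := m - 1) _ _)) _; try lia.
    apply: reach_trans (ex_intro _ _ (notch_bottom (x := 0) (x' := n - 1) _ _)) _; try lia.
    by eexists; apply: notch_end.
  have up x' y' : 1 <= x' < n -> 0 <= y' <= m - 2 ->
      (x' = n - 2 -> 1 <= y') -> (x' = n - 1 -> 2 <= y') -> reach D ibox (0, 0) (x', y').
    move=> hx' hy' h h'; apply: reach_trans to_end _.
    apply: reach_trans (ex_intro _ _ (notch_left (x := x') _)) _; first lia.
    by eexists; apply: notch_up; lia.
  case: (Z.eq_dec x 0) => [->|x0]; first by eexists; apply: notch_down; lia.
  case: (Z.eq_dec y (m - 1)) => [->|ym].
    apply: reach_trans (ex_intro _ _ (notch_down (y := 0) (y' := m - 1) _ _)) _; try lia.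
    by eexists; apply: notch_bottom; lia.
  have toB1 : reach D ibox (0, 0) B1 by apply: up; lia.
  case: (Z.eq_dec y 0) => [y0|y0].
    case: (Z_lt_dec x (n - 2)) => xn; first by apply: up; lia.
    have toD2 := reach_trans toB1 hub; rewrite y0.
    by apply: reach_trans toD2 _; eexists; apply: notch_top; lia.
  case: (Z.eq_dec x (n - 1)) => xn; last by apply: up; lia.
  case: (Z.eq_dec y 1) => y1; last by apply: up; lia.
  rewrite xn y1; apply: reach_trans toB1 _.
  by apply: reach1 notch_B1B2; rewrite /box /=; lia.
apply: connected_hub from => -[x y] [/= hx hy].
have fromB1 : reach D ibox B1 (0, 0) by apply: reach_trans hub _; apply: top; lia.
have up2 y' : 1 <= y' <= m - 2 -> reach D ibox (n - 2, y') (0, 0).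
  by move=> hy'; apply: reach_trans fromB1; eexists; apply: notch_up; lia.
have up x' y' : 1 <= x' < n -> 0 <= y' <= m - 2 -> reach D ibox (x', y') (0, 0).
  move=> hx' hy'; case: (Z.eq_dec y' 0) => [->|y0]; first by apply: top; lia.
  case: (Z.eq_dec x' (n - 2)) => [->|x2]; first by apply: up2; lia.
  case: (Z.eq_dec x' (n - 1)) => [->|x1]; last first.
    apply: reach_trans (ex_intro _ _ (notch_up (y' := 0) _ _ _ _ _)) _; try lia.
    by apply: top; lia.
  case: (Z.eq_dec y' 1) => [->|y1].
    apply: reach_trans (reach1 _ _ notch_B2D2) (top _ _); rewrite /box /=; lia.
  apply: reach_trans (ex_intro _ _ (notch_up (y' := 2) _ _ _ _ _)) _; try lia.
  apply: reach_trans (reach1 _ _ notch_A2A1) (up2 _ _); rewrite /box /=; lia.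
have bottom x' : 0 <= x' < n -> reach D ibox (x', m - 1) (0, 0).
  move=> hx'; apply: reach_trans (ex_intro _ _ (notch_bottom (x' := n - 1) _ _)) _; try lia.
  by apply: reach_trans (ex_intro _ _ notch_end) (up _ _ _ _); lia.
case: (Z.eq_dec y (m - 1)) => [->|ym]; first exact: bottom.
case: (Z.eq_dec x 0) => [->|x0]; last by apply: up; lia.
apply: reach_trans (bottom 0 _); last lia.
by eexists; apply: notch_down; lia.
Qed.

Lemma notch_entry u v : ibox u -> ibox v -> D u v -> ~ S u -> S v ->
  u = D1 /\ v = (n - 3, 0).
Proof.
move: u v => [x y] [x' y'] Bu Bv a /(notch_notin Bu)/= nS [_ /Z.ltb_lt /= S'].
case: Bu Bv => /= hx hy [/= hx' hy'].
have wt := w_top (y := 0); have wr := w_range (y := y); have wb := w_bottom (y := y).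
arc_case a h x' y'; move: h; rewrite /notchH /notchV => h.
- lia.
- have y0 : y = 0 by lia.
  by subst y; rewrite /D1; split; congr pair; lia.
- by have wt' := w_top (y := y + 1); lia.
by have := w_mono (y := y - 1) (y' := y); lia.
Qed.

(** Lower bound on the number of arcs from a vertex outside [S] to (n - 3, 0). The values 1, 2, 3
    belong to the last three vertices of the exit path through the corner block; any other vertex
    outside has to pass through (n - 2, 1), which is 4 arcs away. *)
Definition notchf (c : cell) : nat :=
  if (c.2 =? 0)%Z then (if (c.1 =? n - 2)%Z then 1%N else 2%N)
  else if ((c.2 =? 1) && (c.1 =? n - 1))%Z then 3%N
  else Z.to_nat (Z.abs (c.1 - (n - 2)) + Z.abs (c.2 - 1) + 4)%Z.

Lemma notch_convex : geoconvex D ibox S.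
Proof.
apply: (@convex_single_entry _ _ _ _ (n - 3, 0) notchf).
- by move=> c [].
- move=> u v Bu Bv a nS Sv; have [-> ->] := notch_entry Bu Bv a nS Sv.
  by rewrite /notchf /D1 /= !Z.eqb_refl.
- move=> [x y] [x' y'] Bu Bv a /(notch_notin Bu)/= nS /(notch_notin Bv)/= nS'.
  case: Bu Bv => /= hx hy [/= hx' hy'].
  have wr := w_range (y := y); have wr' := w_range (y := y').
  have wt := w_top (y := y).
  arc_case a h x' y'; move: h; rewrite /notchH /notchV /notchf /= => h;
    repeat case: ifP => ?; lia.
move=> [x y] [x' y'] Bu Bv a [_ /Z.ltb_lt /= Su] /(notch_notin Bv)/= nS.
case: Bu Bv => /= hx hy [/= hx' hy'].
have wt := w_top (y := y); have wr := w_range (y := y); have wb := w_bottom (y := y).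
have [x1 y1] : n - 3 <= x /\ 1 <= y <= m - 2.
  arc_case a h x' y'; move: h; rewrite /notchH /notchV => h.
  + lia.
  + lia.
  + by have := w_mono (y := y) (y' := y + 1); lia.
  by have := w_range (y := y - 1); have := w_bottom (y := y - 1); lia.
have SI a' b' : 0 <= a' < w b' -> 0 <= b' < m -> S (a', b').
  move=> ha hb; have wb' := w_range (y := b').
  by split; [rewrite /box /=; lia | apply/Z.ltb_lt => /=; lia].
exists (Z.to_nat (x - (n - 3)) + Z.to_nat (y - 0))%N.
  apply: (@walk_cat _ _ _ _ _ _ (n - 3, y)).
    by apply: walkL => [|t ht|t ht]; [lia|apply: SI; lia|rewrite /notchH; lia].
  apply: walkU => [|t ht|t ht]; [lia| |rewrite /notchV; lia].
  by apply: SI; last lia; have := w_range (y := t); lia.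
have wt' := w_top (y := y - 1).
arc_case a h x' y'; move: h; rewrite /notchH /notchV /notchf /= => h;
    repeat case: ifP => ?; lia.
Qed.

(** Meeting both sides, [T] uses the only arc that enters [S]. Forced out-neighbours then run along
    the top row, the left border and the last row, and geodesics between opposite corners fill [S].
    Forced in-neighbours run backwards through the corner block to (n - 2, 1). Paths with two arcs
    give the column [n - 2] and the vertex (n - 1, 2), and vertical geodesics the remaining
    vertices. *)
Lemma notch_hull T u z : geoconvex D ibox T -> T u -> S u -> T z -> ~ S z ->
  forall c, ibox c -> T c.
Proof.
move=> gT Tu Su Tz nSz; have cD := notch_connected.
have out a : T a -> exists2 v, T v & D a v.
  move=> Ta; case: (classic (a = u)) => [E|]; last exact: geoconvex_out gT cD Ta Tu.
  by apply: geoconvex_out gT cD Ta Tz _ => E'; apply: nSz; rewrite -E' E.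
have inn a : T a -> exists2 v, T v & D v a.
  move=> Ta; case: (classic (u = a)) => [E|]; last exact: geoconvex_in gT cD Tu Ta.
  by apply: geoconvex_in gT cD Tz Ta _ => E'; apply: nSz; rewrite E' -E.
have [l [wl _]] := geoconvex_walk gT cD Tz Tu.
have [a [b [Ta Tb Dab nSa Sb]]] := walk_crossing wl nSz Su.
have [Ea Eb] := notch_entry (gT.1 _ Ta) (gT.1 _ Tb) Dab nSa Sb.
rewrite {}Ea {}Eb {nSa Sb Dab wl l} in Ta Tb.
have Ttop : forall x, 0 <= x <= n - 3 -> T (x, 0).
  apply: Z_down Tb _ => x hx Tx; have [[x' y'] Tv a'] := out _ Tx.
  have := gT.1 _ Tv => -[/= hx' hy'].
  by arc_case a' h x' y'; move: h; rewrite /notchH /notchV => h; try lia.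
have T0y : forall y, 0 <= y <= m - 1 -> T (0, y).
  apply: Z_up => [|y hy Ty]; first by apply: Ttop; lia.
  have [[x' y'] Tv a'] := out _ Ty.
  have := gT.1 _ Tv => -[/= hx' hy']; have wr := w_range (y := y).
  by arc_case a' h x' y'; move: h; rewrite /notchH /notchV => h; try lia.
have Tbot : forall x, 0 <= x <= n - 1 -> T (x, m - 1).
  apply: Z_up => [|x hx Tx]; first by apply: T0y; lia.
  have [[x' y'] Tv a'] := out _ Tx; have := gT.1 _ Tv => -[/= hx' hy'].
  by arc_case a' h x' y'; move: h; rewrite /notchH /notchV => h; try lia.
have TE : T (n - 1, m - 1) by apply: Tbot; lia.
have T00 : T (0, 0) by apply: Ttop; lia.
have TS x y : 0 <= x < w y -> 0 <= y < m -> T (x, y).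
  move=> hx hy; have wr := w_range (y := y).
  case: (Z.eq_dec y (m - 1)) => [->|ym]; first by apply: Tbot; lia.
  case: (Z.eq_dec x 0) => [->|x0]; first by apply: T0y; lia.
  have wt := w_top (y := y); pose x1 := Z.min x (n - 3).
  have wleft : walk D ibox (Z.to_nat (x - x1)) (x, y) (x1, y).
    by apply: walkL => [|t ht|t ht]; rewrite /box /notchH /=; lia.
  apply: (monotone_closed gT TE T00 (walk_cat notch_end (walk_cat (notch_left (x := x) _)
   (notch_up (x := x) (y := m - 2) (y' := y) _ _ _ _ _)))
   (walk_cat wleft (walk_cat (notch_up (y' := 0) _ _ _ _ _) (notch_top (x' := 0) _ _))));
   try lia.
  rewrite /dist /=; lia.
have TD2 : T D2.
  have [[x y] Tv a'] := inn _ Ta; have := gT.1 _ Tv => -[/= hx hy].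
  move: a' => /arcE; rewrite /notchH /notchV /D1 /= => a'.
  have [Ex Ey] : x = n - 1 /\ y = 0 by lia.
  by rewrite Ex Ey in Tv.
have TB2 : T B2.
  have [[x y] Tv a'] := inn _ TD2; have := gT.1 _ Tv => -[/= hx hy].
  move: a' => /arcE; rewrite /notchH /notchV /D2 /= => a'.
  have [Ex Ey] : x = n - 1 /\ y = 1 by lia.
  by rewrite Ex Ey in Tv.
have TB1 : T B1.
  have [[x y] Tv a'] := inn _ TB2; have := gT.1 _ Tv => -[/= hx hy].
  move: a' => /arcE; rewrite /notchH /notchV /B2 /= => a'.
  have [Ex Ey] : x = n - 2 /\ y = 1 by lia.
  by rewrite Ex Ey in Tv.
have Tcol : forall y, 1 <= y <= m - 2 -> T (n - 2, y).
  apply: Z_up TB1 _ => y hy Ty; have wr := w_range (y := y + 1).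
  case: (Z_lt_dec (n - 2) (w (y + 1))) => lt; first by apply: TS; lia.
  apply: (two_path_closed gT (u := (n - 3, y + 1)) (v := (n - 2, y))) => //.
  - by rewrite /box /=; lia.
  - by apply: TS; lia.
  - by apply: Or41; rewrite /notchH /=; split; lia.
  by apply: Or44; rewrite /notchV /=; split; lia.
have TA2 : T (n - 1, 2).
  apply: (two_path_closed gT (u := B2) (v := (n - 2, 2))) => //.
  - by rewrite /box /=; lia.
  - by apply: Tcol; lia.
  - by apply: Or43; rewrite /notchV /=; split; lia.
  exact: notch_A2A1.
case=> x y [/= hx hy]; have wr := w_range (y := y); have wb := w_bottom (y := y).
case: (Z_lt_dec x (w y)) => lt; first by apply: TS; lia.
have [->|xn] : x = n - 2 \/ x = n - 1 by lia.
  by case: (Z.eq_dec y 0) => [->//|y0]; apply: Tcol; lia.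
rewrite xn; case: (Z.eq_dec y 0) => [->//|y0]; case: (Z.eq_dec y 1) => [->//|y1].
have TE' : T (n - 1, m - 2) by apply: TS; have := w_bottom (y := m - 2); lia.
apply: (monotone_closed gT TE' TA2 (notch_up (y' := y) _ _ _ _ _)
  (notch_up (y' := 2) _ _ _ _ _)); try lia.
rewrite /dist /=; lia.
Qed.
End Notch.

(** [notch_hull] handles the convex sets that meet [S] and its complement. Those that avoid [S] are
    bounded by counting, which asks [S] to contain half of the vertices. *)
Lemma notch_spectrum n m (w : nat -> nat) k : (4 <= n)%N -> (5 <= m)%N ->
  (forall i, (i <= 2)%N -> w i = (n - 2)%N) ->
  (forall i, (i < m)%N -> (n - 2 <= w i <= n)%N) ->
  (forall i j, (i <= j < m)%N -> (w i <= w j)%N) ->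
  (forall i, (m - 2 <= i < m)%N -> w i = n) ->
  (\sum_(i < m) w i)%N = k -> (n * m <= k.*2)%N ->
  strong_convexity_spectrum (cartesian_product (@path_graph n) (@path_graph m)) k.
Proof.
move=> n4 m5 wt wr wm wb Ek le; pose W y := Z.of_nat (w (Z.to_nat y)).
have [n4' m5'] : 4 <= Z.of_nat n /\ 5 <= Z.of_nat m by lia.
have W1 y : 0 <= y <= 2 -> W y = Z.of_nat n - 2.
  by move=> hy; have := wt (Z.to_nat y); rewrite /W; lia.
have W2 y : 0 <= y < Z.of_nat m -> Z.of_nat n - 2 <= W y <= Z.of_nat n.
  by move=> hy; have := wr (Z.to_nat y); rewrite /W; lia.
have W3 y y' : 0 <= y <= y' -> y' < Z.of_nat m -> W y <= W y'.
  by move=> hy hy'; have := wm (Z.to_nat y) (Z.to_nat y'); rewrite /W; lia.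
have W4 y : Z.of_nat m - 2 <= y < Z.of_nat m -> W y = Z.of_nat n.
  by move=> hy; have := wb (Z.to_nat y); rewrite /W; lia.
have wn i : (i < m)%N -> (w i <= n)%N by move/wr; lia.
have Sk := etrans (card_young wn) Ek.
apply: (@spectrum_intro n m 0 (notchH (Z.of_nat n) (Z.of_nat m) W)
  (notchV (Z.of_nat n) (Z.of_nat m)) (fun c => c.1 <? W c.2)) => //.
- rewrite -Ek; apply: (sum_strictly_between (i := 0) (j := m.-1)) => //; try lia.
    by rewrite wt; lia.
  by have := wr m.-1; lia.
- by rewrite Z.add_0_l; apply: notch_connected.
- by rewrite Z.add_0_l; apply: notch_convex.
move=> T; rewrite Z.add_0_l => gT _ [z Tz nz].
case: (classic (exists2 u, T u & u.1 <? W u.2)) => [[u Tu Su]|no]; last first.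
  right; apply: (covered_complement Sk le); first exact: gT.1.
  by move=> c Tc; apply/negP=> Sc; apply: no; exists c; [exact: Tc | exact: Sc].
left; apply: (notch_hull n4' m5' W1 W2 W3 W4 gT Tu _ Tz) => [|[_ Sz]].
  by split=> //; apply: gT.1.
by rewrite Sz in nz.
Qed.

Local Close Scope Z_scope.

(** * Directed faces *)

Local Open Scope Z_scope.

Definition cycle4 (D : cell -> cell -> Prop) a b c d := [/\ D a b, D b c, D c d & D d a].

Definition cyclic_face D x y :=
  cycle4 D (x, y) (x + 1, y) (x + 1, y + 1) (x, y + 1) \/
  cycle4 D (x, y) (x, y + 1) (x + 1, y + 1) (x + 1, y).

Definition quad (P : cell -> Prop) x y :=
  [/\ P (x, y), P (x + 1, y), P (x, y + 1) & P (x + 1, y + 1)].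

Definition has_side (P : cell -> Prop) x y :=
  [\/ P (x, y) /\ P (x + 1, y), P (x, y + 1) /\ P (x + 1, y + 1),
      P (x, y) /\ P (x, y + 1) | P (x + 1, y) /\ P (x + 1, y + 1)].

(** The sense of rotation of a face depends on the parity of [x + y] alone, and two faces with a
    common edge turn in opposite senses, so the prescriptions for that edge agree. *)
Lemma checkered_face H V x y :
  (forall t, y <= t <= y + 1 -> H x t = Z.even (x + t)) ->
  (forall s, x <= s <= x + 1 -> V s y = Z.odd (s + y)) ->
  cyclic_face (arc H V) x y.
Proof.
move=> hH hV.
have [H0 H1] := (hH y ltac:(lia), hH (y + 1) ltac:(lia)).
have [V0 V1] := (hV x ltac:(lia), hV (x + 1) ltac:(lia)).
have E1 : Z.even (x + (y + 1)) = ~~ Z.even (x + y).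
  by rewrite Z.add_assoc Z.add_1_r Z.even_succ Z.negb_even.
have E2 : Z.odd (x + y) = ~~ Z.even (x + y) by rewrite Z.negb_even.
have E3 : Z.odd (x + 1 + y) = Z.even (x + y).
  by rewrite -Z.add_assoc (Z.add_comm 1) Z.add_assoc Z.add_1_r Z.odd_succ.
rewrite {}E1 in H1; rewrite {}E2 in V0; rewrite {}E3 in V1.
case: (Z.even (x + y)) in H0 H1 V0 V1 *; [left | right]; split.
- by apply: Or41; split=> //=; rewrite H0.
- by apply: Or43; split=> //=; rewrite V1.
- by apply: Or42; split=> //=; rewrite H1.
- by apply: Or44; split=> //=; rewrite V0.
- by apply: Or43; split=> //=; rewrite V0.
- by apply: Or41; split=> //=; rewrite H1.
- by apply: Or44; split=> //=; rewrite V1.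
- by apply: Or42; split=> //=; rewrite H0.
Qed.

Section FaceClosure.
Variables (H V : Z -> Z -> bool) (A : cell -> Prop).
Local Notation D := (arc H V).

Lemma cycle4_closed T a b c d : geoconvex D A T -> A a -> A b -> A c -> A d ->
  cycle4 D a b c d ->
  [\/ T a /\ T b, T b /\ T c, T c /\ T d | T d /\ T a] -> [/\ T a, T b, T c & T d].
Proof.
move=> gT Aa Ab Ac Ad [ab bc cd da] [] [T1 T2].
- by have [] := face_closed gT Ac Ad T1 T2 ab bc cd da.
- by have [] := face_closed gT Ad Aa T1 T2 bc cd da ab.
- by have [] := face_closed gT Aa Ab T1 T2 cd da ab bc.
- by have [] := face_closed gT Ab Ac T1 T2 da ab bc cd.
Qed.

Lemma geoconvex_face T x y : geoconvex D A T -> quad A x y -> cyclic_face D x y ->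
  has_side T x y -> quad T x y.
Proof.
move=> gT [Aa Ab Ac Ad] [] cyc side.
  have [|? ? ? ?] := cycle4_closed gT Aa Ab Ad Ac cyc; last by split.
  by case: side => -[? ?]; [apply: Or41|apply: Or43|apply: Or44|apply: Or42].
have [|? ? ? ?] := cycle4_closed gT Aa Ac Ad Ab cyc; last by split.
by case: side => -[? ?]; [apply: Or44|apply: Or42|apply: Or41|apply: Or43].
Qed.

(** Mutual reachability spreads over a directed face just as membership in a convex set does, so
    [staircase_spread] serves both strong connectivity and hulls. *)
Definition linked h u := reach D A u h /\ reach D A h u.

Lemma linked_cycle4 h a b c d : A a -> A b -> A c -> A d -> cycle4 D a b c d ->
  linked h a -> [/\ linked h a, linked h b, linked h c & linked h d].
Proof.
move=> Aa Ab Ac Ad [ab bc cd da] [ah ha].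
have [rb rc] := (reach1 Aa Ab ab, reach1 Ab Ac bc).
have [rd ra] := (reach1 Ac Ad cd, reach1 Ad Aa da).
have dh := reach_trans ra ah; have ch := reach_trans rd dh.
have bh := reach_trans rc ch; have hb := reach_trans ha rb.
have hc := reach_trans hb rc; have hd := reach_trans hc rd.
by split.
Qed.

Lemma linked_face h x y : quad A x y -> cyclic_face D x y ->
  [\/ linked h (x, y), linked h (x + 1, y), linked h (x, y + 1) | linked h (x + 1, y + 1)] ->
  quad (linked h) x y.
Proof.
have rot a b c d : cycle4 D a b c d -> cycle4 D b c d a by case=> *; split.
move=> [Aa Ab Ac Ad] [] cyc [] l.
- by have [] := linked_cycle4 Aa Ab Ad Ac cyc l.
- by have [] := linked_cycle4 Ab Ad Ac Aa (rot _ _ _ _ cyc) l.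
- by have [] := linked_cycle4 Ac Aa Ab Ad (rot _ _ _ _ (rot _ _ _ _ (rot _ _ _ _ cyc))) l.
- by have [] := linked_cycle4 Ad Ac Aa Ab (rot _ _ _ _ (rot _ _ _ _ cyc)) l.
- by have [] := linked_cycle4 Aa Ac Ad Ab cyc l.
- by have [] := linked_cycle4 Ab Aa Ac Ad (rot _ _ _ _ (rot _ _ _ _ (rot _ _ _ _ cyc))) l.
- by have [] := linked_cycle4 Ac Ad Ab Aa (rot _ _ _ _ cyc) l.
- by have [] := linked_cycle4 Ad Ab Aa Ac (rot _ _ _ _ (rot _ _ _ _ cyc)) l.
Qed.
End FaceClosure.

(** * Spreading through the complement of a staircase *)

Section Staircase.
Variables (n m : Z) (w : Z -> Z).
Hypotheses (m2 : 2 <= m) (w01 : w 0 = w 1).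
Hypothesis w_range : forall y, 0 <= y < m -> 0 <= w y <= n - 2.

(** Since each row leaves at least two columns free, the initial face leads right to the last column
    of faces, that column leads to all rows, and each row is then filled leftwards. The equality
    [w 0 = w 1] makes every free vertex of row 0 a corner of a free face. *)
Lemma staircase_spread (P : cell -> Prop) :
  (forall x y, 0 <= y <= m - 2 -> w (y + 1) <= x <= n - 2 -> has_side P x y -> quad P x y) ->
  (exists x y, [/\ 0 <= y <= m - 2, w (y + 1) <= x <= n - 2 & has_side P x y]) ->
  forall x y, 0 <= y < m -> w y <= x < n -> P (x, y).
Proof.
move=> face [x0 [y0 [hy0 hx0 /(face _ _ hy0 hx0) q0]]].
have right : forall x, x0 <= x <= n - 2 -> quad P x y0.
  apply: (@Z_up (quad P ^~ y0)) q0 _ => x hx /= [_ ? _ ?].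
  by apply: face; [lia | lia | apply: Or43].
have up : forall y, 0 <= y <= y0 -> quad P (n - 2) y.
  apply: (@Z_down (quad P (n - 2))) => [|y hy [? ? _ _]]; first by apply: right; lia.
  have wr := w_range (y := y - 1 + 1); apply: face; [lia | lia |].
  by apply: Or42; rewrite Z.sub_add.
have edge : forall y, 0 <= y <= m - 2 -> quad P (n - 2) y.
  apply: (@Z_up (quad P (n - 2))) => [|y hy [_ _ ? ?]]; first by apply: up; lia.
  by have wr := w_range (y := y + 1 + 1); apply: face; [lia | lia | apply: Or41].
have all_faces y : 0 <= y <= m - 2 -> forall x, w (y + 1) <= x <= n - 2 -> quad P x y.
  move=> hy; apply: (@Z_down (quad P ^~ y)) => [|x hx /= [? _ ? _]]; first exact: edge.
  by apply: face; [lia | lia | apply: Or44; rewrite Z.sub_add].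
move=> x y hy hx; have wr := w_range (y := y).
pose y' := Z.max 0 (y - 1); pose x' := Z.min x (n - 2).
have E : w (y' + 1) <= x'.
  case: (Z.eq_dec y 0) => y0'; first by rewrite /y' /x' y0' -w01; subst y; lia.
  have -> : y' + 1 = y by lia.
  by lia.
have [P1 P2 P3 P4] := all_faces y' ltac:(lia) x' ltac:(lia).
have [->|->] : y = y' \/ y = y' + 1 by lia.
  by have [->|->] : x = x' \/ x = x' + 1 by lia.
by have [->|->] : x = x' \/ x = x' + 1 by lia.
Qed.

Lemma staircase_edge (P : cell -> Prop) u v : dist u v = 1 ->
  box 0 n m u -> box 0 n m v -> w u.2 <= u.1 -> w v.2 <= v.1 -> P u -> P v ->
  exists x y, [/\ 0 <= y <= m - 2, w (y + 1) <= x <= n - 2 & has_side P x y].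
Proof.
have horizontal x y : 0 <= x < n - 1 -> 0 <= y < m -> w y <= x ->
    P (x, y) -> P (x + 1, y) ->
    exists x y, [/\ 0 <= y <= m - 2, w (y + 1) <= x <= n - 2 & has_side P x y].
  move=> hx hy wx P1 P2; case: (Z.eq_dec y 0) => [y0|y0].
    by exists x, 0; split; [lia | rewrite -w01 -y0; lia | rewrite -y0; apply: Or41].
  exists x, (y - 1); split; [lia | rewrite Z.sub_add; lia |].
  by apply: Or42; rewrite Z.sub_add.
have vertical x y : 0 <= x < n -> 0 <= y < m - 1 -> w (y + 1) <= x ->
    P (x, y) -> P (x, y + 1) ->
    exists x y, [/\ 0 <= y <= m - 2, w (y + 1) <= x <= n - 2 & has_side P x y].
  move=> hx hy wx P1 P2; case: (Z.eq_dec x (n - 1)) => xn; last first.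
    by exists x, y; split; [lia | lia | apply: Or43].
  have wr := w_range (y := y + 1).
  exists (n - 2), y; split; [lia | lia | apply: Or44].
  by have -> : n - 2 + 1 = x by lia.
case: u v => x y [x' y']; rewrite /dist /= => d1 [/= hx hy] [/= hx' hy'] wu wv Pu Pv.
have [[E E']|[[E E']|[[E E']|[E E']]]] :
  (x' = x + 1 /\ y' = y) \/ (x = x' + 1 /\ y' = y) \/
  (x' = x /\ y' = y + 1) \/ (x' = x /\ y = y' + 1) by lia.
- by subst x' y'; apply: (horizontal x y); lia || done.
- by subst x y'; apply: (horizontal x' y); lia || done.
- by subst x' y'; apply: (vertical x y); lia || done.
- by subst x' y; apply: (vertical x y'); lia || done.
Qed.
End Staircase.

(** * Staircases surrounded by directed faces *)

Section Inner.
Variables (n m r W : Z) (w : Z -> Z).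
Hypotheses (r2 : 2 <= r <= m - 2) (W2 : 2 <= W <= n - 2).
Hypothesis w_top : forall y, 0 <= y < r -> w y = 0.
Hypothesis w_range : forall y, r <= y < m -> 2 <= w y <= W.
Hypothesis w_mono : forall y y', 0 <= y <= y' -> y' < m -> w y <= w y'.
Hypothesis w_bottom : forall y, m - 2 <= y < m -> w y = W.

(* As for a corner inside [S], whose first [r] rows are empty, and directed faces
   outside; [S] is entered from (0, r - 1) only. *)
Definition innerH x y :=
  if x + 1 <? w y then y =? m - 1 else (x + 1 =? w y) || Z.even (x + y).
Definition innerV x y :=
  if x <? w y then (x =? 0) || (y + 1 =? m - 1) && (x + 1 <? W)
  else if x <? w (y + 1) then (x =? 0) && (y + 1 =? r) else Z.odd (x + y).
Local Notation D := (arc innerH innerV).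
Local Notation ibox := (box 0 n m).
Local Notation S := (fun c : cell => ibox c /\ c.1 <? w c.2).

Let w_all y : 0 <= y < m -> 0 <= w y <= n - 2.
Proof.
move=> hy; have wt := w_top (y := y); have wr := w_range (y := y).
by case: (Z_lt_dec y r) => ?; lia.
Qed.

Let w01 : w 0 = w 1. Proof. by rewrite !w_top; lia. Qed.

Lemma inner_in c : S c -> ibox c /\ c.1 < w c.2.
Proof. by case=> Bc /Z.ltb_lt. Qed.

Lemma inner_notin c : ibox c -> ~ S c -> w c.2 <= c.1.
Proof. by move=> Bc nS; case: (Z.ltb_spec c.1 (w c.2)) => // lt; case: nS; split=> //; lia. Qed.

Lemma inner_face x y : 0 <= y <= m - 2 -> w (y + 1) <= x <= n - 2 -> cyclic_face D x y.
Proof.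
move=> hy hx; have wm := w_mono (y := y) (y' := y + 1).
apply: checkered_face => t ht.
  have le : w t <= x.
    have [Et|Et] : t = y \/ t = y + 1 by lia.
      by rewrite Et; lia.
    by rewrite Et; lia.
  rewrite /innerH; case: Z.ltb_spec => [?|_]; first lia.
  by case: Z.eqb_spec => [?|_] //; lia.
by rewrite /innerV; case: Z.ltb_spec => [?|_]; [lia | case: Z.ltb_spec => [?|_] //; lia].
Qed.

Lemma inner_quad x y : 0 <= y <= m - 2 -> w (y + 1) <= x <= n - 2 -> quad ibox x y.
Proof. by move=> hy hx; have wa := w_all (y := y + 1); split; rewrite /box /=; lia. Qed.

Lemma inner_down y y' : r - 1 <= y <= y' -> y' < m ->
  walk D ibox (Z.to_nat (y' - y)) (0, y) (0, y').
Proof.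
move=> hy hy'; apply: walkD => [|t ht|t ht]; [lia | rewrite /box /=; lia |].
have wr := w_range (y := t); have wr' := w_range (y := t + 1); rewrite /innerV.
case: Z.ltb_spec => // wt; case: Z.ltb_spec => // ?; last lia.
by apply/andP; split=> //; apply/Z.eqb_eq; lia.
Qed.

Lemma inner_bottom x x' : 0 <= x <= x' -> x' <= W ->
  walk D ibox (Z.to_nat (x' - x)) (x, m - 1) (x', m - 1).
Proof.
move=> hx hx'; have wb := w_bottom (y := m - 1).
apply: walkR => [|t ht|t ht]; rewrite /box /innerH /=; try lia.
by case: Z.ltb_spec => ?; [lia | apply/orP; left; lia].
Qed.

Lemma inner_end :
  walk D ibox (Z.to_nat (m - 1 - (m - 2))) (W - 1, m - 1) (W - 1, m - 2).
Proof.
have wb := w_bottom (y := m - 2); apply: walkU => [|t ht|t ht]; rewrite /box /=; try lia.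
have -> : t = m - 2 by lia.
by rewrite /innerV; case: Z.ltb_spec => ?; lia.
Qed.

Lemma inner_left x x' y : 0 <= x' <= x -> r <= y <= m - 2 -> x < w y ->
  walk D S (Z.to_nat (x - x')) (x, y) (x', y).
Proof.
move=> hx hy wx; have wr := w_range (y := y); apply: walkL => [|t ht|t ht]; first lia.
  by split; [rewrite /box /= | apply/Z.ltb_lt => /=]; lia.
by rewrite /innerH; case: Z.ltb_spec => ?; lia.
Qed.

Lemma inner_up x y y' : 1 <= x -> r <= y' <= y -> y <= m - 2 -> x < w y' ->
  walk D S (Z.to_nat (y - y')) (x, y) (x, y').
Proof.
move=> hx hy hy' wx; apply: walkU => [|t ht|t ht]; first lia.
  have wm := w_mono (y := y') (y' := t); have wr := w_range (y := t).
  by split; [rewrite /box /= | apply/Z.ltb_lt => /=]; lia.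
have wm := w_mono (y := y') (y' := t).
by rewrite /innerV; case: Z.ltb_spec => ?; lia.
Qed.

Lemma inner_back x y : 1 <= x -> r <= y <= m - 2 -> x < w y ->
  walk D S (Z.to_nat (x + y - r)) (x, y) (0, r).
Proof.
move=> hx hy wx; have wr := w_range (y := r); have wm := w_mono (y := r) (y' := y).
pose x1 := Z.min x (w r - 1).
have -> : Z.to_nat (x + y - r) =
    (Z.to_nat (x - x1) + (Z.to_nat (y - r) + Z.to_nat (x1 - 0)))%N by lia.
apply: (@walk_cat _ _ _ _ _ _ (x1, y)); first by apply: inner_left; lia.
apply: (@walk_cat _ _ _ _ _ _ (x1, r)); first by apply: inner_up; lia.
by apply: inner_left; lia.
Qed.

Let SB c : S c -> ibox c. Proof. by case. Qed.

Lemma inner_across x y : 1 <= x -> r <= y <= m - 2 -> x < w y ->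
  walk D ibox (Z.to_nat (1 + (W - 1 - x) + (m - 2 - y))) (W - 1, m - 1) (x, y).
Proof.
move=> hx hy wx; have wr := w_range (y := y); have wb := w_bottom (y := m - 2).
have -> : Z.to_nat (1 + (W - 1 - x) + (m - 2 - y)) = (Z.to_nat (m - 1 - (m - 2)) +
   (Z.to_nat (W - 1 - x) + Z.to_nat (m - 2 - y)))%N by lia.
apply: walk_cat inner_end _; apply: (walk_sub SB).
apply: (@walk_cat _ _ _ _ _ _ (x, m - 2)); first by apply: inner_left; lia.
by apply: inner_up; lia.
Qed.

Lemma inner_entry u v : ibox u -> ibox v -> D u v -> ~ S u -> S v ->
  u = (0, r - 1) /\ v = (0, r).
Proof.
move: u v => [x y] [x' y'] Bu Bv a /(inner_notin Bu)/= nS [_ /Z.ltb_lt /= S'].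
case: Bu Bv => /= hx hy [/= hx' hy'].
arc_case a h x' y'; move: h; rewrite /innerH /innerV.
- lia.
- case: Z.ltb_spec => ?; first lia.
  by case: Z.eqb_spec => ?; [| lia].
- case: Z.ltb_spec => ?; first lia.
  case: Z.ltb_spec => ?; last lia.
  by case/andP=> /Z.eqb_eq -> /Z.eqb_eq E; split; congr pair; lia.
by have := w_mono (y := y - 1) (y' := y); lia.
Qed.

(** Apart from the arc that prolongs the last row, [S] is left only from vertices off the first
    column and above the last row, where [inner_back] gives a monotone way back to (0, r). *)
Lemma inner_exit u v : ibox u -> ibox v -> D u v -> S u -> ~ S v ->
  (u = (W - 1, m - 1) /\ v = (W, m - 1)) \/
  [/\ 1 <= u.1, r <= u.2 <= m - 2 & v.1 + v.2 >= u.1 + u.2 - 1].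
Proof.
move: u v => [x y] [x' y'] Bu Bv a [_ /Z.ltb_lt /= Su] /(inner_notin Bv)/= nS.
case: Bu Bv => /= hx hy [/= hx' hy'].
have wt := w_top (y := y); have ry : r <= y by lia.
have wr := w_range (y := y); have wb := w_bottom (y := y).
arc_case a h x' y'; move: h; rewrite /innerH /innerV.
- case: (Z.eq_dec y (m - 1)) => [Ey|ym] _; last by right; split; lia.
  by left; split; congr pair; lia.
- lia.
- by have := w_mono (y := y) (y' := y + 1); lia.
have wr' := w_range (y := y - 1); have wb' := w_bottom (y := y - 1).
rewrite Z.sub_add; case: Z.ltb_spec => ?; first lia.
case: Z.ltb_spec => ?; last lia.
by move=> h; right; split; lia.
Qed.

Lemma inner_spread (P : cell -> Prop) :
  (forall x y, 0 <= y <= m - 2 -> w (y + 1) <= x <= n - 2 -> has_side P x y -> quad P x y) ->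
  (exists x y, [/\ 0 <= y <= m - 2, w (y + 1) <= x <= n - 2 & has_side P x y]) ->
  forall c, ibox c -> ~ S c -> P c.
Proof.
move=> face side [x y] Bc /(inner_notin Bc)/= wc; case: (Bc) => /= hx hy.
by apply: (staircase_spread _ w01 w_all face side); lia.
Qed.

(** The complement is strong thanks to its faces. It is joined to [S] by a circuit that enters at
    (0, r), follows the left border and the last row, and leaves at (W, m - 1). *)
Lemma inner_connected : connected D ibox.
Proof.
have wb := w_bottom (y := m - 1); have wb' := w_bottom (y := m - 2).
have nSc y : 0 <= y < r -> ~ S (0, y).
  by move=> hy [_ /Z.ltb_lt /=]; rewrite w_top; lia.
have link c : ibox c -> ~ S c -> linked innerH innerV ibox (n - 1, 0) c.
  have wr1 := w_top (y := 0 + 1).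
  have q : quad (linked innerH innerV ibox (n - 1, 0)) (n - 2) 0.
    apply: linked_face; first by apply: inner_quad; lia.
      by apply: inner_face; lia.
    apply: Or42; have -> : n - 2 + 1 = n - 1 by lia.
    by split; apply: reach_refl; rewrite /box /=; lia.
  move: c; apply: inner_spread.
    move=> x y hy hx side; apply: linked_face; [exact: inner_quad|exact: inner_face|].
    by case: side => -[? ?]; [apply: Or41|apply: Or43|apply: Or41|apply: Or42].
  by exists (n - 2), 0; case: q => *; split; [lia | lia | apply: Or41].
have down y : r - 1 <= y < m -> reach D ibox (0, r - 1) (0, y).
  by move=> hy; eexists; apply: inner_down; lia.
have to_end : reach D ibox (0, r - 1) (W - 1, m - 1).
  apply: reach_trans (down (m - 1) _) _; first lia.
  by eexists; apply: inner_bottom; lia.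
have cyc c : ibox c -> ~ S c -> linked innerH innerV ibox (0, r - 1) c.
  move=> Bc nc; have [c1 c2] := link c Bc nc.
  have hr1 : 0 <= r - 1 < r by lia.
  have Bh : ibox (0, r - 1) by rewrite /box /=; lia.
  have [e1 e2] := link _ Bh (nSc _ hr1).
  by split; [apply: reach_trans c1 e2 | apply: reach_trans e1 c2].
have last_out : reach D ibox (W - 1, m - 1) (0, r - 1).
  have BW : ibox (W, m - 1) by rewrite /box /=; lia.
  have nSW : ~ S (W, m - 1) by move=> [_ /Z.ltb_lt /=]; lia.
  apply: reach_trans (cyc _ BW nSW).1.
  by eexists; apply: (inner_bottom (x := W - 1) (x' := W)); lia.
have back y : r <= y < m -> reach D ibox (0, y) (0, r - 1).
  move=> hy; apply: reach_trans (ex_intro _ _ (inner_down (y' := m - 1) _ _)) _; try lia.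
  by apply: reach_trans (ex_intro _ _ (inner_bottom (x' := W - 1) _ _)) last_out; lia.
apply: (connected_hub (c := (0, r - 1))) => -[x y] Bc.
  case: (classic (S (x, y))) => [Sc|nSc']; last exact: (cyc _ Bc nSc').1.
  have [[/= hx hy] /= lt] := inner_in Sc; have wt := w_top (y := y).
  case: (Z.eq_dec x 0) => [->|x0]; first by apply: back; lia.
  case: (Z.eq_dec y (m - 1)) => [Ey|ym].
    rewrite Ey wb in lt; last lia.
    rewrite Ey; apply: reach_trans last_out.
    by eexists; apply: inner_bottom; lia.
  apply: reach_trans (back r _); last lia.
  by eexists; apply: (walk_sub SB); apply: inner_back; lia.
case: (classic (S (x, y))) => [Sc|nSc']; last exact: (cyc _ Bc nSc').2.
have [[/= hx hy] /= lt] := inner_in Sc; have wt := w_top (y := y).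
case: (Z.eq_dec x 0) => [->|x0]; first by apply: down; lia.
case: (Z.eq_dec y (m - 1)) => [Ey|ym].
  rewrite Ey wb in lt; last lia.
  rewrite Ey; apply: reach_trans (down (m - 1) _) _; first lia.
  by eexists; apply: inner_bottom; lia.
by apply: reach_trans to_end _; eexists; apply: inner_across; lia.
Qed.

Lemma inner_convex : geoconvex D ibox S.
Proof.
have wb := w_bottom (y := m - 1); have wb' := w_bottom (y := m - 2).
apply: (@convex_single_entry _ _ _ _ (0, r)
  (fun c => Z.to_nat (c.1 + Z.abs (c.2 - (r - 1)) + 1))).
- exact: SB.
- move=> u v Bu Bv a nS Sv; have [-> ->] := inner_entry Bu Bv a nS Sv.
  by split=> //=; lia.
- move=> [x y] [x' y'] [/= hx hy] [/= hx' hy'] /arc_dist; rewrite /dist /=; lia.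
move=> u v Bu Bv a Su nSv; have := inner_exit Bu Bv a Su nSv.
case: u v {Bu} Bv a Su {nSv} => x y [x' y'] [/= hx' hy'] a Su [[Eu Ev]|/= [x1 hy sum]].
  case: Eu Ev => -> -> [-> ->].
  exists (1 + Z.to_nat (W - 1 + (m - 2) - r))%N; last lia.
  apply: (walk_cat (x := (W - 1, m - 2))); last by apply: inner_back; lia.
  have wr : r <= m - 2 by lia.
  apply: walk1.
  - by split; [rewrite /box /= | apply/Z.ltb_lt => /=]; lia.
  - by split; [rewrite /box /= | apply/Z.ltb_lt => /=]; lia.
  by apply: Or44; rewrite /innerV /=; split; try lia; case: Z.ltb_spec => ?; lia.
have [_ /= lt] := inner_in Su.
exists (Z.to_nat (x + y - r)); first by apply: inner_back; lia.
by move: (arc_dist a); rewrite /dist /=; lia.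
Qed.

(** An edge of [T] in the complement spreads over all faces. The two neighbours of [z] along arcs of
    [T] provide one: otherwise [z] would be (0, r - 1), the tail of the entry arc, and also the head
    of an exit, which it is not. Once the complement is in [T], geodesics from (0, r - 1) to (W, m -
    1) give the left border and the last row, and geodesics from (W - 1, m - 1) to (0, r) the
    inside. *)
Lemma inner_hull T z : geoconvex D ibox T -> (exists2 u, T u & exists2 v, T v & u <> v) ->
  T z -> ~ S z -> forall c, ibox c -> T c.
Proof.
move=> gT [u0 Tu0 [v0 Tv0 nuv]] Tz nSz; have cD := inner_connected.
have wb := w_bottom (y := m - 1); have wb' := w_bottom (y := m - 2).
have [v Tv nvz] : exists2 v, T v & v <> z.
  by case: (classic (u0 = z)) => [E|]; [exists v0 => // E'; apply: nuv; rewrite E E' | exists u0].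
have [a Ta Dza] := geoconvex_out gT cD Tz Tv (not_eq_sym nvz).
have [b Tb Dbz] := geoconvex_in gT cD Tv Tz nvz.
have edge u x : T u -> T x -> D u x -> ~ S u -> ~ S x -> exists x y,
    [/\ 0 <= y <= m - 2, w (y + 1) <= x <= n - 2 & has_side T x y].
  move=> Tu Tx /arc_dist d1 nSu nSx; have [Bu Bx] := (gT.1 _ Tu, gT.1 _ Tx).
  by apply: (staircase_edge _ w01 w_all d1 Bu Bx (inner_notin Bu nSu) (inner_notin Bx nSx) Tu Tx);
     lia.
have side : exists x y, [/\ 0 <= y <= m - 2, w (y + 1) <= x <= n - 2 & has_side T x y].
  case: (classic (S a)) => Sa; last exact: (edge z a).
  case: (classic (S b)) => Sb; last exact: (edge b z).
  have [Ez _] := inner_entry (gT.1 _ Tz) (gT.1 _ Ta) Dza nSz Sa.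
  have := inner_exit (gT.1 _ Tb) (gT.1 _ Tz) Dbz Sb nSz; rewrite Ez /=.
  case=> [[_ [] ? ?]|[]]; first lia.
  move: Dbz; rewrite Ez => /arc_dist; rewrite /dist; case: (b) => x y /= d1 x1 hy ?.
  by lia.
have TC : forall c, ibox c -> ~ S c -> T c.
  apply: inner_spread side => x y hy hx sd.
  by apply: geoconvex_face gT _ _ sd; [apply: inner_quad | apply: inner_face].
have T1 : T (0, r - 1).
  by apply: TC => [|[_ /Z.ltb_lt /=]]; [rewrite /box /= | rewrite w_top]; lia.
have T2 : T (W, m - 1).
  by apply: TC => [|[_ /Z.ltb_lt /=]]; [rewrite /box /= | ]; lia.
have T0y y : r <= y < m -> T (0, y).
  move=> hy; apply: (monotone_closed gT T1 T2 (inner_down (y' := y) _ _)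
    (walk_cat (inner_down (y' := m - 1) _ _) (inner_bottom (x' := W) _ _))); try lia.
  by rewrite /dist /=; lia.
have Tbot x : 0 <= x < W -> T (x, m - 1).
  move=> hx; apply: (monotone_closed gT T1 T2
    (walk_cat (inner_down (y' := m - 1) _ _) (inner_bottom (x' := x) _ _))
    (inner_bottom (x' := W) _ _)); try lia.
  by rewrite /dist /=; lia.
move=> [x y] Bc; case: (classic (S (x, y))) => [Sc|]; last exact: TC.
have [[/= hx hy] /= lt] := inner_in Sc; have wt := w_top (y := y).
case: (Z.eq_dec x 0) => [->|x0]; first by apply: T0y; lia.
case: (Z.eq_dec y (m - 1)) => [Ey|ym].
  by rewrite Ey wb in lt; [rewrite Ey; apply: Tbot; lia | lia].
have TE : T (W - 1, m - 1) by apply: Tbot; lia.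
have Tr : T (0, r) by apply: T0y; lia.
have wr := w_range (y := y).
apply: (monotone_closed gT TE Tr (inner_across (x := x) (y := y) _ _ _)
  (walk_sub SB (inner_back _ _ _))); try lia.
by rewrite /dist /=; lia.
Qed.
End Inner.

Lemma inner_spectrum n m r W (w : nat -> nat) k : (2 <= r <= m - 2)%N -> (2 <= W <= n - 2)%N ->
  (forall i, (i < r)%N -> w i = 0%N) ->
  (forall i, (r <= i < m)%N -> (2 <= w i <= W)%N) ->
  (forall i j, (i <= j < m)%N -> (w i <= w j)%N) ->
  (forall i, (m - 2 <= i < m)%N -> w i = W) -> (\sum_(i < m) w i)%N = k ->
  strong_convexity_spectrum (cartesian_product (@path_graph n) (@path_graph m)) k.
Proof.
move=> hr hW wt wr wm wb Ek; pose U y := Z.of_nat (w (Z.to_nat y)).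
have hr' : 2 <= Z.of_nat r <= Z.of_nat m - 2 by lia.
have hW' : 2 <= Z.of_nat W <= Z.of_nat n - 2 by lia.
have U1 y : 0 <= y < Z.of_nat r -> U y = 0.
  by move=> hy; have := wt (Z.to_nat y); rewrite /U; lia.
have U2 y : Z.of_nat r <= y < Z.of_nat m -> 2 <= U y <= Z.of_nat W.
  by move=> hy; have := wr (Z.to_nat y); rewrite /U; lia.
have U3 y y' : 0 <= y <= y' -> y' < Z.of_nat m -> U y <= U y'.
  by move=> hy hy'; have := wm (Z.to_nat y) (Z.to_nat y'); rewrite /U; lia.
have U4 y : Z.of_nat m - 2 <= y < Z.of_nat m -> U y = Z.of_nat W.
  by move=> hy; have := wb (Z.to_nat y); rewrite /U; lia.
have wn i : (i < m)%N -> (w i <= n)%N.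
  by move=> hi; case: (ltnP i r) => ir; [rewrite wt | have := wr i; lia].
apply: (@spectrum_intro n m 0 (innerH (Z.of_nat m) U)
  (innerV (Z.of_nat m) (Z.of_nat r) (Z.of_nat W) U) (fun c => c.1 <? U c.2)).
- exact: etrans (card_young wn) Ek.
- rewrite -Ek; apply: (sum_strictly_between (i := 0) (j := m.-1)) => //; try lia.
    by rewrite wt; lia.
  by have := wr m.-1; lia.
- by rewrite Z.add_0_l; apply: inner_connected.
- by rewrite Z.add_0_l; apply: inner_convex.
move=> T; rewrite Z.add_0_l => gT T2 [z Tz nz]; left.
by apply: (inner_hull hr' hW' U1 U2 U3 U4 gT T2 Tz) => -[_ Sz]; rewrite Sz in nz.
Qed.

(** With all faces directed, a convex set with two vertices contains an edge and so everything. The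
    spreading lemma is applied to the staircase with all rows of width 0. *)
Lemma one_spectrum n m : (2 <= n)%N -> (2 <= m)%N ->
  strong_convexity_spectrum (cartesian_product (@path_graph n) (@path_graph m)) 1.
Proof.
move=> n2 m2; pose H x y := Z.even (x + y); pose V x y := Z.odd (x + y).
pose N := Z.of_nat n; pose M := Z.of_nat m; pose A := box 0 N M.
have N2 : 2 <= N by rewrite /N; lia.
have M2 : 2 <= M by rewrite /M; lia.
have face x y : cyclic_face (arc H V) x y by apply: checkered_face.
have w_range y : 0 <= y < M -> 0 <= 0 <= N - 2 by lia.
have spread P := staircase_spread M2 (w := fun=> 0) erefl w_range (P := P).
have quadA x y : 0 <= y <= M - 2 -> 0 <= x <= N - 2 -> quad A x y.
  by move=> hy hx; split; rewrite /A /box /=; lia.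
have cA : connected (arc H V) A.
  have l0 : linked H V A (0, 0) (0, 0) by split; apply: reach_refl; rewrite /A /box /=; lia.
  have link c : A c -> linked H V A (0, 0) c.
    case: c => x y [/= hx hy]; apply: (spread (linked H V A (0, 0))); try lia.
      move=> x' y' hy' hx' sd; apply: linked_face; [exact: quadA|exact: face|].
      by case: sd => -[? ?]; [apply: Or41|apply: Or43|apply: Or41|apply: Or42].
    exists 0, 0; split; [lia | lia |].
    have [? ? _ _] : quad (linked H V A (0, 0)) 0 0.
      by apply: linked_face; [apply: quadA; lia | exact: face | apply: Or41].
    exact: Or41.
  by move=> u v /link[u1 _] /link[_ v2]; apply: reach_trans u1 v2.
apply: (@spectrum_intro n m 0 H V (fun c => (c.1 =? 0) && (c.2 =? 0))).
- have n0 : (0 < n)%N by lia.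
  have m0 : (0 < m)%N by lia.
  apply/eqP/cards1P; exists (Ordinal n0, Ordinal m0); apply/setP=> -[x y].
  by rewrite !inE xpair_eqE -!val_eqE /=; apply/idP/idP; lia.
- by rewrite /=; nia.
- by rewrite Z.add_0_l.
- rewrite Z.add_0_l; split=> [c []//|u v c i j [Au hu] [Av hv] wi wj minl].
  have E : u = v by case: u v hu hv {Au Av wi wj minl} => ? ? [? ?] /= ? ?; congr pair; lia.
  have := minl 0%N; rewrite -E => /(_ (walk_nil _ Au)) le.
  have i0 : i = 0%N by lia.
  by rewrite i0 in wi; rewrite -(walk0E wi).
move=> T; rewrite Z.add_0_l => gT [u Tu [v Tv nuv]] _; left.
have [a Ta Dua] := geoconvex_out gT cA Tu Tv nuv.
have side : exists x y, [/\ 0 <= y <= M - 2, 0 <= x <= N - 2 & has_side T x y].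
  have [Bu Ba] := (gT.1 _ Tu, gT.1 _ Ta).
  have [[u0 _] _] := Bu; have [[a0 _] _] := Ba.
  exact: (staircase_edge (w := fun=> 0) M2 erefl w_range (arc_dist Dua) Bu Ba u0 a0 Tu Ta).
move=> [x y] [/= hx hy]; apply: (spread T) side _ _ _ _; try lia.
by move=> x' y' hy' hx' sd; apply: geoconvex_face gT (quadA _ _ _ _) (face _ _) sd.
Qed.

Local Close Scope Z_scope.

(** * Enlarging a grid *)

(** Invariant of the enlargements: the conditions of [spectrum_intro] in the strong form, in which a
    convex set that sticks out of [S] is everything. *)
Definition good X (D : X -> X -> Prop) (A S : X -> Prop) :=
  [/\ connected D A, geoconvex D A (fun u => A u /\ S u) &
      forall T, geoconvex D A T -> (exists2 u, T u & exists2 v, T v & u <> v) ->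
        (exists2 u, T u & ~ S u) -> forall u, A u -> T u].

Lemma walk_map X Y (D : X -> X -> Prop) (D' : Y -> Y -> Prop) A A' (f : X -> Y) l u v :
  (forall x, A x -> A' (f x)) -> (forall x y, A x -> A y -> D x y -> D' (f x) (f y)) ->
  walk D A l u v -> walk D' A' l (f u) (f v).
Proof.
move=> fA fD; elim=> [x /fA|l' x y z Ax Dxy w IH]; first exact: walk_nil.
by apply: walk_cons (fA _ Ax) (fD _ _ Ax (walk_first w) Dxy) IH.
Qed.

Section Transport.
Variables (X Y : Type) (D : X -> X -> Prop) (D' : Y -> Y -> Prop).
Variables (A : X -> Prop) (A' : Y -> Prop) (f : X -> Y).
Hypotheses (fA : forall u, A u -> A' (f u)) (f_onto : forall y, A' y -> exists2 u, A u & f u = y).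
Hypothesis f_inj : forall u v, A u -> A v -> f u = f v -> u = v.
Hypothesis fD : forall u v, A u -> A v -> (D u v <-> D' (f u) (f v)).

Lemma walk_pull l u v : A u -> A v -> walk D' A' l (f u) (f v) -> walk D A l u v.
Proof.
elim: l u => [|l IH] u Au Av w.
  by rewrite (f_inj Au Av (walk0E w)); apply: walk_nil.
have [y [_ Duy wy]] := walkSE w; have [x Ax Ex] := f_onto (walk_first wy).
rewrite -{y}Ex in Duy wy; exact: walk_cons Au ((fD Au Ax).2 Duy) (IH x Ax Av wy).
Qed.

Lemma walk_push l u v : walk D A l u v -> walk D' A' l (f u) (f v).
Proof. by apply: walk_map => // x y Ax Ay /(fD Ax Ay). Qed.

Lemma geoconvex_pull T : geoconvex D' A' T -> geoconvex D A (fun u => A u /\ T (f u)).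
Proof.
move=> [_ cT]; split=> [u []//|u v x i j [Au Tu] [Av Tv] wi wj minl].
split; first exact: walk_first wj.
apply: (cT (f u) (f v) (f x) i j) => //; [exact: walk_push|exact: walk_push|].
by move=> l /(walk_pull Au Av)/minl.
Qed.

Lemma connected_push : connected D A -> connected D' A'.
Proof.
move=> cD y z /f_onto[u Au <-] /f_onto[v Av <-]; have [l w] := cD _ _ Au Av.
by exists l; apply: walk_push.
Qed.

Lemma geoconvex_push S : geoconvex D A (fun u => A u /\ S (f u)) ->
  geoconvex D' A' (fun y => A' y /\ S y).
Proof.
move=> gS; split=> [y []//|_ _ x i j [/f_onto[u Au <-] Su] [/f_onto[v Av <-] Sv] wi wj minl].
have [t At Et] := f_onto (walk_last wi); rewrite -{x}Et in wi wj *.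
split; first exact: fA.
have [] // := gS.2 u v t i j (conj Au Su) (conj Av Sv) (walk_pull _ _ wi) (walk_pull _ _ wj).
by move=> l /walk_push/minl.
Qed.

Lemma good_transport S : good D A (fun u => S (f u)) -> good D' A' S.
Proof.
move=> [cD gS hull]; split; [exact: connected_push | exact: geoconvex_push |].
move=> T gT [y Ty [z Tz nyz]] [t Tt nSt] x /f_onto[w Aw <-].
have [u Au Eu] := f_onto (gT.1 _ Ty); have [v Av Ev] := f_onto (gT.1 _ Tz).
have [s As Es] := f_onto (gT.1 _ Tt).
suff [] : A w /\ T (f w) by [].
apply: (hull _ (geoconvex_pull gT)) => //.
  exists u; first by rewrite Eu.
  by exists v; [rewrite Ev | move=> E; apply: nyz; rewrite -Eu -Ev E].
by exists s; rewrite Es.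
Qed.
End Transport.

(** * Retractions of digraphs *)

Section Retraction.
Variables (X : Type) (D : X -> X -> Prop) (A A' : X -> Prop) (r : X -> X).
Hypotheses (sAA' : forall u, A u -> A' u) (rA : forall u, A' u -> A (r u)).
Hypotheses (r_id : forall u, A u -> r u = u).
Hypothesis rD : forall u v, A' u -> A' v -> D u v -> D (r u) (r v).

Lemma walk_retract l u v : walk D A' l u v -> walk D A l (r u) (r v).
Proof. exact: walk_map rA rD. Qed.

(** A retraction maps walks to walks of the same length, so no shortcut through the larger set
    exists and geodesics of [A] stay geodesics in [A']. *)
Lemma geoconvex_retract T : geoconvex D A' T -> geoconvex D A (fun u => A u /\ T u).
Proof.
move=> [_ cT]; split=> [u []//|u v x i j [Au Tu] [Av Tv] wi wj minl].
split; first exact: walk_last wi.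
apply: (cT u v x i j) => //; [exact: walk_sub wi|exact: walk_sub wj|].
by move=> l /walk_retract; rewrite !r_id // => /minl.
Qed.

Lemma retract_geodesic u v x i j : A u -> A v -> A x -> walk D A' i u x -> walk D A' j x v ->
  (forall l, walk D A' l u v -> i + j <= l) ->
  [/\ walk D A i u x, walk D A j x v & forall l, walk D A l u v -> i + j <= l].
Proof.
move=> Au Av Ax /walk_retract wi /walk_retract wj minl; rewrite !r_id // in wi wj.
by split=> // l w; apply: minl; apply: walk_sub w.
Qed.
End Retraction.

Lemma walk_enters X (D : X -> X -> Prop) (A B : X -> Prop) l u v :
  walk D A l u v -> ~ B u -> B v -> exists a b i j,
    [/\ walk D A i u a, D a b, walk D A j b v, ~ B a & B b] /\ i + j.+1 = l.
Proof.
elim=> [x _ nB /nB //|l' x y v' Ax Dxy w IH nBx Bv].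
case: (classic (B y)) => By.
  by exists x, y, 0, l'; split; [split=> //; apply: walk_nil | lia].
have [a [b [i [j [[wi Dab wj nBa Bb] E]]]]] := IH By Bv.
exists a, b, i.+1, j; split; last lia.
by split=> //; apply: walk_cons Dxy wi.
Qed.

Local Open Scope Z_scope.

(** * Adding a column by reflection *)

Section Mirror.
Variables (H V : Z -> Z -> bool).
Local Notation D := (arc H V).

(** Invariance, next to column [x], under the reflection in that column; [H] is negated because the
    reflection exchanges left and right. *)
Definition mirror x := (forall y, H x y = ~~ H (x - 1) y) /\ (forall y, V (x + 1) y = V (x - 1) y).

Lemma mirror_arc x u v : mirror x -> u.1 <= x + 1 -> v.1 <= x + 1 -> D u v ->
  let r c := if c.1 =? x + 1 then (x - 1, c.2) else c in D (r u) (r v).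
Proof.
move=> [mH mV]; case: u v => a b [a' b'] /= ha ha' Duv.
case: Z.eqb_spec => Ea; case: Z.eqb_spec => Ea' //.
- subst a a'; move: Duv => /arcE /= h; apply/arcE => /=.
  by rewrite !mV in h; lia.
- have Ex : a' = x by move/arc_dist: Duv; rewrite /dist /=; lia.
  have Eb : b' = b by move/arc_dist: Duv; rewrite /dist /=; lia.
  subst a a' b'; move: Duv => /arcE /= [[]|[[_ [_ h]]|[[]|[]]]]; try lia.
  by apply/arcE => /=; left; rewrite mH in h; move/negbFE: h => ->; lia.
- have Ex : a = x by move/arc_dist: Duv; rewrite /dist /=; lia.
  have Eb : b' = b by move/arc_dist: Duv; rewrite /dist /=; lia.
  subst a a' b'; move: Duv => /arcE /= [[_ [_ h]]|[[]|[[]|[]]]]; try lia.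
  by apply/arcE => /=; right; left; rewrite mH in h; move/negbTE: h => ->; lia.
Qed.

Lemma mirror_arc_left x u v : mirror x -> x - 1 <= u.1 -> x - 1 <= v.1 -> D u v ->
  let r c := if c.1 =? x - 1 then (x + 1, c.2) else c in D (r u) (r v).
Proof.
move=> [mH mV]; case: u v => a b [a' b'] /= ha ha' Duv.
case: Z.eqb_spec => Ea; case: Z.eqb_spec => Ea' //.
- subst a a'; move: Duv => /arcE /= h; apply/arcE => /=.
  by rewrite !mV; lia.
- have Ex : a' = x by move/arc_dist: Duv; rewrite /dist /=; lia.
  have Eb : b' = b by move/arc_dist: Duv; rewrite /dist /=; lia.
  subst a a' b'; move: Duv => /arcE /= [[_ [_ h]]|[[]|[[]|[]]]]; try lia.
  by apply/arcE => /=; right; left; rewrite mH h; lia.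
- have Ex : a = x by move/arc_dist: Duv; rewrite /dist /=; lia.
  have Eb : b' = b by move/arc_dist: Duv; rewrite /dist /=; lia.
  subst a a' b'; move: Duv => /arcE /= [[]|[[_ [_ h]]|[[]|[]]]]; try lia.
  by apply/arcE => /=; left; rewrite mH h; lia.
Qed.

Definition cyclicb x y := [&& V (x + 1) y == H x y, H x (y + 1) != H x y & V x y != H x y].

Lemma cyclic_faceP x y : reflect (cyclic_face D x y) (cyclicb x y).
Proof.
apply: (iffP and3P) => [[/eqP h1 h2 h3]|].
  case h: (H x y) in h1 h2 h3 *; [left | right].
    by split; apply/arcE => /=; rewrite ?h ?h1; case: (H x (y + 1)) (V x y) h2 h3 => -[] //; lia.
  by split; apply/arcE => /=; rewrite ?h ?h1; case: (H x (y + 1)) (V x y) h2 h3 => -[] //; lia.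
case=> -[/arcE/= h1 /arcE/= h2 /arcE/= h3 /arcE/= h4].
  have -> : H x y = true by lia.
  have -> : H x (y + 1) = false by lia.
  have -> : V x y = false by lia.
  by have -> : V (x + 1) y = true by lia.
have -> : H x y = false by lia.
have -> : H x (y + 1) = true by lia.
have -> : V x y = true by lia.
by have -> : V (x + 1) y = false by lia.
Qed.

Lemma mirror_face x y : mirror x -> (cyclic_face D (x - 1) y <-> cyclic_face D x y).
Proof.
move=> [mH mV]; have E : cyclicb (x - 1) y = cyclicb x y.
  rewrite /cyclicb Z.sub_add mV !mH.
  by case: (H (x - 1) y) (H (x - 1) (y + 1)) (V x y) (V (x - 1) y) => -[] [] [].
by split=> /cyclic_faceP h; apply/cyclic_faceP; rewrite ?E // -E.
Qed.

Section Extend.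
Variables (lo hi m : Z) (S : cell -> Prop).
Hypotheses (wide : lo + 2 <= hi) (m2 : 2 <= m).

(** The new column folds onto column [hi - 2]. A geodesic between points of [S] that visits it
    passes through column [hi - 1]; folded into the old box, it would put a vertex of that column
    into [S]. For hulls, an edge touching the new column brings a whole face, hence two old vertices
    outside [S]. *)
Lemma extend_right : mirror (hi - 1) ->
  (forall y, 0 <= y < m - 1 -> cyclic_face D (hi - 1) y) ->
  (forall x y, hi - 1 <= x <= hi -> 0 <= y < m -> ~ S (x, y)) ->
  good D (box lo hi m) S -> good D (box lo (hi + 1) m) S.
Proof.
move=> mir face nS [cD gS hull]; pose A := box lo hi m; pose A' := box lo (hi + 1) m.
pose r c := if c.1 =? hi then (hi - 2, c.2) else c : cell.
have sAA' u : A u -> A' u by rewrite /A /A' /box; lia.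
have rA u : A' u -> A (r u) by rewrite /A /A' /r /box; case: Z.eqb_spec => /=; lia.
have r_id u : A u -> r u = u by rewrite /A /r /box; case: Z.eqb_spec => //; lia.
have rD u v : A' u -> A' v -> D u v -> D (r u) (r v).
  move=> [hu _] [hv _] Duv; have /= := mirror_arc mir _ _ Duv.
  have E1 : hi - 1 + 1 = hi by lia.
  have E2 : hi - 1 - 1 = hi - 2 by lia.
  by rewrite E1 E2; apply; lia.
have q y : 0 <= y < m - 1 -> quad A' (hi - 1) y by move=> hy; split; rewrite /A' /box /=; lia.
have inN c : A' c -> ~ A c -> c.1 = hi by rewrite /A /A' /box; lia.
have onN y : 0 <= y < m -> exists2 y', 0 <= y' < m - 1 & y = y' \/ y = y' + 1.
  by move=> hy; case: (Z.eq_dec y 0) => ?; [exists y | exists (y - 1)]; lia.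
have Ehi : hi - 1 + 1 = hi by lia.
have cD' : connected D A'.
  have A0 : A (lo, 0) by rewrite /A /box /=; lia.
  have linkA c : A c -> linked H V A' (lo, 0) c.
    by move=> Ac; have [[l w] [l' w']] := (cD _ _ Ac A0, cD _ _ A0 Ac);
       split; [exists l | exists l']; apply: walk_sub sAA' _.
  suff link c : A' c -> linked H V A' (lo, 0) c.
    by move=> u v /link[u1 _] /link[_ v2]; apply: reach_trans u1 v2.
  case: (classic (A c)) => [/linkA //|nAc A'c]; have Ec := inN _ A'c nAc.
  case: c Ec A'c {nAc} => x y /= -> [_ /= hy]; have [y' hy' Ey] := onN y hy.
  have [] := linked_face (h := (lo, 0)) (q y' hy') (face y' hy').
    by apply: Or41; apply: linkA; rewrite /A /box /=; lia.
  by rewrite Ehi; case: Ey => ->.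
split=> //.
  split=> [u []//|u v x i j [A'u Su] [A'v Sv] wi wj minl].
  have inA w : A' w -> S w -> A w.
    move=> A'w Sw; case: (classic (A w)) => // /(inN _ A'w) E.
    by case: w E A'w Sw => a b /= -> [_ /= hb] /(nS hi b); lia.
  have key a i' j' : A a -> walk D A' i' u a -> walk D A' j' a v -> (i' + j' = i + j)%N -> S a.
    move=> Aa wi' wj' E.
    have minl' l : walk D A' l u v -> (i' + j' <= l)%N by rewrite E; apply: minl.
    have [w1 w2 min12] :=
      retract_geodesic sAA' rA r_id rD (inA _ A'u Su) (inA _ A'v Sv) Aa wi' wj' minl'.
    by case: (gS.2 u v a i' j' _ _ w1 w2 min12) => //; split=> //; apply: inA.
  have A'x := walk_first wj; split=> //.
  case: (classic (A x)) => [Ax|nAx]; first exact: (key x i j).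
  have [a [b [i1 [i2 [[w1 Dab w2 nBa Bb] E]]]]] :=
    walk_enters (B := fun c => ~ A c) wi (fun h => h (inA _ A'u Su)) nAx.
  have Aa : A a by apply: NNPP.
  have A'b := walk_first w2; have A'a := walk_last w1.
  exfalso; apply: (nS a.1 a.2).
  - have := inN _ A'b Bb; move: (arc_dist Dab) Aa; rewrite /dist /A /box; lia.
  - by case: Aa.
  rewrite -surjective_pairing; apply: (key a i1 (i2.+1 + j)%N) => //; last lia.
  exact: walk_cat (walk_cons A'a Dab w2) wj.
move=> T gT [u0 Tu0 [v0 Tv0 nuv]] [z Tz nSz].
have gTA : geoconvex D A (fun c => A c /\ T c) := geoconvex_retract sAA' rA r_id rD gT.
have sT := gT.1.
suff full : forall c, A c -> T c.
  move=> c A'c; case: (classic (A c)) => [/full //|nAc]; have Ec := inN _ A'c nAc.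
  case: c Ec A'c {nAc} => x y /= -> [_ /= hy]; have [y' hy' Ey] := onN y hy.
  have [] := geoconvex_face gT (q y' hy') (face y' hy').
    by apply: Or43; split; apply: full; rewrite /A /box /=; lia.
  by rewrite Ehi; case: Ey => ->.
have fin : (exists2 u, A u /\ T u & exists2 v, A v /\ T v & u <> v /\ ~ S v) ->
    forall c, A c -> T c.
  move=> [u Pu [v Pv [nuv' nSv]]] c Ac.
  have [] // := hull _ gTA _ _ c Ac; first by exists u => //; exists v.
  by exists v.
have [v Tv nvz] : exists2 v, T v & v <> z.
  by case: (classic (u0 = z)) => [E|]; [exists v0 => // E'; apply: nuv; rewrite E E' | exists u0].
have [a Ta /arc_dist d1] := geoconvex_out gT cD' Tz Tv (not_eq_sym nvz).
have [Bz Ba] := (sT _ Tz, sT _ Ta).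
have side y : 0 <= y < m - 1 -> has_side T (hi - 1) y -> forall c, A c -> T c.
  move=> hy /(geoconvex_face gT (q y hy) (face y hy))[T1 _ T2 _]; apply: fin.
  exists (hi - 1, y); first by split=> //; rewrite /A /box /=; lia.
  exists (hi - 1, y + 1); first by split=> //; rewrite /A /box /=; lia.
  by split; [case; lia | apply: nS; lia].
case: (classic (A z)) => [Az|/(inN _ Bz) Ez].
  case: (classic (A a)) => [Aa|/(inN _ Ba) Ea].
    apply: fin; exists a => //; exists z => //; split=> // E.
    by move: d1; rewrite E /dist; lia.
  have Ez : z.1 = hi - 1 by move: d1 Az; rewrite /dist /A /box; lia.
  have Eaz : a.2 = z.2 by move: d1; rewrite /dist; lia.
  case: Bz => _ /onN[y' hy' Ey]; apply: (side y' hy').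
  move: Tz Ta; rewrite (surjective_pairing z) (surjective_pairing a) Ez Ea Eaz => Tz Ta.
  by rewrite -{1}Ehi in Ta; case: Ey => E; rewrite E in Tz Ta; [apply: Or41 | apply: Or42].
case: (Z.eq_dec a.1 hi) => Ea.
  have /= [y' hy' Ey] : exists2 y', 0 <= y' < m - 1 &
      (z.2 = y' /\ a.2 = y' + 1) \/ (z.2 = y' + 1 /\ a.2 = y').
    exists (Z.min z.2 a.2); move: d1 (Bz.2) (Ba.2); rewrite /dist; lia.
  apply: (side y' hy'); apply: Or44; rewrite Ehi -Ea; move: Tz Ta.
  rewrite (surjective_pairing z) (surjective_pairing a) /= Ez Ea.
  by case: Ey => -[-> ->].
have Ea' : a.1 = hi - 1 by move: d1 (Ba.1); rewrite /dist; lia.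
have Eaz : a.2 = z.2 by move: d1; rewrite /dist; lia.
case: Bz => _ /onN[y' hy' Ey]; apply: (side y' hy').
move: Tz Ta; rewrite (surjective_pairing z) (surjective_pairing a) Ez Ea' Eaz => Tz Ta.
by rewrite -{1}Ehi in Tz; case: Ey => E; rewrite E in Tz Ta; [apply: Or41 | apply: Or42].
Qed.

(** Here the new column is part of [S], like the column it is attached to. A vertex outside [S] on a
    geodesic lies in the old box; cutting the geodesic at a crossing into that box before it and at
    a crossing out of it afterwards gives ends in column [lo], so in [S], and convexity in the old
    box applies. *)
Lemma extend_left : mirror lo ->
  (forall y, 0 <= y < m - 1 -> cyclic_face D (lo - 1) y) ->
  (forall x y, lo - 1 <= x <= lo -> 0 <= y < m -> S (x, y)) ->
  good D (box lo hi m) S -> good D (box (lo - 1) hi m) S.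
Proof.
move=> mir face hS [cD gS hull]; pose A := box lo hi m; pose A' := box (lo - 1) hi m.
pose r c := if c.1 =? lo - 1 then (lo + 1, c.2) else c : cell.
have sAA' u : A u -> A' u by rewrite /A /A' /box; lia.
have rA u : A' u -> A (r u) by rewrite /A /A' /r /box; case: Z.eqb_spec => /=; lia.
have r_id u : A u -> r u = u by rewrite /A /r /box; case: Z.eqb_spec => //; lia.
have rD u v : A' u -> A' v -> D u v -> D (r u) (r v).
  by move=> [hu _] [hv _] Duv; have /= := mirror_arc_left mir _ _ Duv; apply; lia.
have q y : 0 <= y < m - 1 -> quad A' (lo - 1) y by move=> hy; split; rewrite /A' /box /=; lia.
have inN c : A' c -> ~ A c -> c.1 = lo - 1 by rewrite /A /A' /box; lia.
have onN y : 0 <= y < m -> exists2 y', 0 <= y' < m - 1 & y = y' \/ y = y' + 1.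
  by move=> hy; case: (Z.eq_dec y 0) => ?; [exists y | exists (y - 1)]; lia.
have Elo : lo - 1 + 1 = lo by lia.
have cD' : connected D A'.
  have A0 : A (lo, 0) by rewrite /A /box /=; lia.
  have linkA c : A c -> linked H V A' (lo, 0) c.
    by move=> Ac; have [[l w] [l' w']] := (cD _ _ Ac A0, cD _ _ A0 Ac);
       split; [exists l | exists l']; apply: walk_sub sAA' _.
  suff link c : A' c -> linked H V A' (lo, 0) c.
    by move=> u v /link[u1 _] /link[_ v2]; apply: reach_trans u1 v2.
  case: (classic (A c)) => [/linkA //|nAc A'c]; have Ec := inN _ A'c nAc.
  case: c Ec A'c {nAc} => x y /= -> [_ /= hy]; have [y' hy' Ey] := onN y hy.
  have [] := linked_face (h := (lo, 0)) (q y' hy') (face y' hy').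
    by apply: Or42; apply: linkA; rewrite /A /box /=; lia.
  by case: Ey => ->.
have nearN a b : A' a -> A' b -> ~ A a -> A b -> dist a b = 1 -> S b.
  move=> A'a A'b /(inN _ A'a) Ea [hb hb']; rewrite /dist => d1.
  by rewrite (surjective_pairing b); apply: hS; lia.
split=> //.
  split=> [u []//|u v x i j [A'u Su] [A'v Sv] wi wj minl].
  have A'x := walk_first wj; split=> //; apply: NNPP => nSx.
  have Ax : A x.
    apply: NNPP => /(inN _ A'x) Ex; apply: nSx; rewrite (surjective_pairing x).
    by case: A'x => _ hy; apply: hS; lia.
  have [u' [i1 [i2 [Au' Su' w1 w2 Ei]]]] : exists u' i1 i2,
      [/\ A u', S u', walk D A' i1 u u', walk D A' i2 u' x & (i1 + i2 = i)%N].
    case: (classic (A u)) => Au; first by exists u, 0%N, i; split=> //; apply: walk_nil.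
    have [a [b [i1 [i2 [[w1 Dab w2 nBa Bb] E]]]]] := walk_enters (B := A) wi Au Ax.
    exists b, i1.+1, i2; split=> //; last lia.
      exact: (nearN a b (walk_last w1) (walk_first w2) nBa Bb (arc_dist Dab)).
    exact: walk_rcons w1 (walk_first w2) Dab.
  have [v' [j1 [j2 [Av' Sv' w3 w4 Ej]]]] : exists v' j1 j2,
      [/\ A v', S v', walk D A' j1 x v', walk D A' j2 v' v & (j1 + j2 = j)%N].
    case: (classic (A v)) => Av; first by exists v, j, 0%N; split=> //; [apply: walk_nil | lia].
    have [a [b [j1 [j2 [[w3 Dab w4 nBa Bb] E]]]]] :=
      walk_enters (B := fun c => ~ A c) wj (fun h => h Ax) Av.
    have Aa : A a by apply: NNPP.
    exists a, j1, j2.+1; split=> //.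
      by apply: (nearN b a (walk_first w4) (walk_last w3) Bb Aa);
         move: (arc_dist Dab); rewrite /dist; lia.
    exact: walk_cons (walk_last w3) Dab w4.
  have minl' l : walk D A' l u' v' -> (i2 + j1 <= l)%N.
    by move=> w; have := minl _ (walk_cat w1 (walk_cat w w4)); lia.
  have [w2' w3' min23] := retract_geodesic sAA' rA r_id rD Au' Av' Ax w2 w3 minl'.
  by case: nSx; case: (gS.2 u' v' x i2 j1 _ _ w2' w3' min23).
move=> T gT [u0 Tu0 [v0 Tv0 nuv]] [z Tz nSz].
have gTA : geoconvex D A (fun c => A c /\ T c) := geoconvex_retract sAA' rA r_id rD gT.
have sT := gT.1.
have Az : A z.
  apply: NNPP => /(inN _ (sT _ Tz)) Ez; apply: nSz; rewrite (surjective_pairing z).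
  by case: (sT _ Tz) => _ hy; apply: hS; lia.
have [v Tv nvz] : exists2 v, T v & v <> z.
  by case: (classic (u0 = z)) => [E|]; [exists v0 => // E'; apply: nuv; rewrite E E' | exists u0].
have [a Ta Dza] := geoconvex_out gT cD' Tz Tv (not_eq_sym nvz).
have Aa : A a.
  apply: NNPP => nAa; apply: nSz.
  by apply: (nearN a z (sT _ Ta) (sT _ Tz) nAa Az); move: (arc_dist Dza); rewrite /dist; lia.
have full c : A c -> T c.
  move=> Ac; have [] // := hull _ gTA _ _ c Ac; last by exists z.
  exists a => //; exists z => // E.
  by move: (arc_dist Dza); rewrite E /dist; lia.
move=> c A'c; case: (classic (A c)) => [/full //|nAc]; have Ec := inN _ A'c nAc.
case: c Ec A'c {nAc} => x y /= -> [_ /= hy]; have [y' hy' Ey] := onN y hy.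
have [] := geoconvex_face gT (q y' hy') (face y' hy').
  by apply: Or44; rewrite Elo; split; apply: full; rewrite /A /box /=; lia.
by case: Ey => ->.
Qed.
End Extend.
End Mirror.

Local Close Scope Z_scope.

(** * Convex sets of a concrete digraph *)

Section Checker.
Variables (n : nat) (e : nat -> nat -> bool) (S : nat -> bool).
Local Notation A := (fun i => is_true (i < n)).
Local Notation D := (fun i j => is_true (e i j)).

(** Sets of vertices are binary numbers, so that evaluation computes unions with [N.lor]. *)
Definition inN (s : N) (i : nat) : bool := N.testbit s (N.of_nat i).
Arguments inN : simpl never.

Definition mask (p : nat -> bool) : N :=
  foldr (fun i s => if p i then N.setbit s (N.of_nat i) else s) 0%num (iota 0 n).

Definition bigor (s : N) (f : nat -> N) : N :=
  foldr (fun i t => if inN s i then N.lor (f i) t else t) 0%num (iota 0 n).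

Lemma in_mask p i : inN (mask p) i = (i < n) && p i.
Proof.
rewrite /mask; have -> : i < n = (i \in iota 0 n) by rewrite mem_iota add0n.
elim: (iota 0 n) => [|j s IH] /=; first by rewrite /inN; case: (N.of_nat i).
rewrite inE; case: (i =P j) => [<-|nij] /=.
  case pi: (p i); first by rewrite /inN N.setbit_eq.
  by rewrite IH pi andbF.
case: (p j) => //; rewrite -IH /inN N.setbit_neq //; lia.
Qed.

Lemma in_bigor s f i : inN (bigor s f) i = has (fun j => inN s j && inN (f j) i) (iota 0 n).
Proof.
rewrite /bigor; elim: (iota 0 n) => [|j t IH] /=; first by rewrite /inN; case: (N.of_nat i).
by case: (inN s j) => //=; rewrite -IH /inN N.lor_spec.
Qed.

Lemma bigorP s f i : reflect (exists j, [/\ j < n, inN s j & inN (f j) i]) (inN (bigor s f) i).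
Proof.
rewrite in_bigor; apply: (iffP hasP) => [[j]|[j [jn sj fj]]].
  by rewrite mem_iota => /andP[_ jn] /andP[sj fj]; exists j.
by exists j; rewrite ?mem_iota ?sj.
Qed.

(** Layer [l] collects the ends of walks with exactly [l] arcs from [u]. There are [n + 1] layers,
    so [find] answers [n + 1] for a vertex found in none of them, and [strongb] compares with
    [n]. *)
Definition layers (out : nat -> N) (u : nat) : seq N :=
  traject (fun s => bigor s out) (mask (pred1 u)) n.+1.

Definition dist_table : seq (seq nat) :=
  let outs := [seq mask (e i) | i <- iota 0 n] in
  [seq (let ls := layers (nth 0%num outs) u in
        [seq find (fun s => inN s v) ls | v <- iota 0 n]) | u <- iota 0 n].

Definition dst d u v : nat := nth 0 (nth [::] d u) v.


Let out i := nth 0%num [seq mask (e i) | i <- iota 0 n] i.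

Let in_out i j : i < n -> inN (out i) j = (j < n) && e i j.
Proof. by move=> lt; rewrite /out (nth_map 0) ?size_iota // nth_iota // in_mask. Qed.

Lemma layerP u l v : u < n ->
  inN (iter l (fun s => bigor s out) (mask (pred1 u))) v <-> walk D A l u v.
Proof.
move=> un; elim: l v => [|l IH] v /=.
  rewrite in_mask /=; split=> [/andP[vn /eqP<-]|w]; first exact: walk_nil.
  by rewrite (walk0E w) in un *; rewrite un eqxx.
split=> [/bigorP[j [jn /IH w]]|].
  by rewrite in_out // => /andP[vn ejv]; apply: walk_rcons w vn ejv.
rewrite -addn1 => w0; have [j [w w1]] := walk_split w0.
have [k [jn Djk w2]] := walkSE w1; have vn := walk_last w1.
rewrite (walk0E w2) in Djk; apply/bigorP; exists j; split=> //; first exact/IH.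
by rewrite in_out // vn.
Qed.

Lemma dstE u v : u < n -> v < n ->
  dst dist_table u v = find (fun s => inN s v) (layers out u).
Proof.
move=> un vn; rewrite /dst /dist_table (nth_map 0) ?size_iota // nth_iota //.
by rewrite (nth_map 0) ?size_iota // nth_iota.
Qed.

Lemma nth_layers u l : l <= n ->
  nth 0%num (layers out u) l = iter l (fun s => bigor s out) (mask (pred1 u)).
Proof.
by move=> le; rewrite /layers (set_nth_default (mask (pred1 u))) ?size_traject // nth_traject.
Qed.

Lemma dst_walk u v : u < n -> v < n -> dst dist_table u v <= n ->
  walk D A (dst dist_table u v) u v.
Proof.
move=> un vn; rewrite dstE // => le.
have lt : has (fun s => inN s v) (layers out u) by rewrite has_find size_traject.
by have := nth_find 0%num lt; rewrite nth_layers // layerP.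
Qed.

Lemma dst_le u v l : walk D A l u v -> dst dist_table u v <= l.
Proof.
move=> w; have un := walk_first w; have vn := walk_last w.
rewrite dstE // leqNgt; apply/negP=> lt; have := before_find 0%num lt.
have ln : l <= n.
  have := find_size (fun s => inN s v) (layers out u); rewrite size_traject => h.
  exact: leq_trans lt h.
by rewrite nth_layers // => /negP; apply; apply/layerP.
Qed.

Definition interval (d : seq (seq nat)) u v : N :=
  let du := nth [::] d u in let duv := nth 0 du v in
  mask (fun x => nth 0 du x + nth 0 (nth [::] d x) v == duv).

Definition interval_table (d : seq (seq nat)) : seq (seq N) :=
  [seq [seq interval d u v | v <- iota 0 n] | u <- iota 0 n].

Definition hull_step (t : seq (seq N)) (s : N) : N :=
  bigor s (fun u => let tu := nth [::] t u in bigor s (fun v => nth 0%num tu v)).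

(** The fuel may interrupt the closure; what is used is that the result lies in every convex set
    containing [s]. *)
Fixpoint hull (t : seq (seq N)) k (s : N) : N :=
  if k is k'.+1 then
    let s' := hull_step t s in if N.eqb s' s then s else hull t k' s'
  else s.

Definition strongb (d : seq (seq nat)) := all (all (leq^~ n)) d.

Definition convexb (t : seq (seq N)) :=
  all (fun u => ~~ S u || all (fun v => ~~ S v ||
    all (fun x => ~~ inN (nth 0%num (nth [::] t u) v) x || S x) (iota 0 n)) (iota 0 n)) (iota 0 n).

Definition full (s : N) := all (inN s) (iota 0 n).

(** Closing the two ends of an arc suffices: a convex set with two vertices, one of them outside
    [S], contains an out-neighbour of that one. *)
Definition hullb (t : seq (seq N)) :=
  all (fun u => all (fun v => if e u v then (S u && S v) ||
    full (hull t n (mask (pred2 u v))) else true) (iota 0 n)) (iota 0 n).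

Definition check :=
  let d := dist_table in
  if strongb d then let t := interval_table d in if convexb t then hullb t else false
  else false.

Let ns : forall u, u < n -> u \in iota 0 n. Proof. by move=> u; rewrite mem_iota. Qed.

Lemma strongb_le u v : strongb dist_table -> u < n -> v < n -> dst dist_table u v <= n.
Proof.
move=> /allP sb un vn.
have /allP h : all (leq^~ n) (nth [::] dist_table u).
  by apply/sb/mem_nth; rewrite size_map size_iota.
apply/h; rewrite /dst mem_nth // (nth_map 0) ?size_iota // nth_iota //.
by rewrite size_map size_iota.
Qed.

Lemma strongb_connected : strongb dist_table -> connected D A.
Proof.
move=> sb u v un vn; exists (dst dist_table u v).
by apply: dst_walk => //; apply: strongb_le.
Qed.

Let I := interval_table dist_table.

Lemma in_interval u v x : u < n -> v < n ->
  inN (nth 0%num (nth [::] I u) v) x =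
  (x < n) && (dst dist_table u x + dst dist_table x v == dst dist_table u v).
Proof.
move=> un vn; rewrite /I /interval_table (nth_map 0) ?size_iota // nth_iota //.
by rewrite (nth_map 0) ?size_iota // nth_iota // /interval in_mask.
Qed.

Lemma hull_sub T k s : strongb dist_table -> geoconvex D A T -> (forall u, inN s u -> T u) ->
  forall u, inN (hull I k s) u -> T u.
Proof.
move=> sb gT; elim: k s => [|k IH] s sT //=; case: N.eqb => //; apply: IH => x.
case/bigorP=> u [un su /bigorP[v [vn sv]]]; rewrite in_interval // => /andP[xn /eqP E].
have le := strongb_le sb; have wl a b an bn := dst_walk an bn (le a b an bn).
apply: (gT.2 u v x _ _ (sT _ su) (sT _ sv) (wl u x un xn) (wl x v xn vn)).
by move=> l /dst_le; rewrite E.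
Qed.

Lemma convexb_geoconvex : strongb dist_table -> convexb I -> geoconvex D A (fun u => A u /\ S u).
Proof.
move=> sb cb; split=> [u []//|u v x i j [un Su] [vn Sv] wi wj minl].
have xn := walk_first wj; split=> //.
move/allP/(_ _ (ns un)): cb; rewrite Su => /allP/(_ _ (ns vn)); rewrite Sv => /allP/(_ _ (ns xn)).
rewrite in_interval // xn /=; have := strongb_le sb; move=> le.
have -> : dst dist_table u x + dst dist_table x v == dst dist_table u v; last by [].
have := minl _ (dst_walk un vn (le _ _ un vn)).
have := dst_le wi; have := dst_le wj.
have := dst_le (walk_cat (dst_walk un xn (le _ _ un xn)) (dst_walk xn vn (le _ _ xn vn))).
by lia.
Qed.

Lemma check_good : check -> good D A S.
Proof.
rewrite /check; case: ifP => // sb; case: ifP => // cb hb.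
have cD := strongb_connected sb.
split=> //; first exact: convexb_geoconvex.
move=> T gT [u0 Tu0 [v0 Tv0 nuv]] [z Tz /negP nSz] x xn.
have zn := gT.1 _ Tz.
have [v Tv nvz] : exists2 v, T v & v <> z.
  by case: (classic (u0 = z)) => [E|]; [exists v0 => // E'; apply: nuv; rewrite E E' | exists u0].
have [a Ta Dza] := geoconvex_out gT cD Tz Tv (not_eq_sym nvz).
move/allP/(_ _ (ns zn))/allP/(_ _ (ns (gT.1 _ Ta))): hb.
rewrite Dza (negbTE nSz) /= => /allP/(_ _ (ns xn)).
by apply: (hull_sub sb gT) => u; rewrite in_mask => /andP[_ /orP[]/eqP->].
Qed.

(* [s] and [x] are the vertices forced inside and outside a convex set, [todo]
   those not yet decided and [kept] the ones decided to be inside. *)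
Fixpoint small (t : seq (seq N)) k (todo : seq nat) (s x : N) (kept : nat) : bool :=
  if full s then true else if ~~ N.eqb (N.land s x) 0%num then true else
  if kept + size todo <= k then true else
  if todo is v :: todo' then
    if small t k todo' (hull t n (N.lor s (mask (pred1 v)))) x kept.+1 then
      small t k todo' s (N.lor x (mask (pred1 v))) kept
    else false
  else false.

(** Following the branch that agrees with [T] on each decided vertex leads to a full hull or to few
    remaining candidates; a vertex forced both inside and outside cannot occur there. *)
Lemma smallP T k todo s x kept : strongb dist_table -> geoconvex D A T ->
  (forall u, inN s u -> T u) -> (forall u, inN x u -> ~ T u) ->
  (forall u, T u -> u \in kept ++ todo) -> small I k todo s x (size kept) ->
  (forall u, A u -> T u) \/ exists2 l : seq nat, size l <= k & forall u, T u -> u \in l.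
Proof.
move=> sb gT; have base todo' s' x' kept' (rest : bool) : (forall u, inN s' u -> T u) ->
    (forall u, inN x' u -> ~ T u) -> (forall u, T u -> u \in kept' ++ todo') ->
    (if full s' then true else if ~~ N.eqb (N.land s' x') 0%num then true else
     if size kept' + size todo' <= k then true else rest) ->
    rest \/ (forall u, A u -> T u) \/ exists2 l : seq nat, size l <= k & forall u, T u -> u \in l.
  move=> sT xT Tk; case: ifP => [/allP fs _|_].
    by right; left=> u /ns/fs/sT.
  case: N.eqb_spec => [_|nE _] /=; last first.
    case: nE; apply: N.bits_inj => i; rewrite N.land_spec N.bits_0; apply/negP=> /andP[h1 h2].
    by apply: (xT (N.to_nat i)); [|apply: sT]; rewrite /inN Nnat.N2Nat.id.
  case: ifP => [le _|_]; last by left.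
  by right; right; exists (kept' ++ todo'); rewrite ?size_cat.
elim: todo s x kept => [|v todo IH] s x kept sT xT Tk /(base _ _ _ _ _ sT xT Tk)[] //.
case: ifP => // h1 h2.
have in1 u : inN (mask (pred1 v)) u -> u = v by rewrite in_mask => /andP[_ /eqP].
case: (classic (T v)) => Tv.
  apply: (IH _ _ (v :: kept) _ xT _ h1) => [|u Tu].
    apply: (hull_sub sb gT) => u; rewrite /inN N.lor_spec => /orP[/sT //|].
    by move/in1 => ->.
  by have := Tk u Tu; rewrite !mem_cat !inE -!orbA /= orbCA.
apply: (IH _ _ kept sT _ _ h2) => u; last first.
  move=> Tu; have := Tk u Tu; rewrite !mem_cat inE.
  by case: (u =P v) => // E; case: Tv; rewrite -E.
by rewrite /inN N.lor_spec => /orP[/xT //|/in1 ->].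
Qed.
End Checker.

(** * Folded bases *)

Local Open Scope Z_scope.

(** Enlarging a grid downwards is enlarging its transpose to the right. *)
Definition swap (c : cell) : cell := (c.2, c.1).
Definition transpose (F : Z -> Z -> bool) x y := F y x.

Lemma swapK : cancel swap swap.
Proof. by case. Qed.

Lemma arc_swap H V u v :
  arc H V u v <-> arc (transpose V) (transpose H) (swap u) (swap v).
Proof. by case: u v => x y [x' y']; rewrite !arcE /transpose /=; tauto. Qed.

Lemma box_swap n m c : box 0 n m c -> box 0 m n (swap c).
Proof. by case=> ? ?; split. Qed.

Lemma good_swap H V n m S : good (arc H V) (box 0 n m) (fun c => S (swap c)) ->
  good (arc (transpose V) (transpose H)) (box 0 m n) S.
Proof.
apply: good_transport; [exact: box_swap| | |].
- by move=> c /box_swap Bc; exists (swap c); rewrite ?swapK.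
- by move=> u v _ _; apply: (can_inj swapK).
by move=> u v _ _; apply: arc_swap.
Qed.

Lemma cyclic_face_swap H V x y :
  cyclic_face (arc (transpose V) (transpose H)) y x <-> cyclic_face (arc H V) x y.
Proof.
split=> /cyclic_faceP h; apply/cyclic_faceP; move: h; rewrite /cyclicb /transpose.
  by case: (H x y) (H x (y + 1)) (V x y) (V (x + 1) y) => -[] [] [].
by case: (H x y) (H x (y + 1)) (V x y) (V (x + 1) y) => -[] [] [].
Qed.

Section Iterate.
Variables (H V : Z -> Z -> bool) (lo hi m : Z) (S : cell -> Prop).
Hypotheses (wide : lo + 2 <= hi) (m2 : 2 <= m).
Local Notation D := (arc H V).

Lemma cyclic_faces_right x0 x y : (forall x, x0 < x -> mirror H V x) -> x0 <= x ->
  cyclic_face D x0 y -> cyclic_face D x y.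
Proof.
move=> mir le face.
apply: (Z_up (P := fun t => cyclic_face D t y) (b := x) face) => [t ht ft|]; last lia.
have Et : t = t + 1 - 1 by lia.
by rewrite Et in ft; move/mirror_face: ft; apply; apply: mir; lia.
Qed.

Lemma extend_right_iter hi' : hi <= hi' -> (forall x, hi - 1 <= x -> mirror H V x) ->
  (forall y, 0 <= y < m - 1 -> cyclic_face D (hi - 2) y) ->
  (forall x y, hi - 1 <= x -> 0 <= y < m -> ~ S (x, y)) ->
  good D (box lo hi m) S -> good D (box lo hi' m) S.
Proof.
move=> le mir face nS gS.
apply: (Z_up (P := fun t => good D (box lo t m) S) (b := hi') gS) => [t ht|]; last lia.
apply: extend_right => //; [lia | apply: mir; lia | | by move=> x y hx; apply: nS; lia].
move=> y hy; apply: (cyclic_faces_right (x0 := hi - 2)); [ | lia | exact: face].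
by move=> x hx; apply: mir; lia.
Qed.

Lemma extend_left_iter lo' : lo' <= lo -> (forall x, x <= lo -> mirror H V x) ->
  (forall y, 0 <= y < m - 1 -> cyclic_face D lo y) ->
  (forall x y, x <= lo -> 0 <= y < m -> S (x, y)) ->
  good D (box lo hi m) S -> good D (box lo' hi m) S.
Proof.
move=> le mir face hS gS.
pose P t := good D (box t hi m) S /\ forall y, 0 <= y < m - 1 -> cyclic_face D t y.
suff [] : P lo' by [].
apply: (@Z_down P lo' lo (conj gS face)) => [t ht [gt ft]|]; last lia.
have mt : mirror H V t by apply: mir; lia.
have ft' y : 0 <= y < m - 1 -> cyclic_face D (t - 1) y by move=> /ft; apply: (mirror_face y mt).2.
by split=> //; apply: extend_left => //; [lia | move=> x y hx; apply: hS; lia].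
Qed.
End Iterate.

Lemma mod2_spec z : exists q, z = 2 * q + z mod 2 /\ 0 <= z mod 2 < 2.
Proof. by exists (z / 2); split; [apply: Z.div_mod | apply: Z.mod_pos_bound]. Qed.

Lemma all_iotaZ (p : Z -> bool) k z :
  all (fun i => p (Z.of_nat i)) (iota 0 k) -> 0 <= z < Z.of_nat k -> p z.
Proof.
move=> /allP h hz; have -> : z = Z.of_nat (Z.to_nat z) by lia.
by apply: (h (Z.to_nat z)); rewrite mem_iota; lia.
Qed.

Lemma count_grid (p : pred nat) k l :
  count p (iota 0 (k * l)) = (\sum_(i < k) \sum_(j < l) p (i * l + j))%N.
Proof.
elim: k => [|k IH]; first by rewrite big_ord0.
rewrite mulSnr iotaD count_cat IH big_ord_recr /= add0n; congr addn.
rewrite -{1}[(k * l)%N]addn0 iotaDl count_map -sum1_count big_mkcond /=.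
by rewrite -[l]subn0 -/(index_iota _ _) big_mkord subn0; apply: eq_bigr => j _; case: (p _).
Qed.

Section Base.

(* The bits of [hbits], [vbits] and [sbits] are indexed by [x * rows + y]. *)
Record base := Base { cols : nat; rows : nat; hbits : Z; vbits : Z; sbits : Z }.

(* The integer line is folded onto [0, n): it bounces between the last two points
   on the right and between the first two on the left. *)
Definition fold (n : nat) (x : Z) : Z :=
  let N := Z.of_nat n in
  if x <? 0 then x mod 2 else if x <? N then x else N - 2 + (x - N) mod 2.

Variable b : base.
Let n := cols b.
Let m := rows b.

Definition bit (s x y : Z) : bool := Z.testbit s (x * Z.of_nat m + y).

(** Folding can reverse an edge, when [x + 1] lands to the left of [x]; the bit of the folded edge
    is then negated. *)
Definition foldH x y : bool :=
  let x0 := fold n x in let x1 := fold n (x + 1) in let y0 := fold m y in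
  if x0 <? x1 then bit (hbits b) x0 y0 else ~~ bit (hbits b) x1 y0.

Definition foldV x y : bool :=
  let x0 := fold n x in let y0 := fold m y in let y1 := fold m (y + 1) in
  if y0 <? y1 then bit (vbits b) x0 y0 else ~~ bit (vbits b) x0 y1.

(** Columns added on the left lie in the convex set, while columns or rows added on the right or at
    the bottom lie outside it, in accordance with [extend_left] and [extend_right]. *)
Definition foldS (c : cell) : bool :=
  (c.1 <? 0) ||
  ((c.1 <? Z.of_nat n) && (c.2 <? Z.of_nat m) && bit (sbits b) c.1 c.2).

Definition cell_of (i : nat) : cell := (Z.of_nat (i %/ m), Z.of_nat (i %% m)).

Definition edgeb i j := arcb foldH foldV (cell_of i) (cell_of j).

Definition checkb := (1 < n)%N && (1 < m)%N && check (n * m) edgeb (fun i => foldS (cell_of i)).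

(** Asks the last column of faces to be directed, since its reflections become the added faces, and
    the last column of vertices to avoid the convex set. *)
Definition right_free :=
  all (fun y => cyclicb foldH foldV (Z.of_nat n - 2) (Z.of_nat y)) (iota 0 m.-1) &&
  all (fun y => ~~ foldS (Z.of_nat n - 1, Z.of_nat y)) (iota 0 m).

Definition bottom_free :=
  all (fun x => cyclicb foldH foldV (Z.of_nat x) (Z.of_nat m - 2)) (iota 0 n.-1) &&
  all (fun x => ~~ foldS (Z.of_nat x, Z.of_nat m - 1)) (iota 0 n).

Definition left_full :=
  all (fun y => cyclicb foldH foldV 0 (Z.of_nat y)) (iota 0 m.-1) &&
  all (fun y => foldS (0, Z.of_nat y)) (iota 0 m).
Lemma cell_of_box i : (i < n * m)%N -> box 0 (Z.of_nat n) (Z.of_nat m) (cell_of i).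
Proof.
move=> lt; have m0 : (0 < m)%N by case: m lt => //; rewrite muln0.
rewrite /box /cell_of /=; have := ltn_pmod i m0; have : (i %/ m < n)%N by rewrite ltn_divLR.
by move: (i %/ m)%N (i %% m)%N; lia.
Qed.

Lemma cell_of_onto c : box 0 (Z.of_nat n) (Z.of_nat m) c ->
  exists2 i, (i < n * m)%N & cell_of i = c.
Proof.
case: c => x y [/= hx hy]; exists (Z.to_nat x * m + Z.to_nat y)%N; first nia.
rewrite /cell_of divnMDl ?modnMDl ?divn_small ?modn_small; try lia.
by congr pair; lia.
Qed.

Lemma cell_of_inj : injective cell_of.
Proof. by move=> i j [E1 E2]; rewrite (divn_eq i m) (divn_eq j m); congr (_ * _ + _)%N; lia. Qed.

Definition base_size := count (fun i => foldS (cell_of i)) (iota 0 (n * m)).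

Lemma base_card p q r : (p = 0%N) \/ (r = 0%N) ->
  #|[set u : 'I_(p + n + q) * 'I_(m + r) | foldS (emb (- Z.of_nat p) u)]|
  = (p * m + base_size)%N.
Proof.
move=> pr; pose F (x y : nat) : nat := foldS (- Z.of_nat p + Z.of_nat x, Z.of_nat y).
have F1 x y : (x < p)%N -> F x y = 1%N.
  by move=> xp; rewrite /F /foldS /=; case: Z.ltb_spec => //; lia.
have F2 x y : (x < n)%N -> (y < m)%N -> F (p + x)%N y = foldS (cell_of (x * m + y)).
  move=> xn ym; rewrite /F /cell_of divnMDl ?modnMDl ?divn_small ?modn_small //; last lia.
  by congr (nat_of_bool (foldS (_, _))); lia.
have F3 x y : (m <= y)%N -> F (p + x)%N y = 0%N.
  move=> ym; rewrite /F /foldS /=; case: Z.ltb_spec => [|_]; first lia.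
  by case: (Z.ltb_spec _ (Z.of_nat m)) => [|_]; [lia | rewrite andbF].
have F4 x y : F (p + (n + x))%N y = 0%N.
  rewrite /F /foldS /=; case: Z.ltb_spec => [|_]; first lia.
  by case: (Z.ltb_spec _ (Z.of_nat n)) => [|_]; first lia.
transitivity (\sum_(u : 'I_(p + n + q) * 'I_(m + r)) F u.1 u.2)%N.
  rewrite cardsE -sum1_card big_mkcond; apply: eq_bigr => u _.
  by rewrite unfold_in /F /emb /foldS; case: (_ || _).
rewrite -(pair_bigA _ (fun (x : 'I_(p + n + q)) (y : 'I_(m + r)) => F x y)) /=.
rewrite -addnA big_split_ord /= big_split_ord /=; congr addn.
  rewrite (eq_bigr (fun=> m + r)%N) => [|x _]; last first.
    by rewrite (eq_bigr (fun=> 1%N)) => [|y _]; rewrite ?sum1_card ?card_ord // F1.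
  by rewrite sum_nat_const card_ord; case: pr => ->; rewrite ?addn0.
rewrite [X in (_ + X)%N]big1 ?addn0 => [|x _]; last by apply: big1 => y _; apply: F4.
rewrite /base_size count_grid; apply: eq_bigr => x _; rewrite big_split_ord /=.
rewrite [X in (_ + X)%N]big1 ?addn0 => [|y _]; last by rewrite F3 ?leq_addr.
by apply: eq_bigr => y _; rewrite F2.
Qed.

Section Extensions.
Hypothesis cb : checkb.
Let N := Z.of_nat n.
Let M := Z.of_nat m.

Let N2 : 2 <= N. Proof. by case/andP: cb => /andP[]; rewrite /N; lia. Qed.
Let M2 : 2 <= M. Proof. by case/andP: cb => /andP[]; rewrite /M; lia. Qed.

Lemma fold_step k x : (1 < k)%N -> fold k (x + 1) = fold k x + 1 \/ fold k (x + 1) = fold k x - 1.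
Proof.
move=> k1; rewrite /fold; have [q1 ?] := mod2_spec x; have [q2 ?] := mod2_spec (x + 1).
have [q3 ?] := mod2_spec (x - Z.of_nat k); have [q4 ?] := mod2_spec (x + 1 - Z.of_nat k).
case: (Z.ltb_spec x 0) => h1; case: (Z.ltb_spec (x + 1) 0) => h2;
case: (Z.ltb_spec x (Z.of_nat k)) => h3; case: (Z.ltb_spec (x + 1) (Z.of_nat k)) => h4;
lia.
Qed.

Lemma fold_mirror k x : (1 < k)%N -> x <= 0 \/ Z.of_nat k - 1 <= x ->
  fold k (x + 1) = fold k (x - 1).
Proof.
move=> k1 hx; rewrite /fold; have [q1 ?] := mod2_spec (x - 1); have [q2 ?] := mod2_spec (x + 1).
have [q3 ?] := mod2_spec (x - 1 - Z.of_nat k); have [q4 ?] := mod2_spec (x + 1 - Z.of_nat k).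
case: (Z.ltb_spec (x - 1) 0) => h1; case: (Z.ltb_spec (x + 1) 0) => h2;
case: (Z.ltb_spec (x - 1) (Z.of_nat k)) => h3; case: (Z.ltb_spec (x + 1) (Z.of_nat k)) => h4;
lia.
Qed.

Lemma fold_mirrored_column x : x <= 0 \/ N - 1 <= x -> mirror foldH foldV x.
Proof.
move=> hx; have n1 : (1 < n)%N by move: N2; rewrite /N; lia.
have E := fold_mirror n1 hx; split=> y; last by rewrite /foldV E.
rewrite /foldH Z.sub_add -E; have := fold_step x n1.
by case: Z.ltb_spec; case: Z.ltb_spec; rewrite ?negbK //; lia.
Qed.

Lemma fold_mirrored_row y : M - 1 <= y -> mirror (transpose foldV) (transpose foldH) y.
Proof.
move=> hy; have m1 : (1 < m)%N by move: M2; rewrite /M; lia.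
have E := fold_mirror m1 (or_intror hy); split=> x; last by rewrite /transpose /foldH E.
rewrite /transpose /foldV Z.sub_add -E; have := fold_step y m1.
by case: Z.ltb_spec; case: Z.ltb_spec; rewrite ?negbK //; lia.
Qed.

Lemma base_good : good (arc foldH foldV) (box 0 N M) foldS.
Proof.
have m0 : (0 < m)%N by move: M2; rewrite /M; lia.
case/andP: cb => _ /check_good gb.
apply: (good_transport (f := cell_of) (S := fun c => is_true (foldS c)) _ _ _ _ gb).
- exact: cell_of_box.
- exact: cell_of_onto.
- by move=> i j _ _; apply: cell_of_inj.
by move=> i j _ _; apply: arcbP.
Qed.

(** Rows are added before columns; the faces needed next to the added rows then follow by
    reflection. Columns are added on the left only without new rows, because below the base column 0
    is outside the convex set. *)
Lemma base_extend p q r : (r = 0%N) \/ bottom_free -> (q = 0%N) \/ right_free ->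
  (p = 0%N) \/ (r = 0%N /\ left_full) ->
  good (arc foldH foldV) (box (- Z.of_nat p) (N + Z.of_nat q) (M + Z.of_nat r)) foldS.
Proof.
move=> hr hq hp.
have g1 : good (arc foldH foldV) (box 0 N (M + Z.of_nat r)) foldS.
  case: hr => [->|]; first by rewrite Z.add_0_r; apply: base_good.
  case/andP=> face nS.
  have g0 : good (arc (transpose foldV) (transpose foldH)) (box 0 M N) (fun c => foldS (swap c)).
    by apply: good_swap; apply: base_good.
  apply: (good_swap (H := transpose foldV) (V := transpose foldH)).
  apply: (extend_right_iter (hi := M)); last exact: g0.
  - lia.
  - lia.
  - lia.
  - by move=> y hy; apply: fold_mirrored_row.
  - move=> x hx; apply/cyclic_face_swap/cyclic_faceP.
    apply: (all_iotaZ (p := fun x => cyclicb foldH foldV x (M - 2)) face).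
    by move: hx; rewrite /N; lia.
  move=> y x hy hx; rewrite /foldS /swap /=; case: (Z.eq_dec y (M - 1)) => [->|yM].
    have := all_iotaZ (p := fun x => ~~ foldS (x, M - 1)) nS (z := x).
    by rewrite /foldS /= => /(_ ltac:(move: hx; rewrite /N; lia)) /negP.
  rewrite -/M; case: (Z.ltb_spec x 0) => ?; first lia.
  by case: (Z.ltb_spec y M) => ?; [lia | rewrite andbF].
have g2 : good (arc foldH foldV) (box 0 (N + Z.of_nat q) (M + Z.of_nat r)) foldS.
  case: hq => [->|]; first by rewrite Z.add_0_r.
  case/andP=> face nS.
  have face' y : 0 <= y < M - 1 -> cyclic_face (arc foldH foldV) (N - 2) y.
    move=> hy; apply/cyclic_faceP.
    apply: (all_iotaZ (p := fun y => cyclicb foldH foldV (N - 2) y) face).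
    by move: hy; rewrite /M; lia.
  apply: (extend_right_iter (hi := N)); last exact: g1.
  - lia.
  - lia.
  - lia.
  - by move=> x hx; apply: fold_mirrored_column; right; lia.
  - move=> y hy; case: (Z.leb_spec y (M - 2)) => yM; first by apply: face'; lia.
    apply/cyclic_face_swap; apply: (cyclic_faces_right (x0 := M - 2)).
    + by move=> t ht; apply: fold_mirrored_row; lia.
    + lia.
    by apply/cyclic_face_swap/face'; lia.
  move=> x y hx hy; rewrite /foldS /=; case: (Z.eq_dec x (N - 1)) => [->|xN]; last first.
    by rewrite -/N; case: (Z.ltb_spec x 0) => ?; [lia|]; case: (Z.ltb_spec x N) => ? //; lia.
  case: (Z.leb_spec M y) => yM.
    rewrite -/M; case: (Z.ltb_spec (N - 1) 0) => ?; first lia.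
    by case: (Z.ltb_spec y M) => ?; [lia | rewrite andbF].
  have := all_iotaZ (p := fun y => ~~ foldS (N - 1, y)) nS (z := y).
  by rewrite /foldS /= => /(_ ltac:(move: hy yM; rewrite /M; lia)) /negP.
case: hp => [->//|[Er /andP[face hS]]]; rewrite Er Z.add_0_r in g2 *.
apply: (extend_left_iter (lo := 0)); last exact: g2.
- lia.
- lia.
- lia.
- by move=> x hx; apply: fold_mirrored_column; left.
- move=> y hy; apply/cyclic_faceP.
  by apply: (all_iotaZ (p := fun y => cyclicb foldH foldV 0 y) face); move: hy; rewrite /M; lia.
move=> x y hx hy; case: (Z.eq_dec x 0) => [->|x0].
  by apply: (all_iotaZ (p := fun y => foldS (0, y)) hS); move: hy; rewrite /M; lia.
by rewrite /foldS /=; case: (Z.ltb_spec x 0) => ?; [|lia].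
Qed.

Lemma base_spectrum p q r : (r = 0%N) \/ bottom_free -> (q = 0%N) \/ right_free ->
  (p = 0%N) \/ (r = 0%N /\ left_full) -> (0 < base_size < n * m)%N ->
  strong_convexity_spectrum
    (cartesian_product (@path_graph (p + n + q)) (@path_graph (m + r))) (p * m + base_size).
Proof.
move=> hr hq hp sz; have gd := base_extend hr hq hp.
have E : - Z.of_nat p + Z.of_nat (p + n + q) = N + Z.of_nat q by rewrite /N; lia.
have E' : Z.of_nat (m + r) = M + Z.of_nat r by rewrite /M; lia.
rewrite -{}E -{}E' in gd; case: gd => cD gS hull.
have pr : (p = 0%N) \/ (r = 0%N) by case: hp => [|[]]; [left | right].
apply: (spectrum_intro (H := foldH) (V := foldV) (base_card q pr)); first by nia.
- exact: cD.
- exact: gS.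
move=> T gT T2 [u Tu nSu]; left; apply: hull => //.
by exists u => //; apply/negP.
Qed.
End Extensions.
End Base.

Local Close Scope Z_scope.

(** * The spectrum *)

Local Notation grid n m := (cartesian_product (@path_graph n) (@path_graph m)).

Section Isomorphism.
Variables (T U : finType) (e : rel T) (e' : rel U) (f : T -> U) (g : U -> T).
Hypotheses (fK : cancel f g) (gK : cancel g f) (fe : forall x y, e' (f x) (f y) = e x y).

Lemma spectrum_iso k : strong_convexity_spectrum e k -> strong_convexity_spectrum e' k.
Proof.
case=> D [[sD xD] strD [[S [cS ST Sk] maxS]]].
have f_inj := can_inj fK; pose D' : rel U := fun x y => D (g x) (g y).
have dipE u v p : dipath D' (f u) (f v) (map f p) = dipath D u v p.
  rewrite /dipath last_map (inj_eq f_inj) -map_cons (map_inj_uniq f_inj).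
  by rewrite path_map (eq_path (e' := D)) // => x y; rewrite /D' /= !fK.
have geoE u v p : geodesic D' (f u) (f v) (map f p) <-> geodesic D u v p.
  rewrite /geodesic dipE size_map; split=> -[-> minp]; split=> // q.
    by rewrite -dipE => /minp; rewrite size_map.
  by rewrite -[q](mapK gK) dipE size_map => /minp.
have convE (A : {set T}) : convex D' (f @: A) <-> convex D A.
  rewrite /convex imset_eq0; split=> -[A0 cA]; split=> // u v p Au Av.
    move=> /geoE /(cA _ _ _ (imset_f f Au) (imset_f f Av)) sub x xp.
    by rewrite -(mem_imset _ _ f_inj); apply: sub; rewrite -map_cons map_f.
  case/imsetP: Au => {}u Au ->; case/imsetP: Av => {}v Av ->.
  rewrite -[p](mapK gK) => /geoE /(cA _ _ _ Au Av) sub x.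
  by rewrite -map_cons => /mapP[y yp ->]; rewrite imset_f ?sub.
have imT (A : {set T}) : (f @: A == [set: U]) = (A == [set: T]).
  apply/eqP/eqP => [E|->]; apply/setP => x; rewrite inE.
    by rewrite -(mem_imset _ _ f_inj) E inE.
  by rewrite -[x]gK imset_f ?inE.
exists D'; split.
- split=> [x y /sD|x y]; first by rewrite -fe !gK.
  by rewrite -{1}[x]gK -{1}[y]gK fe => /xD.
- move=> x y; have [p dp] := strD (g x) (g y).
  by exists (map f p); rewrite -[x]gK -[y]gK dipE.
split=> [|A cA AT].
  by exists (f @: S); rewrite imT card_imset //; split=> //; apply/convE.
have EA : f @: (g @: A) = A by rewrite -imset_comp (eq_imset (g := id)) ?imset_id.
rewrite -EA in cA AT *; rewrite card_imset //; rewrite imT in AT.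
by apply: maxS AT; apply/convE.
Qed.
End Isomorphism.

(** Lets the short side be the row length of a staircase, so that an empty row costs only [m]
    vertices. *)
Lemma grid_spectrum_sym n m k :
  strong_convexity_spectrum (grid n m) k -> strong_convexity_spectrum (grid m n) k.
Proof.
apply: (spectrum_iso (f := fun u => (u.2, u.1)) (g := fun u => (u.2, u.1))); try by case.
by move=> [x y] [x' y']; rewrite /cartesian_product /= orbC.
Qed.

(** Greedy distribution of an excess [E] over [a] rows of capacity [N], starting from the last row
    so that the widths are nondecreasing. *)
Lemma sum_filler N E a :
  \sum_(i < a) minn N (E - N * (a.-1 - i)) = minn E (N * a).
Proof.
elim: a => [|a IH]; first by rewrite big_ord0 muln0 minn0.
rewrite big_ord_recl /= subn0 (eq_bigr (fun i : 'I_a => minn N (E - N * (a.-1 - i)))); last first.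
  by move=> i _; rewrite /bump /=; congr (minn _ (_ - _ * _)); lia.
by rewrite IH mulnS; move: (N * a) => b; lia.
Qed.

(** After the exchange of sides there are [n] rows: an empty one, [n - 3] of widths from 2 to [m],
    and two full ones. The bounds on [k] are the extreme sums. *)
Lemma corner_range n m k : 4 <= n -> 2 <= m -> 2 * n + 2 * m - 6 <= k <= n * m - m ->
  strong_convexity_spectrum (grid n m) k.
Proof.
move=> n4 m2 hk; apply: grid_spectrum_sym.
have [a En] : exists a, n = a.+3 by exists (n - 3); lia.
pose E := k - (2 * n + 2 * m - 6).
have EM : E <= (m - 2) * a by rewrite /E; nia.
pose w i := if i == 0 then 0 else if i < a.+1 then 2 + minn (m - 2) (E - (m - 2) * (a - i)) else m.
have w_mid i : i < a -> w i.+1 = 2 + minn (m - 2) (E - (m - 2) * (a.-1 - i)).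
  by move=> ia; rewrite /w /= ltnS ia; congr (_ + minn _ (_ - _ * _)); lia.
have w_end i : a < i -> w i = m by move=> ia; rewrite /w; do 2!(case: ifP => // ?; first lia).
have -> : k = \sum_(i < n) w i.
  rewrite En big_ord_recl 2!big_ord_recr /= /bump /= (w_end (1 + a)) ?(w_end (1 + a.+1)); try lia.
  rewrite (eq_bigr (fun i : 'I_a => 2 + minn (m - 2) (E - (m - 2) * (a.-1 - i)))); last first.
    by move=> i _; rewrite /= add1n w_mid.
  rewrite big_split /= sum_filler sum_nat_const card_ord (minn_idPl EM) /w /= /E; nia.
apply: corner_spectrum => //; rewrite /w.
- by move=> i hi; case: eqP => [|_]; [lia | case: ifP => _; lia].
- move=> i j hij; case: eqP => [_|i0]; first lia.
  case: eqP => [|_]; first lia.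
  case: ifP => hi; case: ifP => hj; try lia.
  rewrite leq_add2l leq_min geq_minl /=; apply: leq_trans (geq_minr _ _) _.
  by apply: leq_sub2l; rewrite leq_mul2l; apply/orP; right; lia.
- by rewrite En /=; case: ifP => //; lia.
- by rewrite En /=; case: ifP => //; lia.
Qed.

(** After the exchange of sides, three rows have width [m - 2], the last two are full and the others
    range between these widths; at the upper bound only the block of 6 vertices is missing. *)
Lemma notch_range n m k : 5 <= n -> 4 <= m -> (n - 2) * (m - 2) + 2 * m <= k <= n * m - 6 ->
  n * m <= k.*2 -> strong_convexity_spectrum (grid n m) k.
Proof.
move=> n5 m4 hk le2; apply: grid_spectrum_sym.
have [a En] : exists a, n = a.+1.+4 by exists (n - 5); lia.
pose E := k - ((n - 2) * (m - 2) + 2 * m).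
have EM : E <= 2 * a by rewrite /E; nia.
pose w i := if i < 3 then m - 2 else if i < a + 3 then m - 2 + minn 2 (E - 2 * (a + 2 - i)) else m.
have w_mid i : i < a -> w (3 + i) = m - 2 + minn 2 (E - 2 * (a.-1 - i)).
  move=> ia; rewrite /w; case: ltnP => ?; first lia.
  by case: ltnP => ?; [congr (_ + minn _ (_ - _ * _)); lia | lia].
have w_end i : a + 3 <= i -> w i = m by move=> ia; rewrite /w; do 2!(case: ltnP => ?; first lia).
apply: (notch_spectrum (w := w)) => //.
- by move=> i i2; rewrite /w; case: ltnP => //; lia.
- by move=> i hi; rewrite /w; do !case: ltnP => ?; lia.
- by move=> i j hij; rewrite /w; do !case: ltnP => ?; lia.
- by move=> i hi; apply: w_end; lia.
- rewrite En 2!big_ord_recr 3!big_ord_recl /= /bump /= (w_end a.+3) ?(w_end a.+4); try lia.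
  rewrite (eq_bigr (fun i : 'I_a => m - 2 + minn 2 (E - 2 * (a.-1 - i)))); last first.
    by move=> i _; rewrite -w_mid.
  rewrite big_split /= sum_filler sum_nat_const card_ord (minn_idPl EM) /w /= /E; nia.
- by rewrite mulnC.
Qed.

(** The list holds the nonzero widths from top to bottom. Two rows of width [W] end it and at least
    two empty rows precede it, hence the 4. *)
Lemma inner_tail n m t W : sorted leq (t ++ [:: W; W]) -> all (leq 2) t -> 2 <= W <= n - 2 ->
  size t + 4 <= m -> strong_convexity_spectrum (grid n m) (sumn t + 2 * W).
Proof.
move=> srt t2 hW hm; pose s := t ++ [:: W; W].
have sz : size s = size t + 2 by rewrite size_cat.
have [r Em] : exists r, m = r + size s by exists (m - size s); lia.
pose w i := if i < r then 0 else nth 0 s (i - r).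
have mono i j : i <= j < size s -> nth 0 s i <= nth 0 s j.
  by move=> /andP[ij js]; apply: (sorted_leq_nth leq_trans leqnn 0 srt) => //; rewrite inE -/s; lia.
have tailW i : size t <= i < size s -> nth 0 s i = W.
  move=> hi; rewrite nth_cat; have [->|->] : i = size t \/ i = (size t).+1 by lia.
    by rewrite ltnn subnn.
  by rewrite ltnNge leqnSn /= subSnn.
have s2 i : i < size s -> 2 <= nth 0 s i <= W.
  move=> hi; case: (ltnP i (size t)) => it; last by rewrite tailW; lia.
  have le : nth 0 s i <= nth 0 s (size t).+1 by apply: mono; lia.
  rewrite [X in _ <= X]tailW in le; last lia.
  by rewrite le andbT nth_cat it; apply: (allP t2); apply: mem_nth.
apply: (@inner_spectrum n m r W w) => //.
- lia.
- by move=> i ir; rewrite /w ir.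
- by move=> i hi; rewrite /w; case: (ltnP i r) => [|_]; [lia | apply: s2; lia].
- move=> i j hij; rewrite /w; case: (ltnP i r) => // ri.
  by case: (ltnP j r) => [|_]; [lia | apply: mono; lia].
- by move=> i hi; rewrite /w; case: (ltnP i r) => [|_]; [lia | apply: tailW; lia].
rewrite Em big_split_ord /= big1 => [|i _]; last by rewrite /w ltn_ord.
rewrite add0n (eq_bigr (fun i : 'I_(size s) => nth 0 s i)); last first.
  by move=> i _; rewrite /w ltnNge leq_addr /= addKn.
rewrite -(big_mkord xpredT (nth 0 s)) -(big_nth 0 xpredT id) -sumnE sumn_cat /=; lia.
Qed.

(* The orientations in [Base] below were found by a randomized computer search. *)
Definition base_of_size b k :=
  [&& checkb b, base_size b == k & 0 < k < cols b * rows b].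

Lemma exact_spectrum b k : base_of_size b k ->
  strong_convexity_spectrum (grid (cols b) (rows b)) k.
Proof.
case/and3P=> cb /eqP <- hk; have := base_spectrum cb (p := 0) (q := 0) (r := 0).
by rewrite mul0n add0n !addn0; apply=> //; left.
Qed.

Lemma right_spectrum b n k : base_of_size b k && right_free b -> cols b <= n ->
  strong_convexity_spectrum (grid n (rows b)) k.
Proof.
case/andP=> /and3P[cb /eqP <- hk] rf le.
have := base_spectrum cb (p := 0) (q := n - cols b) (r := 0).
by rewrite mul0n !add0n addn0 subnKC //; apply=> //; [left | right | left].
Qed.

Lemma both_spectrum b n p k : [&& base_of_size b k, right_free b & left_full b] ->
  p + cols b <= n -> strong_convexity_spectrum (grid n (rows b)) (p * rows b + k).
Proof.
case/and3P=> /and3P[cb /eqP <- hk] rf lf le.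
have := base_spectrum cb (p := p) (q := n - (p + cols b)) (r := 0).
by rewrite addn0 subnKC //; apply=> //; [left | right | right].
Qed.

Lemma corner_free_spectrum b n m k : [&& base_of_size b k, right_free b & bottom_free b] ->
  cols b <= n -> rows b <= m -> strong_convexity_spectrum (grid n m) k.
Proof.
case/and3P=> /and3P[cb /eqP <- hk] rf bf len lem.
have := base_spectrum cb (p := 0) (q := n - cols b) (r := m - rows b).
by rewrite mul0n !add0n !subnKC //; apply=> //; [right | right | left].
Qed.

(** Maximality is checked in the weaker form that a convex set is the whole grid or has at most 7
    vertices, by the branching of [small] instead of closures of arcs. *)
Lemma seven_spectrum_4_4 : strong_convexity_spectrum (grid 4 4) 7.
Proof.
pose b := Base 4 4 2085 1808 1651; pose e := edgeb b.
pose t := interval_table 16 (dist_table 16 e).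
have /and3P[sb cb sm] : [&& strongb 16 (dist_table 16 e),
    convexb 16 (fun i => foldS b (cell_of b i)) t & small 16 t 7 (iota 0 16) 0%num 0%num 0].
  by vm_cast_no_check (erefl true).
have inj i j (_ : i < 16) (_ : j < 16) : cell_of b i = cell_of b j -> i = j by apply: cell_of_inj.
have arcE i j (_ : i < 16) (_ : j < 16) :
  e i j <-> arc (foldH b) (foldV b) (cell_of b i) (cell_of b j) by apply: arcbP.
apply: (@spectrum_intro 4 4 0 (foldH b) (foldV b) (foldS b)).
- have /eqP sz : base_size b == 7 by [].
  by have := base_card b 0 (or_introl erefl : 0 = 0 \/ 0 = 0).
- by [].
- exact: (connected_push (@cell_of_box b) (@cell_of_onto b) arcE (strongb_connected sb)).
- exact: (geoconvex_push (@cell_of_box b) (@cell_of_onto b) inj arcE (convexb_geoconvex sb cb)).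
move=> T gT _ _; have gP := geoconvex_pull (@cell_of_box b) (@cell_of_onto b) inj arcE gT.
have s0 (P : nat -> Prop) u : inN 0%num u -> P u by rewrite /inN N.bits_0.
have todo u : u < 16 /\ T (cell_of b u) -> u \in [::] ++ iota 0 16.
  by case=> un _; rewrite mem_iota.
have [full|[s sz sT]] := smallP (kept := [::]) sb gP (s0 _) (s0 _) todo sm => {sb cb sm}.
  by left=> c /(@cell_of_onto b)[i lt <-]; case: (full i lt).
right; exists [seq cell_of b i | i <- s]; first by rewrite size_map.
move=> c Tc; have [i lt Ei] := @cell_of_onto b c (gT.1 _ Tc).
have := sT i; rewrite Ei => /(_ (conj lt Tc)); rewrite -Ei.
elim: s {sz sT} => //= j s IH; rewrite inE => /orP[/eqP <-|/IH]; first by left.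
by right.
Qed.

(** With four rows [inner_tail] admits only the empty list, so most sizes below the corner range use
    bases. Each full column added on the left contributes 4, and bases of sizes 10 to 13 represent
    all residues. *)
Lemma spectrum4 n k : 4 <= n -> (1 <= k <= n * 4 - 4) && (k \notin [:: 2; 3; 5]) ->
  strong_convexity_spectrum (grid n 4) k.
Proof.
move=> n4; rewrite !inE => hk; case: (leqP (2 * n + 2) k) => hk'.
  by apply: corner_range; lia.
have [->|k1] := eqVneq k 1; first by apply: one_spectrum; lia.
have [->|k4] := eqVneq k 4; first by apply: (@inner_tail n 4 [::] 2) => //; lia.
have [->|k6] := eqVneq k 6.
  by apply: (@right_spectrum (Base 4 4 1387 21044 238)); [vm_compute | rewrite /=; lia..].
have [->|k8] := eqVneq k 8.
  by apply: (@right_spectrum (Base 4 4 1347 21104 255)); [vm_compute | rewrite /=; lia..].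
(* On the 4 by 4 grid the corner range starts at 10, which leaves 7 and 9. *)
have [E4|n5] := eqVneq n 4; first rewrite {}E4 in hk' *.
  have [->|k7] := eqVneq k 7; first exact: seven_spectrum_4_4.
  have -> : k = 9 by lia.
  by apply: (@exact_spectrum (Base 4 4 443 29540 3822)); vm_compute.
have {n4 n5} n5 : 4 < n by lia.
have [->|k7] := eqVneq k 7.
  by apply: (@right_spectrum (Base 5 4 41305 151588 1772)); [vm_compute | rewrite /=; lia..].
have [->|k9] := eqVneq k 9.
  by apply: (@right_spectrum (Base 5 4 42619 153348 3822)); [vm_compute | rewrite /=; lia..].
pose p := (k - 10) %/ 4.
have [E|[E|[E|E]]] : k = p * 4 + 10 \/ k = p * 4 + 11 \/ k = p * 4 + 12 \/ k = p * 4 + 13.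
- by rewrite /p; lia.
- by rewrite E; apply: (@both_spectrum (Base 5 4 43338 153125 3327));
    [vm_compute | rewrite /=; lia].
- by rewrite E; apply: (@both_spectrum (Base 5 4 21669 336722 3839));
    [vm_compute | rewrite /=; lia].
- by rewrite E; apply: (@both_spectrum (Base 5 4 43610 153381 4095));
    [vm_compute | rewrite /=; lia].
by rewrite E; apply: (@both_spectrum (Base 6 4 694474 2434341 52991));
    [vm_compute | rewrite /=; lia].
Qed.

Lemma seven_spectrum n m : 5 <= n -> 5 <= m -> strong_convexity_spectrum (grid n m) 7.
Proof.
by move=> n5 m5; apply: (@corner_free_spectrum (Base 5 5 696970 5571911 6371));
  [vm_compute | rewrite /=; lia..].
Qed.

Lemma spectrum5 n k : 5 <= n -> (1 <= k <= n * 5 - 5) && (k \notin [:: 2; 3; 5]) ->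
  strong_convexity_spectrum (grid n 5) k.
Proof.
move=> n5; rewrite !inE => hk; case: (leqP (2 * n + 4) k) => hk'.
  by apply: corner_range; lia.
have [->|k1] := eqVneq k 1; first by apply: one_spectrum; lia.
have [->|k4] := eqVneq k 4; first by apply: (@inner_tail n 5 [::] 2) => //; lia.
have [->|k6] := eqVneq k 6; first by apply: (@inner_tail n 5 [:: 2] 2) => //; lia.
have [->|k7] := eqVneq k 7; first exact: seven_spectrum.
have [->|k8] := eqVneq k 8; first by apply: (@inner_tail n 5 [:: 2] 3) => //; lia.
have [->|k9] := eqVneq k 9; first by apply: (@inner_tail n 5 [:: 3] 3) => //; lia.
have [->|k11] := eqVneq k 11.
  by apply: (@right_spectrum (Base 5 5 719498 5578085 29662)); [vm_compute | rewrite /=; lia..].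
pose p := (k - 10) %/ 5.
(* The size 11 being settled, the residue 1 starts at 16, one full column later than the others,
   hence [p.-1]. *)
have [E|[E|[E|[E|E]]]] : k = p * 5 + 10 \/ k = p * 5 + 12 \/ k = p * 5 + 13 \/
    k = p * 5 + 14 \/ k = p.-1 * 5 + 16.
- by rewrite /p; lia.
- by rewrite E; apply: (@both_spectrum (Base 5 5 341866 10656069 1023));
    [vm_compute | rewrite /=; lia].
- by rewrite E; apply: (@both_spectrum (Base 5 5 343786 10651973 25599));
    [vm_compute | rewrite /=; lia].
- by rewrite E; apply: (@both_spectrum (Base 5 5 353930 10656069 29695));
    [vm_compute | rewrite /=; lia].
- by rewrite E; apply: (@both_spectrum (Base 5 5 335018 10662213 31743));
    [vm_compute | rewrite /=; lia].
by rewrite E; apply: (@both_spectrum (Base 6 5 22619274 178624837 947199));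
    [vm_compute | rewrite /=; lia].
Qed.

Lemma spectrum6 n m k : 6 <= m -> m <= n ->
  (1 <= k <= n * m - 6) && (k \notin [:: 2; 3; 5]) -> strong_convexity_spectrum (grid n m) k.
Proof.
move=> m6 mn; rewrite !inE => hk.
case: (leqP (n * m - m) k.-1) => hk1; first by apply: notch_range; nia.
case: (leqP (2 * n + 2 * m - 6) k) => hk2; first by apply: corner_range; lia.
have [->|k1] := eqVneq k 1; first by apply: one_spectrum; lia.
have [->|k4] := eqVneq k 4; first by apply: (@inner_tail n m [::] 2) => //=; lia.
have [->|k6] := eqVneq k 6; first by apply: (@inner_tail n m [:: 2] 2) => //=; lia.
have [->|k7] := eqVneq k 7; first by apply: seven_spectrum; lia.
have [->|k9] := eqVneq k 9; first by apply: (@inner_tail n m [:: 3] 3) => //=; lia.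
(* Only [m = n] leaves this size below the corner range. Splitting it over four rows would require
   the width [n - 1], beyond the limit of [inner_tail]; five rows are used instead, and the 6 by 6
   grid, too low for them, is computed. *)
have [E|E] := eqVneq k (4 * n - 7).
  have Emn : m = n by lia.
  have [n6|n6] := eqVneq n 6.
    rewrite E Emn n6; apply: (@exact_spectrum (Base 6 6 510962538 17540116631 820236092)).
    by vm_compute.
  have -> : k = sumn [:: 2; n - 3; n - 2] + 2 * (n - 2) by rewrite /=; lia.
  by apply: inner_tail => /=; lia.
pose q := k %/ 4.
(* Four nearly equal rows. As the last two widths coincide, remainder 1 takes [q.+1] twice and is
   balanced by [q.-1]; for [k = 9] this would be a row of width 1, hence its separate treatment
   above. *)
have [e|[e|[e|e]]] : k = sumn [:: q; q] + 2 * q \/ k = sumn [:: q.-1; q] + 2 * q.+1 \/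
   k = sumn [:: q; q] + 2 * q.+1 \/ k = sumn [:: q; q.+1] + 2 * q.+1.
- by rewrite /q /=; lia.
all: by rewrite e; apply: inner_tail => /=; rewrite /= in e; lia.
Qed.

Theorem theorem23 (n m : nat) (hm : 4 <= m) (hmn : m <= n) :
  let SSC :=
    strong_convexity_spectrum
      (cartesian_product (@path_graph n) (@path_graph m)) in
  [/\ m = 4 ->
        forall k : nat,
          SSC k <-> (1 <= k <= n * m - 4) && (k \notin [:: 2; 3; 5]),
      m = 5 ->
        forall k : nat,
          SSC k <-> (1 <= k <= n * m - 5) && (k \notin [:: 2; 3; 5])
    & 6 <= m ->
        forall k : nat,
          SSC k <-> (1 <= k <= n * m - 6) && (k \notin [:: 2; 3; 5])].
Proof.
move=> SSC; rewrite /SSC; split=> [E|E|m6] k; rewrite ?E in hmn *.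
- by split; [apply: spectrum_bound => //; lia | apply: spectrum4].
- by split; [apply: spectrum_bound => //; lia | apply: spectrum5].
by split; [apply: spectrum_bound => //; lia | apply: spectrum6].
Qed.
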